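(* Let the setting be as fixed in the context (space dimension $2$, $\eta\in(0,\infty)$, $\gamma\in(\tfrac12,\infty)$, nonlinearity $F(w)=R(\eta w-w_1\partial_1w-w_2\partial_2w)$). Let $(\varphi_k)_{k\in\mathbb{Z}}\subseteq\mathcal{C}((0,1),\mathbb{R})$, $(\phi_{k,l})_{k,l\in\mathbb{Z}}\subseteq\mathcal{C}(\mathcal{D},\mathbb{R})$, $(e_{i,j,0})_{i,j\in\mathbb{Z}}\subseteq U$, $e_{0,0,1}\in U$. Assume $\mathbb{H}=\{e_{0,0,1}\}\cup\{e_{i,j,0}:i,j\in\mathbb{Z}\}$, and assume for all $n\in\mathbb{N}$, $(k,l)\in\mathbb{Z}^2\setminus\{(0,0)\}$, $v\in H_\gamma$, $x,y\in(0,1)$ that $\varphi_0(x)=1$, $\varphi_n(x)=\sqrt2\cos(2n\pi x)$, $\varphi_{-n}(x)=\sqrt2\sin(2n\pi x)$, $\phi_{k,l}(x,y)=\varphi_k(x)\varphi_l(y)$, that $e_{0,0,0}$ and $e_{0,0,1}$ are the equivalence classes of the constant functions $(1,0)$ and $(0,1)$ on $\mathcal{D}$, that $e_{k,l,0}$ is the equivalence class of $$\mathcal{D}\ni(x,y)\mapsto\tfrac1{\sqrt{k^2+l^2}}\big(l\,\phi_{k,l}(x,y),\ k\,\phi_{-k,-l}(x,y)\big)\in\mathbb{R}^2,$$ that $\lambda_{e_{k,l,0}}=-\eta-4\pi^2(k^2+l^2)$, $\lambda_{e_{0,0,0}}=\lambda_{e_{0,0,1}}=-\eta$, and that $$r(v)\ge\max\Big\{\sqrt\vartheta+\varepsilon\|v\|_H^2,\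 \eta\|v\|_H+6\Big[\eta^{-2\gamma}+\sum_{i,j\in\mathbb{Z}}\big(\eta+4\pi^2(i^2+j^2)\big)^{-2\gamma}\Big]^{1/2}\|v\|_{H_\gamma}^2\Big\}.$$ Then $$\sup_{\theta\in\varpi_T}\ \sup_{I\in\mathcal{P}_0(\mathbb{H})}\ \sup_{J\in\mathcal{P}_0(\mathbb{U})}\ \sup_{t\in[0,T]}\ \mathbb{E}\Big[\exp\Big(\tfrac{\varepsilon\|Y^{\theta,I,J}_t\|_H^2}{e^{2(\eta+\varepsilon\vartheta)t}}\Big)\Big]<\infty.$$
   Context: Setting. $\mathcal{D}=(0,1)^2$, $\mu_{\mathcal D}$ is Lebesgue measure on $\mathcal D$, $\eta\in(0,\infty)$, $\gamma\in(\tfrac12,\infty)$, $T,\varepsilon\in(0,\infty)$, $\delta\in(0,\tfrac1{18})$, $U=L^2(\mu_{\mathcal D};\mathbb{R}^2)$ with its usual scalar product and norm, $\mathbb{U}$ is an orthonormal basis of $U$, $H\subseteq U$ is a closed subspace of $U$ (with the induced scalar product), $\mathbb{H}\subseteq H$ is a non-empty orthonormal basis of $H$, $\lambda\colon\mathbb{H}\to\mathbb{R}$, $h\mapsto\lambda_h$, satisfies $\sup_{h\in\mathbb{H}}\lambda_h<0$. $(\Omega,\mathcal{F},\mathbb{P},(\mathcal{F}_t)_{t\in[0,T]})$ is a filtered probability space, $(W_t)_{t\in[0,T]}$ is an $\mathrm{Id}_U$-cylindrical $(\mathcal{F}_t)_{t\in[0,T]}$-Wiener process, $Q\in L(U)$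 is a non-negative symmetric trace class operator. $A\colon D(A)\subseteq H\to H$ is the linear operator with $D(A)=\{w\in H:\sum_{h\in\mathbb{H}}|\lambda_h\langle h,w\rangle_H|^2<\infty\}$, $Av=\sum_{h\in\mathbb{H}}\lambda_h\langle h,v\rangle_Hh$. $H_s$, $s\in\mathbb{R}$, are the interpolation spaces associated to $-A$; for $s\ge0$: $H_s=\{v\in H:\sum_{h\in\mathbb{H}}|\lambda_h|^{2s}|\langle h,v\rangle_H|^2<\infty\}$, $\|v\|_{H_s}=\|(-A)^sv\|_H$. $r\colon H_\gamma\to[0,\infty)$ and $b\colon\mathcal{D}\times\mathbb{R}^2\to\mathbb{R}^{2\times2}$ are Borel measurable with $\sup_{x\in\mathcal D,\,y\in\mathbb{R}^2,\,z\in\mathbb{R}^2\setminus\{y\}}\big(\|b(x,y)\|_{\mathbb{R}^{2\times2}}+\tfrac{\|b(x,y)-b(x,z)\|_{\mathbb{R}^{2\times2}}}{\|y-z\|_{\mathbb{R}^2}}\big)<\infty$, where $\|\cdot\|_{\mathbb{R}^{2\times2}}$ is the operator norm induced by the Euclidean norm. $\vartheta=\operatorname{trace}_U(Q)\,\sup_{x\in\mathcal D,y\in\mathbb{R}^2}\|b(x,y)\|_{\mathbb{R}^{2\times2}}^2$ and $c\in[2\max\{1,\varepsilon\sqrt\vartheta,\varepsilon\},\infty)$. For $I\subseteq\mathbb{H}$, $J\subseteq\mathbb{U}$: $P_I(v)=\sum_{h\in I}\langle h,v\rangle_Hh$ for $v\in H$, and $\hat P_J(w)=\sum_{u\in J}\langle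 u,w\rangle_Uu$ for $w\in U$. $R\in L(U)$ is the orthogonal projection of $U$ on $H$. $\partial_1,\partial_2$ denote weak partial derivatives on $W^{1,2}(\mathcal D,\mathbb{R}^2)$. $F\colon H_\gamma\to H$, $B\colon H_\gamma\to\mathrm{HS}(U,H)$ (Hilbert–Schmidt operators) are functions and $\xi\colon\Omega\to H_\gamma$ is $\mathcal{F}_0/\mathcal{B}(H_\gamma)$-measurable such that: $\mathbb{E}[e^{\varepsilon\|\xi\|_H^2}]<\infty$; for every Borel function $v\colon\mathcal D\to\mathbb{R}^2$ whose equivalence class $[v]$ lies in $H_\gamma$ and every $u\in U$, $B([v])u=R\big([x\mapsto b(x,v(x))](\sqrt Qu)\big)$ (pointwise matrix-vector product); and $F(w)=R\big(\eta w-\sum_{i=1}^2w_i\,\partial_iw\big)$ for all $w=(w_1,w_2)\in H_\gamma\cap W^{1,2}(\mathcal D,\mathbb{R}^2)\cap L^\infty(\mu_{\mathcal D};\mathbb{R}^2)$. Scheme. $Y^{\theta,I,J}\colon[0,T]\times\Omega\to P_I(H)$, $\theta\in\varpi_T$, $I\in\mathcal{P}_0(\mathbb{H})$, $J\in\mathcal{P}_0(\mathbb{U})$, are $(\mathcal{F}_t)_{t\in[0,T]}$-adapted stochastic processes with continuous sample paths such that for all $t\in(0,T]$, $\theta,I,J$: $Y^{\theta,I,J}_0=P_I(\xi)$ and, $\mathbb{P}$-almost surely, with $\tau=\llcorner t\lrcorner_\theta$ and $\chi=1$ if $r(Y^{\theta,I,J}_\tau)\le c\,[|\theta|_T]^{-\delta}$,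 $\chi=0$ otherwise, $$Y^{\theta,I,J}_t=e^{(t-\tau)A}\big(Y^{\theta,I,J}_\tau+\chi\,P_IF(Y^{\theta,I,J}_\tau)(t-\tau)\big)+\frac{\int_\tau^te^{(t-\tau)A}\,\chi\,P_IB(Y^{\theta,I,J}_\tau)\hat P_J\,dW_s}{1+\big\|\int_\tau^tP_IB(Y^{\theta,I,J}_\tau)\hat P_J\,dW_s\big\|_H^2}.$$ Notation. $\mathcal{P}_0(X)$: set of finite subsets of $X$. $\varpi_T$: set of all finite $\theta\subseteq[0,T]$ with $\{0,T\}\subseteq\theta$; $|\theta|_T$: maximal distance between consecutive points of $\theta$; $\llcorner t\lrcorner_\theta=\max([0,t)\cap\theta)$ for $t\in(0,T]$. *)

(* Defs.v *)
From HB Require Import structures.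
From mathcomp Require Import all_boot all_order all_algebra.
From mathcomp Require Import generic_quotient ring_quotient.
From mathcomp Require Import all_classical all_reals all_analysis.
From mathcomp Require Import ring lra.

Set Implicit Arguments.
Unset Strict Implicit.
Unset Printing Implicit Defensive.
Import Order.TTheory GRing.Theory Num.Theory numFieldNormedType.Exports.
Local Open Scope classical_set_scope.
Local Open Scope ring_scope.

(* L^2(mu; R^2): pairs of square integrable functions modulo equality mu-almost
   everywhere; the library has no module or norm structure on its L^p spaces *)
Section L2.
Context d (T : measurableType d) (R : realType).
Variable mu : {measure set T -> \bar R}.

Definition L2fun : Type :=
  (LfunType mu (lee1n 2) * LfunType mu (lee1n 2))%type.
HB.instance Definition _ := GRing.Lmodule.on L2fun.

Definition L2null : {pred L2fun} :=
  [pred f : L2fun | `[< {ae mu, forall x, f.1 x = 0 /\ f.2 x = 0} >]].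

Lemma L2null_zmod_closed : zmod_closed L2null.
Proof.
split.
  by apply/asboolP; exact: nearW.
move=> f g /asboolP hf /asboolP hg; apply/asboolP.
by apply: filterS2 hf hg => x [f1 f2] [g1 g2] /=; split;
  rewrite ?fctE ?f1 ?f2 ?g1 ?g2 subr0.
Qed.

HB.instance Definition _ := GRing.isZmodClosed.Build L2fun L2null
  L2null_zmod_closed.

Definition L2 : Type := Quotient.quot L2null.
HB.instance Definition _ := GRing.Zmodule.on L2.

Definition L2class (f : L2fun) : L2 := (\pi_(Quotient.quot L2null) f)%qT.
Definition L2rep (u : L2) : L2fun := repr u.

Lemma L2repK : cancel L2rep L2class.
Proof. exact: reprK. Qed.

Lemma L2_eqP (f g : L2fun) :
  L2class f = L2class g <->
  {ae mu, forall x, f.1 x = g.1 x /\ f.2 x = g.2 x}.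
Proof.
split.
  move/eqP. rewrite -Quotient.idealrBE => /asboolP.
  apply: filterS => x /=. rewrite !fctE => -[h1 h2].
  by split; apply/eqP; rewrite -subr_eq0; apply/eqP.
move=> h; apply/eqP; rewrite -Quotient.idealrBE; apply/asboolP.
by apply: filterS h => x /= [h1 h2]; rewrite !fctE h1 h2 !subrr.
Qed.

Lemma L2_piP (u : L2) : exists f, u = (L2class f).
Proof. by exists (L2rep u); rewrite L2repK. Qed.

Lemma L2_reprP (u : L2) (f : L2fun) : u = (L2class f) ->
  {ae mu, forall x, (L2rep u).1 x = f.1 x /\ (L2rep u).2 x = f.2 x}.
Proof. by move=> uf; apply/L2_eqP; rewrite L2repK. Qed.

Definition L2scale (a : R) (u : L2) : L2 := L2class (a *: L2rep u).

Lemma L2scale_pi a (f : L2fun) :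
  L2scale a (L2class f) = L2class (a *: f).
Proof.
apply/L2_eqP; have := @L2_reprP (L2class f) f erefl.
by apply: filterS => x /= [h1 h2]; rewrite !fctE h1 h2.
Qed.

Lemma L2piD (f g : L2fun) : L2class (f + g) = L2class f + L2class g.
Proof. exact: (@Quotient.pi_add _ (L2null : zmodClosed L2fun) f g). Qed.

Let L2scaleA a b u : L2scale a (L2scale b u) = L2scale (a * b) u.
Proof. by case: (L2_piP u) => f ->; rewrite !L2scale_pi scalerA. Qed.

Let L2scale1 : left_id 1 L2scale.
Proof. by move=> u; case: (L2_piP u) => f ->; rewrite L2scale_pi scale1r. Qed.

Let L2scaleDr : right_distributive L2scale +%R.
Proof.
move=> a u v; case: (L2_piP u) => f ->; case: (L2_piP v) => g ->.
by rewrite -L2piD !L2scale_pi -L2piD scalerDr.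
Qed.

Let L2scaleDl u : {morph L2scale^~ u : a b / a + b}.
Proof.
move=> a b /=; case: (L2_piP u) => f ->.
by rewrite !L2scale_pi -L2piD scalerDl.
Qed.

HB.instance Definition _ := GRing.Zmodule_isLmodule.Build R L2
  L2scaleA L2scale1 L2scaleDr L2scaleDl.

Lemma L2piZ a (f : L2fun) : L2class (a *: f) = a *: L2class f.
Proof. by rewrite -L2scale_pi. Qed.

Definition L2dot_fun (f g : L2fun) : R :=
  Rintegral mu setT (fun x => f.1 x * g.1 x + f.2 x * g.2 x).

Lemma L2dot_integrable (f g : L2fun) :
  mu.-integrable setT (fun x => (f.1 x * g.1 x + f.2 x * g.2 x)%:E).
Proof.
have h (u v : LfunType mu (lee1n 2)) :
    mu.-integrable setT (fun x => (u x * v x)%:E).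
  exact/Lfun1_integrable/Lfun2_mul_Lfun1/LfunP/LfunP.
rewrite (_ : (fun _ => _) = ((fun x => (f.1 x * g.1 x)%:E) \+
  (fun x => (f.2 x * g.2 x)%:E))%E); last by apply/funext.
by apply: integrableD => //; exact: h.
Qed.

Lemma eq_L2dot_fun (f f' g g' : L2fun) :
  L2class f = L2class f' -> L2class g = L2class g' ->
  L2dot_fun f g = L2dot_fun f' g'.
Proof.
move=> /L2_eqP ff' /L2_eqP gg'; congr fine.
apply: ae_eq_integral => //.
- by case/integrableP: (L2dot_integrable f g).
- by case/integrableP: (L2dot_integrable f' g').
by apply: filterS2 ff' gg' => x [-> ->] [-> ->].
Qed.

Lemma L2dot_funC f g : L2dot_fun f g = L2dot_fun g f.
Proof. by apply: eq_Rintegral => x _; rewrite mulrC [X in _ + X]mulrC. Qed.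

Lemma L2dot_funP a (f g h : L2fun) :
  L2dot_fun (a *: f + g) h = a * L2dot_fun f h + L2dot_fun g h.
Proof.
rewrite /L2dot_fun -RintegralZl//; last exact: L2dot_integrable.
rewrite -RintegralD//.
- apply: eq_Rintegral => x _.
  have -> : (a *: f + g).1 x = a * f.1 x + g.1 x by [].
  have -> : (a *: f + g).2 x = a * f.2 x + g.2 x by [].
  by ring.
- have := integrableZl measurableT a (L2dot_integrable f h).
  by apply: eq_integrable => // x _.
- exact: L2dot_integrable.
Qed.

Definition L2dot (u v : L2) : R := L2dot_fun (L2rep u) (L2rep v).

Lemma L2dotE (f g : L2fun) :
  L2dot (L2class f) (L2class g) = L2dot_fun f g.
Proof. by apply: eq_L2dot_fun; rewrite L2repK. Qed.

Lemma L2dotC u v : L2dot u v = L2dot v u.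
Proof. exact: L2dot_funC. Qed.

Lemma L2dotP a u v w : L2dot (a *: u + v) w = a * L2dot u w + L2dot v w.
Proof.
case: (L2_piP u) (L2_piP v) (L2_piP w) => f -> [g ->] [h ->].
rewrite -L2piZ -L2piD !L2dotE.
exact: L2dot_funP.
Qed.

Lemma L2dotDl u v w : L2dot (u + v) w = L2dot u w + L2dot v w.
Proof. by rewrite -{1}[u]scale1r L2dotP mul1r. Qed.

Lemma L2dot0l w : L2dot 0 w = 0.
Proof. by apply: (@addrI _ (L2dot 0 w)); rewrite -L2dotDl !addr0. Qed.

Lemma L2dotZl a u w : L2dot (a *: u) w = a * L2dot u w.
Proof. by rewrite -[a *: u]addr0 L2dotP L2dot0l addr0. Qed.

Lemma L2dot_ge0 u : 0 <= L2dot u u.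
Proof.
apply: Rintegral_ge0 => //.
by move=> x _; rewrite -!expr2 addr_ge0// sqr_ge0.
Qed.

Lemma L2dot_eq0 u : L2dot u u = 0 -> u = 0.
Proof.
set f := L2rep u => h.
have i := L2dot_integrable f f.
have mi := measurable_int _ i.
have g0 x : 0 <= f.1 x * f.1 x + f.2 x * f.2 x.
  by rewrite -!expr2 addr_ge0// sqr_ge0.
have : (\int[mu]_x `|(f.1 x * f.1 x + f.2 x * f.2 x)%:E| = 0)%E.
  under eq_integral do rewrite gee0_abs ?lee_fin ?g0//.
  rewrite -[LHS]fineK; last exact: integrable_fin_num.
  by rewrite [X in X%:E]h.
move/(ae_eq_integral_abs mu measurableT mi) => f0.
rewrite -[u]L2repK -/f; have -> : 0 = L2class 0 :> L2.
  by apply: (@addrI _ (L2class 0)); rewrite -L2piD !addr0.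
apply/L2_eqP; apply: filterS f0 => x /(_ I) /= [] /eqP.
rewrite paddr_eq0 -?expr2 ?sqr_ge0// !sqrf_eq0 => /andP[/eqP-> /eqP->].
by split.
Qed.

Definition L2norm (u : L2) : R := Num.sqrt (L2dot u u).

Lemma L2cauchy_schwarz u v : L2dot u v <= L2norm u * L2norm v.
Proof.
rewrite /L2norm -sqrtrM ?L2dot_ge0//.
apply: le_trans (ler_norm _) _; rewrite -sqrtr_sqr ler_sqrt.
  2: by rewrite mulr_ge0 ?L2dot_ge0.
set a := L2dot u v; set b := L2dot v v.
have [v0|v0] := eqVneq b 0.
  have -> : a = 0 by rewrite /a (L2dot_eq0 v0) L2dotC L2dot0l.
  by rewrite v0 mulr0 expr0n.
have bp : 0 < b by rewrite lt_neqAle eq_sym v0 L2dot_ge0.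
pose w := b *: u + (- a) *: v.
have wE : L2dot w w = b * (L2dot u u * b - a ^+ 2).
  rewrite {1}/w L2dotP L2dotZl !(L2dotC _ w) /w !L2dotP !L2dotZl (L2dotC v u).
  by rewrite -/a -/b; ring.
have := L2dot_ge0 w; rewrite wE.
by rewrite pmulr_rge0// subr_ge0.
Qed.

Let L2norm_triangle u v : L2norm (u + v) <= L2norm u + L2norm v.
Proof.
rewrite -(@ler_pXn2r _ 2)// ?nnegrE ?addr_ge0 ?sqrtr_ge0//.
rewrite sqr_sqrtr ?L2dot_ge0// sqrrD !sqr_sqrtr ?L2dot_ge0//.
rewrite L2dotDl !(L2dotC _ (u + v)) !L2dotDl (L2dotC v u).
have := L2cauchy_schwarz u v; lra.
Qed.

Let L2normZ a u : L2norm (a *: u) = `|a| * L2norm u.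
Proof.
by rewrite /L2norm L2dotZl L2dotC L2dotZl mulrA -expr2 sqrtrM ?sqr_ge0//
  sqrtr_sqr.
Qed.

Let L2norm_eq0 u : L2norm u = 0 -> u = 0.
Proof.
move=> /eqP; rewrite sqrtr_eq0 => h; apply: L2dot_eq0.
by apply/eqP; rewrite eq_le h L2dot_ge0.
Qed.

HB.instance Definition _ := Lmodule_isNormed.Build R L2
  L2norm_triangle L2normZ L2norm_eq0.

Lemma L2normE (u : L2) : `|u| = Num.sqrt (L2dot u u).
Proof. by []. Qed.
End L2.

Notation plane R := (measurableTypeR R * measurableTypeR R)%type.

Section spaces.
Context (R : realType).

Definition sqD : set (plane R) := `]0, 1[%classic `*` `]0, 1[%classic.

Lemma measurable_sqD : measurable sqD.
Proof. by apply: measurableX; exact: measurable_itv. Qed.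

Definition muD : {measure set (plane R) -> \bar R} :=
  mrestr (lebesgue_measure \x lebesgue_measure)%E measurable_sqD.

(* functions on the whole plane, but muD only sees their restriction to sqD *)
Definition Uspace : Type := L2 muD.
HB.instance Definition _ := NormedModule.on Uspace.

Definition Uval (u : Uspace) (x : plane R) : plane R :=
  ((L2rep u).1 x, (L2rep u).2 x).

(* v is a Borel function on sqD whose equivalence class is u *)
Definition is_class (v : plane R -> plane R) (u : Uspace) : Prop :=
  measurable_fun sqD v /\ {ae muD, forall x, Uval u x = v x}.

(* 0 if v is not measurable on sqD or not square integrable *)
Definition cls (v : plane R -> plane R) : Uspace := xget 0 (is_class v).
End spaces.

Section plane_algebra.
Context (R : realType).
Implicit Types (y : plane R) (M : 'M[R]_2).

Definition pcoord (i : 'I_2) y : R := if i == 0 then y.1 else y.2.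
Definition pscale (a : R) y : plane R := (a * y.1, a * y.2).
Definition psub y z : plane R := (y.1 - z.1, y.2 - z.2).
Definition pnorm y : R := Num.sqrt (y.1 ^+ 2 + y.2 ^+ 2).
Definition mxact M y : plane R :=
  (M 0 0 * y.1 + M 0 1 * y.2, M 1 0 * y.1 + M 1 1 * y.2).
Definition opnorm M : R :=
  sup [set pnorm (mxact M y) | y in [set y | pnorm y <= 1]].
End plane_algebra.

Section weak_derivatives.
Context (R : realType).
Implicit Types (f phi : R * R -> R).

Definition pslice (i : 'I_2) f (p : R * R) : R -> R :=
  if i == 0 then fun s => f (s, p.2) else fun s => f (p.1, s).

Definition pderiv (i : 'I_2) f (p : R * R) : R := derive1 (pslice i f p) (pcoord i p).

(* all iterated partial derivatives exist and are continuous *)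
Definition smooth f : Prop :=
  forall s : seq 'I_2, let g := foldr pderiv f s in
    continuous g /\
    forall i p, derivable (pslice i g p) (pcoord i p) 1.

Definition test_fun phi : Prop :=
  smooth phi /\
  exists K : set (R * R),
    [/\ compact K, K `<=` @sqD R & forall x, ~ K x -> phi x = 0].

Definition is_wderiv (i : 'I_2) (w g : Uspace R) : Prop :=
  forall phi, test_fun phi -> forall j : 'I_2,
    Rintegral (muD R) setT (fun x => pcoord j (Uval w x) * pderiv i phi x) =
    - Rintegral (muD R) setT (fun x => pcoord j (Uval g x) * phi x).

Definition ess_bounded (w : Uspace R) : Prop :=
  exists C : R, {ae muD R, forall x, pnorm (Uval w x) <= C}.
End weak_derivatives.

Section hilbert.
Context (R : realType).
Local Notation U := (Uspace R).
Implicit Types (S H HH UU I : set U) (u v w : U) (Q G : U -> U).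

Definition closed_subspace H : Prop :=
  [/\ closed H, H 0 & forall (a : R) u v, H u -> H v -> H (a *: u + v)].

Definition orthonormal S : Prop :=
  forall u v, S u -> S v -> L2dot u v = if u == v then 1 else 0.

Definition lin_span S : set U :=
  [set v | exists (s : seq U) (a : U -> R),
     {in s, forall u, S u} /\ v = \sum_(u <- s) a u *: u].

Definition orthonormal_basis H S : Prop :=
  orthonormal S /\ closure (lin_span S) = H.

(* unconditional summation of families of vectors *)
Definition has_usum S (f : U -> U) v : Prop :=
  forall e : R, 0 < e -> exists2 A, finite_set A /\ A `<=` S &
    forall B, finite_set B -> A `<=` B -> B `<=` S ->
      `| \sum_(u \in B) f u - v | < e.

Definition usum S (f : U -> U) : U := xget 0 (has_usum S f).

Definition projI I v : U := usum I (fun h => L2dot h v *: h).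

Definition orth_projection H (P : U -> U) : Prop :=
  forall u, H (P u) /\ forall h, H h -> L2dot h (u - P u) = 0.

(* g(A) for the diagonal operator A with eigenvalues lam on the basis HH, so
   that A itself is [diag_op HH lam id] *)
Definition diag_op HH (lam : U -> R) (g : R -> R) v : U :=
  usum HH (fun h => (g (lam h) * L2dot h v) *: h).

Definition semigroup HH lam (t : R) : U -> U :=
  diag_op HH lam (fun l => expR (t * l)).

(* the interpolation spaces of -A, for s >= 0 *)
Definition Hs H HH (lam : U -> R) (s : R) : set U :=
  [set v | H v /\
    (\esum_(h in HH) (`|lam h| `^ (2 * s) * `|L2dot h v| ^+ 2)%:E < +oo)%E].

Definition Hs_norm HH lam (s : R) v : R :=
  `| diag_op HH lam (fun l => (- l) `^ s) v |.

(* Borel sigma-algebra on S of the metric given by the norm N *)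
Definition borel_on S (N : U -> R) : set (set U) :=
  <<s S, [set O | O `<=` S /\
    forall x, O x -> exists2 e : R, 0 < e & forall y, S y -> N (y - x) < e -> O y] >>.

Definition bounded_linear G : Prop := linear G /\ continuous G.

Definition symmetric_op Q : Prop := forall u v, L2dot (Q u) v = L2dot u (Q v).
Definition nonneg_op Q : Prop := forall u, 0 <= L2dot u (Q u).

(* trace class in the sense of nuclear operators: Q is the sum of the series of
   rank one operators <a k, .> b k *)
Definition trace_class Q : Prop :=
  exists a b : nat -> U,
    (\sum_(0 <= k <oo) (`|a k| * `|b k|)%:E < +oo)%E /\
    forall u, (fun n => \sum_(0 <= k < n) L2dot (a k) u *: b k) @ \oo --> Q u.

(* only meant for non-negative Q, since esum is a supremum of finite sums; UU is
   an orthonormal basis, on which the value does not depend *)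
Definition optrace UU Q : R := fine (\esum_(u in UU) (L2dot u (Q u))%:E).

Definition is_sqrt_op Q G : Prop :=
  [/\ bounded_linear G, symmetric_op G, nonneg_op G & forall u, G (G u) = Q u].

Definition hilbert_schmidt UU H G : Prop :=
  [/\ bounded_linear G, forall u, H (G u) &
      (\esum_(u in UU) (`|G u| ^+ 2)%:E < +oo)%E].

Definition finsub S : set (set U) := [set I | finite_set I /\ I `<=` S].
End hilbert.

Section grids.
Context (R : realType).
Implicit Types (theta : set R).

Definition grid (T : R) : set (set R) :=
  [set theta | [/\ finite_set theta, theta `<=` `[0, T], theta 0 & theta T]].

(* a maximum, as theta is finite *)
Definition mesh theta : R :=
  sup [set x | exists a b, [/\ theta a, theta b, a < b,
    (forall s, theta s -> ~~ (a < s < b)) & x = b - a]].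

(* the largest point of the finite set theta in [0, t) *)
Definition gfloor theta (t : R) : R := sup (`[0, t[ `&` theta).
End grids.

Section stochastics.
Context (R : realType) d (Omega : measurableType d) (P : probability Omega R).
Local Notation U := (Uspace R).

Definition filtration (T : R) (Ft : R -> set (set Omega)) : Prop :=
  [/\ forall t, 0 <= t <= T -> sigma_algebra setT (Ft t),
      forall t, 0 <= t <= T -> Ft t `<=` measurable &
      forall s t, 0 <= s -> s <= t -> t <= T -> Ft s `<=` Ft t].

(* Id_U-cylindrical Wiener process on [0, T], with W t u standing for the
   pairing of W_t with u. The last clause says that, for orthonormal u in us,
   the increments over [s, t] are N(0, t - s)-distributed and that they and
   Ft s are mutually independent. *)
Record cyl_wiener (T : R) (Ft : R -> set (set Omega))
    (W : R -> U -> Omega -> R) : Prop := {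
  cyl_wiener0 : forall u, {ae P, forall w, W 0 u w = 0};
  cyl_wiener_linear : forall t (a : R) u v, 0 <= t <= T ->
    {ae P, forall w, W t (a *: u + v) w = a * W t u w + W t v w};
  cyl_wiener_adapted : forall t u, 0 <= t <= T ->
    forall E : set (measurableTypeR R), measurable E -> Ft t (W t u @^-1` E);
  cyl_wiener_continuous : forall u,
    {ae P, forall w, {within `[0, T], continuous (fun t => W t u w)}};
  cyl_wiener_increments : forall s t (us : seq U) (E : U -> set (measurableTypeR R)) A,
    0 <= s -> s < t -> t <= T ->
    uniq us -> orthonormal [set` us] ->
    (forall u, measurable (E u)) -> Ft s A ->
    P (A `&` \bigcap_(u in [set` us]) [set w | E u (W t u w - W s u w)]) =
    (P A * \prod_(u <- us) normal_prob 0 (Num.sqrt (t - s)) (E u))%E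
}.

(* Ito integral over [s, t] of an integrand G (an operator-valued random
   variable) that is constant in time, Ft s-measurable, and vanishes at all but
   finitely many elements of the orthonormal basis UU *)
Definition stoch_int (UU : set U) (W : R -> U -> Omega -> R)
    (G : Omega -> U -> U) (s t : R) (w : Omega) : U :=
  \sum_(u \in UU) (W t u w - W s u w) *: G w u.
End stochastics.

(* Main.v *)
Require Import Defs.
From mathcomp Require Import all_boot all_order all_algebra.
From mathcomp Require Import all_classical all_reals all_analysis.
From mathcomp Require Import measurable_realfun lebesgue_measure.
From mathcomp Require Import ring lra.

Set Implicit Arguments.
Unset Strict Implicit.
Unset Printing Implicit Defensive.
Import Order.TTheory GRing.Theory Num.Theory numFieldNormedType.Exports.
Local Open Scope classical_set_scope.
Local Open Scope ring_scope.

(* On a grid step of length h ending at t, conditionally on the past, the scheme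
   is Y_t = S (Y + h P F(Y) + Z / (1 + |Z|^2)) with Z a centred Gaussian vector.
   The semigroup S is a contraction, and three deterministic bounds hold on the
   set where the truncation is active: <Y, P F(Y)> = eta |Y|^2, since the
   convection term is orthogonal to a solenoidal field; |P F(Y)| <= r(Y), by an
   energy identity and the bound |w(x)| <= 2 sum |coordinates|; and the squared
   coefficients of Z sum to at most h vartheta.  As the law of Z is symmetric,
   averaging over the sign turns the cross term into a cosh, which is bounded by
   exp (2 a^2 <z, Z>^2); the remaining exponential quadratic moment is computed
   from the Gaussian moment generating function.  This gives
   E_t <= exp (C h) E_tau for the weighted exponential moments, with C
   independent of the grid and of I and J, and one iterates along the grid. *)

(** * Gaussian exponential moments *)

(** Only an error of order [h] per step survives the iteration, while the exponent is quadratic in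
    [Y], so first-order terms proportional to [|Y|^2] must be matched exactly. There are two:
    [2 a eta h |Y|^2] from the drift and [2 a^2 h vartheta |Y|^2] from the cross term with the
    noise. As [a <= eps], the weight [exp (- 2 (eta + eps vartheta) t)] pays for both. What remains
    involves powers of the truncation radius [rho = c h^(-delta)] and is [O(h)] as soon as
    [h (1 + rho)^3] is bounded, which holds for [3 delta <= 1]. The obstacle is that a Gaussian
    quadratic form has a finite exponential moment only for small variance, which a coarse grid
    violates; there the taming denominator bounds the noise surely. This denominator is even in [Z],
    so it does not disturb the symmetry argument. Conditioning is done without conditional
    expectations: the past sigma-algebra becomes a measurable space of its own, the identity into it
    is independent of the increments, and Tonelli freezes the past. The estimates enter through
    traces and Bessel sums, hence do not see the dimensions of the Galerkin spaces. *)

Section density.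
Context d (T : measurableType d) (R : realType).
Variables (mu nu : {measure set T -> \bar R}) (p : T -> R).
Hypotheses (p_ge0 : forall x, 0 <= p x) (mp : measurable_fun setT p).
Hypothesis nuE : forall A, measurable A -> nu A = (\int[mu]_(x in A) (p x)%:E)%E.

Import HBNNSimple.

Let integral_density_nnsfun (f : {nnsfun T >-> R}) :
  (\int[nu]_x (f x)%:E = \int[mu]_x ((f x)%:E * (p x)%:E))%E.
Proof.
under [LHS]eq_integral do rewrite fimfunE -fsumEFin//.
rewrite [LHS]ge0_integral_fsum//; last 2 first.
  - by move=> r; exact/measurable_EFinP/measurableT_comp.
  - by move=> n x _; rewrite EFinM nnfun_muleindic_ge0.
under [RHS]eq_integral.
  move=> x xD; rewrite fimfunE -fsumEFin// muleC ge0_mule_fsumr; last first.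
    by move=> r; rewrite EFinM nnfun_muleindic_ge0.
  over.
rewrite [RHS]ge0_integral_fsum//; last 2 first.
  - move=> r; apply/measurable_EFinP; apply: measurable_funM => //.
    exact/measurableT_comp.
  - by move=> n x _; rewrite mule_ge0 ?nnfun_muleindic_ge0 ?lee_fin.
apply: eq_fsbigr => r; rewrite inE => -[y _ yr].
have r0 : 0 <= r by rewrite -yr.
have mA : measurable (f @^-1` [set r]) by [].
under eq_integral do rewrite EFinM.
rewrite ge0_integralZl ?lee_fin//; last first.
  exact/measurable_EFinP/measurable_indic.
rewrite integral_indic// setIT nuE//.
under [RHS]eq_integral do rewrite EFinM muleCA.
rewrite ge0_integralZl ?lee_fin//; last 2 first.
  - apply/measurable_EFinP; apply: measurable_funM => //; exact: measurable_indic.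
  - by move=> x _; rewrite mule_ge0// lee_fin.
congr (_ * _)%E; rewrite integral_mkcond; apply: eq_integral => x _.
by rewrite patchE indicE; case: ifPn => _; rewrite ?mule1 ?mule0.
Qed.

(** Indicators are the hypothesis [nuE]; simple functions follow by linearity, and general [f] by
    monotone convergence along the same approximating sequence on both sides. *)
Lemma integral_density (f : T -> \bar R) : measurable_fun setT f ->
  (forall x, 0 <= f x)%E -> (\int[nu]_x f x = \int[mu]_x (f x * (p x)%:E))%E.
Proof.
move=> mf f0; pose f_ := nnsfun_approx measurableT mf.
transitivity (lim (\int[nu]_x (f_ n x)%:E @[n --> \oo])%E).
  rewrite -monotone_convergence//=.
  - apply: eq_integral => ? /[!inE] xD; apply/esym/cvg_lim => //=.
    exact: cvg_nnsfun_approx.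
  - by move=> n; exact/measurable_EFinP/measurable_funTS.
  - by move=> n ? _; rewrite lee_fin.
  - by move=> ? _ ? ? mn; rewrite lee_fin; exact/lefP/nd_nnsfun_approx.
rewrite [RHS](_ : _ = lim
    (\int[mu]_x ((f_ n x)%:E * (p x)%:E) @[n --> \oo])%E); last first.
  rewrite -monotone_convergence//=.
  - apply: eq_integral => x _; apply/esym/cvg_lim => //.
    apply: cvgeZr => //; exact: cvg_nnsfun_approx.
  - by move=> n; apply/measurable_EFinP; exact: measurable_funM.
  - by move=> n x _; rewrite mule_ge0// lee_fin.
  - move=> x _ ? ? mn; rewrite lee_wpmul2r ?lee_fin//.
    exact/lefP/nd_nnsfun_approx.
by apply: congr_lim; apply/funext => n /=; exact: integral_density_nnsfun.
Qed.
End density.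

Section normal_integrals.
Context (R : realType).
Local Notation mu := (@lebesgue_measure R).

Lemma integral_normal_prob (m s : R) (f : R -> \bar R) : measurable_fun setT f ->
  (forall x, 0 <= f x)%E ->
  (\int[normal_prob m s]_x f x = \int[mu]_x (f x * (normal_pdf m s x)%:E))%E.
Proof.
move=> mf f0; apply: integral_density => //.
  exact: normal_pdf_ge0.
exact: measurable_normal_pdf.
Qed.

(** Completing the square: tilting the centred density by [exp (a x)] gives a constant multiple of
    the density with mean [a * s ^+ 2] and the same deviation. *)
Lemma normal_mgf (s a : R) : s != 0 ->
  (\int[normal_prob 0 s]_x (expR (a * x))%:E = (expR (a ^+ 2 * s ^+ 2 / 2))%:E)%E.
Proof.
move=> s0.
have mf : measurable_fun setT (fun x : R => (expR (a * x))%:E).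
  by apply/measurable_EFinP; apply: measurableT_comp => //; exact: mulrl_measurable.
rewrite integral_normal_prob//.
transitivity (\int[mu]_x ((expR (a ^+ 2 * s ^+ 2 / 2))%:E *
   (normal_pdf (a * s ^+ 2) s x)%:E))%E.
  apply: eq_integral => x _; rewrite -!EFinM !normal_pdfE//.
  congr EFin; rewrite !(mulrCA _ (normal_peak s)); congr (_ * _).
  rewrite /normal_fun -!expRD; congr expR.
  by field.
rewrite ge0_integralZl//.
- by rewrite integral_normal_pdf mule1.
- by apply/measurable_EFinP; exact: measurable_normal_pdf.
- by move=> x _; rewrite lee_fin normal_pdf_ge0.
Qed.

(** Tilting by [exp (m x^2)] keeps the density Gaussian: with [q^2 = 1 - 2 m] it becomes [q^-1]
    times the centred density of standard deviation [q^-1]. *)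
Lemma normal_square_mgf (m : R) : m < 1 / 2 ->
  (\int[normal_prob 0 1]_x (expR (m * x ^+ 2))%:E = (Num.sqrt (1 - 2 * m))^-1%:E)%E.
Proof.
move=> m2; rewrite integral_normal_prob; last 2 first.
  - apply/measurable_EFinP; apply: measurableT_comp => //.
    apply: measurable_funM => //; exact: measurable_funX.
  - by move=> x; rewrite lee_fin expR_ge0.
have m1 : 0 < 1 - 2 * m by lra.
pose q := Num.sqrt (1 - 2 * m); have q0 : 0 < q by rewrite sqrtr_gt0.
have q2 : q ^+ 2 = 1 - 2 * m by rewrite sqr_sqrtr ?ltW.
transitivity (\int[mu]_x ((q^-1)%:E * (normal_pdf 0 q^-1 x)%:E))%E.
  apply: eq_integral => x _; rewrite -!EFinM !normal_pdfE ?oner_eq0 ?invr_eq0 ?gt_eqF//.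
  congr EFin; rewrite mulrCA [in RHS]mulrA; congr (_ * _).
    rewrite /normal_peak exprVn -mulrnAr -[in RHS]mulrnAr expr1n mul1r.
    rewrite sqrtrM ?invr_ge0 ?sqr_ge0// sqrtrV ?sqr_ge0// sqrtr_sqr gtr0_norm//.
    by rewrite invfM invrK mulrA mulVf ?gt_eqF// mul1r.
  rewrite /normal_fun -!expRD; congr expR.
  rewrite exprVn q2 expr1n; field.
  by rewrite gt_eqF.
rewrite ge0_integralZl//.
- by rewrite integral_normal_pdf mule1.
- by apply/measurable_EFinP; exact: measurable_normal_pdf.
- by move=> x _; rewrite lee_fin normal_pdf_ge0.
- by rewrite lee_fin invr_ge0 ltW.
Qed.

Lemma normal_prob_oppr (s : R) (A : set (measurableTypeR R)) : s != 0 ->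
  measurable A -> normal_prob 0 s (-%R @^-1` A) = normal_prob 0 s A.
Proof.
move=> s0 mA.
have mN : measurable_fun setT (-%R : measurableTypeR R -> measurableTypeR R).
  exact: oppr_measurable.
rewrite /normal_prob.
rewrite [RHS](_ : _ = \int[pushforward mu (-%R : measurableTypeR R -> measurableTypeR R)]_(x in A)
  (normal_pdf 0 s x)%:E)%E; last first.
  apply: eq_measure_integral => B mB _.
  exact/esym/lebesgue_measureN.
have mf : measurable_fun A (fun x : measurableTypeR R => (normal_pdf 0 s x)%:E).
  by apply/measurable_EFinP; apply: measurable_funTS; exact: measurable_normal_pdf.
rewrite (ge0_integral_pushforward mN mu mA mf); last first.
  by move=> x _; rewrite lee_fin normal_pdf_ge0.
apply: eq_integral => x _ /=.
by rewrite !normal_pdfE// /normal_fun !subr0 sqrrN.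
Qed.
End normal_integrals.

(** * Independence as a product of laws *)

Section independence.
Context d (Om : measurableType d) (R : realType) (P : probability Om R).

(** A substitute for conditional expectation: the joint law is the product of the marginals because
    the two agree on rectangles, and Tonelli then integrates [V] with [X] frozen. *)
Lemma integral_indep_pair d1 d2 (T1 : measurableType d1) (T2 : measurableType d2)
    (X : {mfun Om >-> T1}) (V : {mfun Om >-> T2}) (f : T1 * T2 -> \bar R) :
  (forall A B, measurable A -> measurable B ->
     P (X @^-1` A `&` V @^-1` B) = P (X @^-1` A) * P (V @^-1` B))%E ->
  measurable_fun setT f -> (forall x, 0 <= f x)%E ->
  (\int[P]_w f (X w, V w) = \int[P]_w \int[P]_w' f (X w, V w'))%E.
Proof.
move=> XV mf f0.
have mXV : measurable_fun setT (fun w => (X w, V w)) by exact: measurable_fun_pair.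
pose XV' : {mfun Om >-> (T1 * T2)%type} := mfun_Sub (mem_set mXV).
have -> : (\int[P]_w f (X w, V w) = \int[distribution P XV']_x f x)%E.
  by rewrite ge0_integral_distribution.
rewrite (eq_measure_integral (distribution P X \x distribution P V)%E); last first.
  move=> A mA _; apply/esym; apply: product_measure_unique => // B C mB mC.
rewrite fubini_tonelli1//= /fubini_F.
rewrite ge0_integral_distribution//; last 2 first.
- exact: measurable_fun_fubini_tonelli_F.
- by move=> x; apply: integral_ge0.
apply: eq_integral => w _ /=.
rewrite ge0_integral_distribution//.
exact: measurableT_comp.
Qed.

Definition box n (E : 'I_n -> set (measurableTypeR R)) :
    set (n.-tuple (measurableTypeR R)) :=
  [set t | forall i, E i (tnth t i)].

Definition boxes n : set (set (n.-tuple (measurableTypeR R))) :=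
  [set B | exists2 E, (forall i, measurable (E i)) & B = box E].

Lemma measurable_box n (E : 'I_n -> set (measurableTypeR R)) :
  (forall i, measurable (E i)) -> measurable (box E).
Proof.
move=> mE; rewrite (_ : box E = \bigcap_(i in [set: 'I_n])
  ((fun t : n.-tuple (measurableTypeR R) => tnth t i) @^-1` E i)).
  apply: fin_bigcap_measurable => // i _.
  by rewrite -[X in measurable X]setTI; exact: measurable_tnth.
by apply/seteqP; split=> t h i; [move=> _|]; exact: h.
Qed.

Lemma measurable_tuple_boxes n :
  @measurable _ (n.-tuple (measurableTypeR R)) = <<s @boxes n >>.
Proof.
apply/seteqP; split.
  apply: smallest_sub; first exact: smallest_sigma_algebra.
  move=> A; elim/big_ind : _ => //.
    by move=> B C hB hC [/hB|/hC].
  move=> i _ [B mB <-]; apply: sub_sigma_algebra.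
  exists (fun j => if j == i then B else setT); first by move=> j; case: ifPn.
  apply/seteqP; split => t /=.
    by move=> [_ tB] j; case: eqVneq => // ->.
  by move=> /(_ i); rewrite eqxx.
apply: smallest_sub; first exact: sigma_algebra_measurable.
by move=> _ [E mE ->]; exact: measurable_box.
Qed.

Lemma eq_measure_boxes n (m1 m2 : {measure set (n.-tuple (measurableTypeR R)) -> \bar R}) :
  (m1 setT < +oo)%E ->
  (forall E, (forall i, measurable (E i)) -> m1 (box E) = m2 (box E)) ->
  forall A, measurable A -> m1 A = m2 A.
Proof.
move=> fin m12; apply: (measure_unique (@boxes n) (fun=> setT)) => //.
- exact: measurable_tuple_boxes.
- move=> _ _ [E mE ->] [F mF ->]; exists (fun i => E i `&` F i).
    by move=> i; exact: measurableI.
  apply/seteqP; split=> t; first by move=> [h k] i; split; [exact: h|exact: k].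
  by move=> h; split => i; have [] := h i.
- move=> _; exists (fun=> setT) => //.
  by apply/seteqP; split.
- by apply/seteqP; split => // t _; exists 0%N.
- by move=> _ [E mE ->]; exact: m12.
Qed.

Definition vec n (G : 'I_n -> Om -> measurableTypeR R) (w : Om) : n.-tuple (measurableTypeR R) :=
  [tuple G i w | i < n].

Lemma measurable_vec n (G : 'I_n -> Om -> measurableTypeR R) :
  (forall i, measurable_fun setT (G i)) ->
  measurable_fun setT (vec G).
Proof.
move=> mG; apply/measurable_fun_tnthP => i.
apply: (eq_measurable_fun (G i)) => //.
by move=> w _ /=; rewrite tnth_mktuple.
Qed.

Lemma integral_indep_vec d1 (T1 : measurableType d1) (X : {mfun Om >-> T1}) n
    (G : 'I_n -> Om -> measurableTypeR R) (f : T1 * n.-tuple (measurableTypeR R) -> \bar R) :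
  (forall i, measurable_fun setT (G i)) ->
  (forall A E, measurable A -> (forall i, measurable (E i)) ->
     P (X @^-1` A `&` vec G @^-1` box E) =
     P (X @^-1` A) * P (vec G @^-1` box E))%E ->
  measurable_fun setT f -> (forall x, 0 <= f x)%E ->
  (\int[P]_w f (X w, vec G w) = \int[P]_w \int[P]_w' f (X w, vec G w'))%E.
Proof.
move=> mG ind mf f0.
have mV := measurable_vec mG.
pose V : {mfun Om >-> n.-tuple (measurableTypeR R)} := mfun_Sub (mem_set mV).
apply: (@integral_indep_pair _ _ _ _ X V) => // A B mA mB.
have mXA : measurable (X @^-1` A) by rewrite -[X in measurable X]setTI; exact: measurable_funP.
have PA : (0 <= fine (P (X @^-1` A)))%R by rewrite fine_ge0.
(* With [A] fixed, both sides of the product formula are finite measures in the event for [V], so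
   agreement on boxes suffices. *)
pose m1 := mrestr P mXA.
pose m2 := mscale (NngNum PA) P.
have /(_ mV mV) h := @eq_measure_boxes n (pushforward m1 V) (pushforward m2 V).
have m2E C : pushforward m2 V C = (P (X @^-1` A) * P (V @^-1` C))%E.
  by rewrite /pushforward /m2 /mscale /= fineK ?fin_num_measure.
rewrite -m2E setIC; apply: h => //.
  rewrite /pushforward /m1 /mrestr (le_lt_trans (probability_le1 _ _)) ?ltry//.
  by rewrite preimage_setT setTI.
by move=> E mE; etransitivity; last exact/esym/m2E; rewrite -ind// setIC.
Qed.
End independence.

(** * Families of independent normal variables *)

Section gaussian_family.
Context d (Om : measurableType d) (R : realType) (P : probability Om R).
Implicit Type s : R.

Lemma expR_EFin_ge0 (x : R) : (0 <= (expR x)%:E)%E.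
Proof. by rewrite lee_fin expR_ge0. Qed.

(** Independent centred normal variables of standard deviation [s], prescribed on boxes only: the
    form in which [cyl_wiener_increments] delivers them. *)
Definition gaussian_family s n (G : 'I_n -> Om -> measurableTypeR R) : Prop :=
  (forall i, measurable_fun setT (G i)) /\
  forall E, (forall i, measurable (E i)) ->
    P (vec G @^-1` box E) = (\prod_(i < n) normal_prob 0 s (E i))%E.

Lemma vec_box n (G : 'I_n -> Om -> measurableTypeR R) E :
  vec G @^-1` box E = [set w | forall i, E i (G i w)].
Proof.
by apply/seteqP; split=> w h i; have := h i; rewrite tnth_mktuple.
Qed.

Lemma gaussian_family_tail s n (G : 'I_n.+1 -> Om -> measurableTypeR R) :
  gaussian_family s G -> gaussian_family s (fun i => G (lift ord0 i)).
Proof.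
move=> [mG GE]; split=> [i|E mE]; first exact: mG.
pose E' i := if unlift ord0 i is Some j then E j else setT.
rewrite (_ : vec _ @^-1` _ = vec G @^-1` box E'); last first.
  rewrite !vec_box; apply/seteqP; split=> w h i /=.
    by rewrite /E'; case: unliftP => // j ->; exact: h.
  by have := h (lift ord0 i); rewrite /E' liftK.
rewrite GE; last by move=> i; rewrite /E'; case: unliftP.
rewrite big_ord_recl {1}/E' unlift_none probability_setT mul1e.
by apply: eq_bigr => i _; rewrite /E' liftK.
Qed.

Lemma gaussian_family_marginal s n (G : 'I_n.+1 -> Om -> measurableTypeR R) A :
  gaussian_family s G -> measurable A ->
  P (G ord0 @^-1` A) = normal_prob 0 s A.
Proof.
move=> [mG GE] mA.
pose E' (i : 'I_n.+1) := if i == ord0 then A else setT : set (measurableTypeR R).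
rewrite (_ : G ord0 @^-1` _ = vec G @^-1` box E'); last first.
  rewrite !vec_box; apply/seteqP; split=> w.
    by move=> h i; rewrite /E'; case: eqVneq => // ->.
  by move=> /(_ ord0); rewrite /E' eqxx.
rewrite GE; last by move=> i; rewrite /E'; case: ifP.
rewrite big_ord_recl {1}/E' eqxx big1 ?mule1// => i _.
by rewrite /E' eq_sym (negbTE (neq_lift _ _)) probability_setT.
Qed.

Lemma gaussian_family_split s n (G : 'I_n.+1 -> Om -> measurableTypeR R) A E :
  gaussian_family s G -> measurable A -> (forall i, measurable (E i)) ->
  P (G ord0 @^-1` A `&` vec (fun i => G (lift ord0 i)) @^-1` box E) =
  (P (G ord0 @^-1` A) * P (vec (fun i => G (lift ord0 i)) @^-1` box E))%E.
Proof.
move=> GG mA mE; rewrite (gaussian_family_marginal GG mA).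
have [_ ->//] := gaussian_family_tail GG.
pose E' i := if unlift ord0 i is Some j then E j else A.
rewrite [X in P X](_ : _ = vec G @^-1` box E'); last first.
  rewrite !vec_box; apply/seteqP; split=> w.
    by move=> [h k] i; rewrite /E'; case: unliftP => [j|] ->; [exact: k|exact: h].
  move=> h; split; first by have := h ord0; rewrite /E' unlift_none.
  by move=> i; have := h (lift ord0 i); rewrite /E' liftK.
case: GG => _ ->; last by move=> i; rewrite /E'; case: unliftP.
rewrite big_ord_recl {1}/E' unlift_none; congr (_ * _)%E.
by apply: eq_bigr => i _; rewrite /E' liftK.
Qed.

Lemma integral_gaussian1 s (X : Om -> measurableTypeR R) (f : measurableTypeR R -> \bar R) :
  measurable_fun setT X ->
  (forall A, measurable A -> P (X @^-1` A) = normal_prob 0 s A) ->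
  measurable_fun setT f -> (forall x, 0 <= f x)%E ->
  (\int[P]_w f (X w) = \int[normal_prob 0 s]_x f x)%E.
Proof.
move=> mX XE mf f0.
pose V : {mfun Om >-> measurableTypeR R} := mfun_Sub (mem_set mX).
have <- := @ge0_integral_distribution _ _ _ _ _ P V f mf f0.
by apply: eq_measure_integral => A mA _; exact: XE.
Qed.

(** Induction on [n]: the first variable is independent of the vector of the others, so the
    exponential of the sum factors into two integrals. *)
Lemma gaussian_mgf s n (G : 'I_n -> Om -> measurableTypeR R) (a : 'I_n -> R) : s != 0 ->
  gaussian_family s G ->
  (\int[P]_w (expR (\sum_i a i * G i w))%:E =
   (expR (s ^+ 2 / 2 * \sum_i a i ^+ 2))%:E)%E.
Proof.
move=> s0; elim: n G a => [|n IHn] G a GG.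
  under eq_integral do rewrite big_ord0 expR0.
  by rewrite integral_cst//= probability_setT mule1 big_ord0 mulr0 expR0.
have [mG _] := GG.
pose G' (i : 'I_n) := G (lift ord0 i); pose a' (i : 'I_n) := a (lift ord0 i).
pose X : {mfun Om >-> measurableTypeR R} := mfun_Sub (mem_set (mG ord0)).
pose f (x : measurableTypeR R * n.-tuple (measurableTypeR R)) : \bar R :=
  ((expR (a ord0 * x.1))%:E * (expR (\sum_i a' i * tnth x.2 i))%:E)%E.
transitivity (\int[P]_w f (X w, vec G' w))%E.
  apply: eq_integral => w _; rewrite /f /= big_ord_recl expRD EFinM.
  by congr (_ * (expR _)%:E)%E; apply: eq_bigr => i _; rewrite tnth_mktuple.
rewrite integral_indep_vec//; last 4 first.
- by move=> i; exact: mG.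
- by move=> A E mA mE; exact: (gaussian_family_split GG mA mE).
- apply: emeasurable_funM; apply/measurable_EFinP; apply: measurableT_comp => //.
    exact: measurable_funM.
  apply: measurable_sum => i; apply: measurable_funM => //.
  apply: (measurableT_comp (measurable_tnth i)); exact: measurable_snd.
- by move=> x; rewrite /f mule_ge0// lee_fin expR_ge0.
have mf1 : measurable_fun setT (fun x : R => (expR (a ord0 * x))%:E).
  by apply/measurable_EFinP; apply: measurableT_comp => //; exact: mulrl_measurable.
have mf2 : measurable_fun setT (fun w => (expR (\sum_i a' i * G' i w))%:E).
  apply/measurable_EFinP; apply: measurableT_comp => //.
  by apply: measurable_sum => i; apply: measurable_funM => //; exact: mG.
have inner w : (\int[P]_w' f (X w, vec G' w') =
    (expR (a ord0 * G ord0 w))%:E * (expR (s ^+ 2 / 2 * \sum_i a' i ^+ 2))%:E)%E.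
  rewrite -(IHn G' a' (gaussian_family_tail GG)).
  rewrite -(ge0_integralZl P measurableT mf2 _ (expR_EFin_ge0 _)); last first.
    by move=> x _; exact: expR_EFin_ge0.
  apply: eq_integral => w' _; rewrite /f /=; congr (_ * (expR _)%:E)%E.
  by apply: eq_bigr => i _; rewrite tnth_mktuple.
under eq_integral do rewrite inner.
have mf3 : measurable_fun setT (fun w => (expR (a ord0 * G ord0 w))%:E).
  by apply: (measurableT_comp mf1); exact: mG.
rewrite (ge0_integralZr P measurableT mf3 _ (expR_EFin_ge0 _)); last first.
  by move=> x _; exact: expR_EFin_ge0.
rewrite (integral_gaussian1 (mG ord0)
  (fun A => @gaussian_family_marginal s n G A GG) mf1); last first.
  by move=> x; exact: expR_EFin_ge0.
have -> : (\int[normal_prob 0 s]_x (expR (a ord0 * x))%:E =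
    (expR (a ord0 ^+ 2 * s ^+ 2 / 2))%:E)%E by exact: normal_mgf.
rewrite -EFinM -expRD big_ord_recl; congr (expR _)%:E.
by rewrite mulrDr; congr (_ + _); ring.
Qed.

(** Every side of a box may be reflected because the centred normal law is even, and boxes determine
    the law of the vector. *)
Lemma gaussian_symm s n (G : 'I_n -> Om -> measurableTypeR R)
    (f : n.-tuple (measurableTypeR R) -> \bar R) : s != 0 ->
  gaussian_family s G -> measurable_fun setT f -> (forall t, 0 <= f t)%E ->
  (\int[P]_w f (vec G w) = \int[P]_w f (vec (fun i w => (- (G i w : R))%R : measurableTypeR R) w))%E.
Proof.
move=> s0 [mG GE] mf f0.
have mV := measurable_vec mG.
have mGN i : measurable_fun setT (fun w => (- (G i w : R))%R : measurableTypeR R).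
  by apply: measurable_funN; exact: mG.
have mVN := measurable_vec mGN.
pose V : {mfun Om >-> n.-tuple (measurableTypeR R)} := mfun_Sub (mem_set mV).
pose VN : {mfun Om >-> n.-tuple (measurableTypeR R)} := mfun_Sub (mem_set mVN).
have <- := @ge0_integral_distribution _ _ _ _ _ P V f mf f0.
have <- := @ge0_integral_distribution _ _ _ _ _ P VN f mf f0.
apply: eq_measure_integral => A mA _; apply: eq_measure_boxes mA.
  apply: (@le_lt_trans _ _ 1%E); last exact: ltry.
  exact: (probability_le1 (distribution P V) measurableT).
move=> E mE; transitivity (P (vec G @^-1` box E)) => //.
transitivity (P (vec (fun i w => (- (G i w : R))%R : measurableTypeR R) @^-1` box E)) => //.
rewrite GE//.
rewrite [X in P X](_ : _ = vec G @^-1` box (fun i => -%R @^-1` E i)).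
  rewrite GE; first by apply: eq_bigr => i _; rewrite normal_prob_oppr.
  move=> i; rewrite -[X in measurable X]setTI.
  exact: (@oppr_measurable R setT measurableT _ (mE i)).
by rewrite !vec_box.
Qed.

Lemma gaussian_average s n (G : 'I_n -> Om -> measurableTypeR R)
    (f : n.-tuple (measurableTypeR R) -> \bar R) : s != 0 ->
  gaussian_family s G -> measurable_fun setT f -> (forall t, 0 <= f t)%E ->
  (\int[P]_w f (vec G w) = \int[P]_w ((2^-1)%:E *
     (f (vec G w) + f (vec (fun i w => (- (G i w : R))%R : measurableTypeR R) w))))%E.
Proof.
move=> s0 GG mf f0; have [mG _] := GG.
pose Gm i w : measurableTypeR R := (- (G i w : R))%R.
have mGm i : measurable_fun setT (Gm i) by apply: measurable_funN; exact: mG.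
have mfG := measurableT_comp mf (measurable_vec mG).
have mfGm := measurableT_comp mf (measurable_vec mGm).
have h20 : (0 <= (2^-1 : R)%:E)%E by rewrite lee_fin invr_ge0.
have fG0 w : [set: Om] w -> (0 <= (f \o vec G) w + (f \o vec Gm) w)%E.
  by move=> _; apply: adde_ge0; exact: f0.
rewrite (ge0_integralZl P measurableT (emeasurable_funD mfG mfGm) fG0 h20).
rewrite (ge0_integralD P measurableT (fun w _ => f0 _) mfG (fun w _ => f0 _) mfGm).
rewrite [X in (_ * (_ + X))%E](_ : _ = \int[P]_w f (vec G w))%E; last first.
  exact/esym/(gaussian_symm s0 GG mf f0).
have : (0 <= \int[P]_w f (vec G w))%E by apply: integral_ge0.
move: (\int[P]_w f (vec G w))%E => X X0.
rewrite -{2 3}[X]mul1e -ge0_muleDl// muleA -EFinD -EFinM.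
by rewrite (_ : 2^-1 * (1 + 1) = 1) ?mul1e//; field.
Qed.
End gaussian_family.

(** * Elementary inequalities for exponentials and finite sums *)

Section exponential_inequalities.
Context (R : realType).
Implicit Types x y u m : R.

Let cosh u : R := (expR u + expR (- u)) / 2.
Let sinh u : R := (expR u - expR (- u)) / 2.

Let is_derive_expRN u : is_derive u 1 (fun x => expR (- x)) (- expR (- u)).
Proof.
have h : is_derive (- u) 1 expR (expR (- u)) by exact: is_derive_expR.
have := is_derive1_comp (f := expR) (g := -%R) (x := u) h (is_deriveNid u 1).
by rewrite mulrN1.
Qed.

Let is_derive_cosh u : is_derive u 1 cosh (sinh u).
Proof.
have ? := is_derive_expRN u.
by apply: is_derive_eq; rewrite /GRing.scale /= /sinh; ring.
Qed.

Let is_derive_sinh u : is_derive u 1 sinh (cosh u).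
Proof.
have ? := is_derive_expRN u.
by apply: is_derive_eq; rewrite /GRing.scale /= /cosh; ring.
Qed.

Let sinh_ge0 u : 0 <= u -> 0 <= sinh u.
Proof. by move=> u0; rewrite divr_ge0// subr_ge0 ler_expR; lra. Qed.

Let nondecreasing_pos (f g : R -> R) u : (forall x, is_derive x 1 f (g x)) ->
  (forall x, 0 <= x -> 0 <= g x) -> 0 <= u -> f 0 <= f u.
Proof.
move=> fg g0 u0; have df x : derivable f x 1 by have [] := fg x.
have [->//|un0] := eqVneq u 0.
have up : 0 < u by rewrite lt_neqAle eq_sym un0.
have [c /[!in_itv]/= /andP[c0 _] E] : exists2 c, c \in `]0, u[ & f u - f 0 = g c * (u - 0).
  apply: MVT => //.
  by apply: derivable_within_continuous => x _.
by rewrite -subr_ge0 E mulr_ge0 ?g0 ?subr_ge0 ?ltW.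
Qed.

(** For [u >= 0] the product of [exp (- u^2 / 2)] and [cosh u] is nonincreasing: its derivative is
    [- exp (- u^2 / 2)] times [u cosh u - sinh u], and the latter vanishes at 0 and has derivative
    [u sinh u >= 0]. *)
Lemma cosh_le_expR_sqr u : (expR u + expR (- u)) / 2 <= expR (u ^+ 2 / 2).
Proof.
wlog u0 : u / 0 <= u => [hw|].
  have [/hw//|u0] := leP 0 u.
  by have := hw (- u); rewrite opprK addrC sqrrN; apply; lra.
have h v : 0 <= v -> 0 <= v * cosh v - sinh v.
  move=> v0; have := @nondecreasing_pos (fun x => x * cosh x - sinh x) (fun x => x * sinh x) v.
  rewrite mul0r sub0r /sinh oppr0 subrr mul0r oppr0; apply => // [x|x x0].
    have ? := is_derive_cosh x; have ? := is_derive_sinh x.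
    by apply: is_derive_eq; rewrite /GRing.scale /= /sinh; ring.
  by rewrite mulr_ge0// sinh_ge0.
have E0 : - (expR (- (0 ^+ 2 / 2)) * cosh 0) = - 1.
  by rewrite expr0n /= mul0r oppr0 expR0 mul1r /cosh oppr0 expR0; field.
have := @nondecreasing_pos (fun x => - (expR (- (x ^+ 2 / 2)) * cosh x))
  (fun x => expR (- (x ^+ 2 / 2)) * (x * cosh x - sinh x)) u.
rewrite E0 lerN2 expRN mulrC ler_pdivrMr ?expR_gt0// mul1r; apply => //.
- move=> x.
  have ? := is_derive_cosh x.
  have ? : is_derive x 1 (fun x0 => expR (- (x0 ^+ 2 / 2))) (- x * expR (- (x ^+ 2 / 2))).
    have hd : is_derive x 1 (fun x0 => - (x0 ^+ 2 / 2)) (- x).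
      by apply: is_derive_eq; rewrite /GRing.scale /=; field.
    have := is_derive1_comp (g := fun x0 => - (x0 ^+ 2 / 2)) (is_derive_expR _) hd.
    by rewrite mulrC.
  by apply: is_derive_eq; rewrite /GRing.scale /=; ring.
- by move=> x x0; rewrite mulr_ge0 ?expR_ge0// h.
Qed.

(** After squaring and using [expR_ge1Dx], it remains that [(1 + 2 m + 8 m^2) (1 - 2 m) = 1 + 4 m^2
    (1 - 4 m)] is at least 1, whence the range of [m]. The coefficient 1 of the linear term matters:
    it produces the rate [2 eps th] in the weight. *)
Lemma sqrt_inv_le_expR m : 0 <= m -> m <= 1 / 4 ->
  (Num.sqrt (1 - 2 * m))^-1 <= expR (m + 4 * m ^+ 2).
Proof.
move=> m0 m4; have p0 : 0 < 1 - 2 * m by lra.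
rewrite -div1r ler_pdivrMr ?sqrtr_gt0//.
rewrite -[leLHS]sqrtr1 -[X in X * _]ger0_norm ?expR_ge0//.
rewrite -sqrtr_sqr -sqrtrM ?sqr_ge0// ler_sqrt; last by rewrite mulr_ge0 ?sqr_ge0// ltW.
rewrite -expRM_natl.
have := expR_ge1Dx (2 * (m + 4 * m ^+ 2)) => e1.
apply: (@le_trans _ _ ((1 + 2 * (m + 4 * m ^+ 2)) * (1 - 2 * m))); last first.
  by rewrite ler_wpM2r// ltW.
have : 0 <= m ^+ 2 * (1 - 4 * m) by rewrite mulr_ge0 ?sqr_ge0//; lra.
by lra.
Qed.

(** Lagrange's identity: twice the difference of the two sides is a double sum of squares. *)
Lemma sum_cauchy_schwarz (I : finType) (a b : I -> R) :
  (\sum_i a i * b i) ^+ 2 <= (\sum_i a i ^+ 2) * (\sum_i b i ^+ 2).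
Proof.
have h : 0 <= \sum_i \sum_j (a i * b j - a j * b i) ^+ 2.
  by apply: sumr_ge0 => i _; apply: sumr_ge0 => j _; exact: sqr_ge0.
have E : \sum_i \sum_j (a i * b j - a j * b i) ^+ 2 =
    2 * ((\sum_i a i ^+ 2) * (\sum_i b i ^+ 2)) - 2 * (\sum_i a i * b i) ^+ 2.
  rewrite (eq_bigr (fun i => a i ^+ 2 * (\sum_j b j ^+ 2) +
      b i ^+ 2 * (\sum_j a j ^+ 2) - 2 * (a i * b i) * \sum_j a j * b j)).
    by rewrite sumrB big_split/= -!mulr_suml -mulr_sumr; ring.
  move=> i _; rewrite !mulr_sumr -big_split/= -sumrB.
  by apply: eq_bigr => j _; ring.
by move: h; rewrite E; lra.
Qed.

(** The tangent of the exponential at the mean [s] lies below its graph; averaging that inequality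
    removes the linear term. *)
Lemma expR_jensen n (p x : 'I_n -> R) : (forall i, 0 <= p i) -> \sum_i p i = 1 ->
  expR (\sum_i p i * x i) <= \sum_i p i * expR (x i).
Proof.
move=> p0 p1; set s := \sum_i p i * x i.
apply: (@le_trans _ _ (\sum_i p i * (expR s * (1 + (x i - s))))).
  rewrite (eq_bigr (fun i => expR s * (p i + (p i * x i - p i * s)))); last first.
    by move=> i _; ring.
  rewrite -mulr_sumr big_split/= p1 sumrB -mulr_suml p1 mul1r -/s subrr addr0.
  by rewrite mulr1.
apply: ler_sum => i _; rewrite ler_wpM2l//.
apply: (@le_trans _ _ (expR s * expR (x i - s))).
  by rewrite ler_wpM2l ?expR_ge0 ?expR_ge1Dx.
by rewrite -expRD addrC subrK.
Qed.
End exponential_inequalities.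

(** * Exponential moments of Gaussian quadratic forms *)

Section gaussian_quadratic.
Context d (Om : measurableType d) (R : realType) (P : probability Om R).
Variables (s : R) (n : nat) (G : 'I_n -> Om -> measurableTypeR R).
Hypotheses (s0 : s != 0) (GG : gaussian_family P s G).

Let mG i : measurable_fun setT (G i : Om -> R). Proof. by case: GG => + _; apply. Qed.

Definition lin_form (c : 'I_n -> R) (w : Om) : R := \sum_i c i * G i w.

Lemma measurable_lin_form c : measurable_fun setT (lin_form c).
Proof. by apply: measurable_sum => i; exact: measurable_funM. Qed.

(* Hubbard--Stratonovich: exp(x^2) is the Gaussian average of exp(sqrt 2 x y),
   which reduces the squared linear form to the moment generating function *)
Lemma gaussian_square_mgf (c : 'I_n -> R) : s ^+ 2 * \sum_i c i ^+ 2 < 1 / 2 ->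
  (\int[P]_w (expR (lin_form c w ^+ 2))%:E =
   (Num.sqrt (1 - 2 * (s ^+ 2 * \sum_i c i ^+ 2)))^-1%:E)%E.
Proof.
set m := s ^+ 2 * _ => m2.
have sq2 : Num.sqrt 2 ^+ 2 = 2 :> R by rewrite sqr_sqrtr.
pose f (x : Om * measurableTypeR R) : \bar R := (expR (Num.sqrt 2 * lin_form c x.1 * x.2))%:E.
have mf : measurable_fun setT f.
  apply/measurable_EFinP; apply: measurableT_comp => //.
  apply: measurable_funM => //; apply: measurable_funM => //.
  exact: (measurableT_comp (measurable_lin_form c)).
transitivity (\int[P]_w \int[normal_prob 0 1]_y f (w, y))%E.
  apply: eq_integral => w _; rewrite /f /=.
  have -> := normal_mgf (Num.sqrt 2 * lin_form c w) (oner_neq0 R).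
  by rewrite exprMn sq2 expr1n mulr1 mulrC mulKf.
rewrite (fubini_tonelli (m1 := P) (m2 := normal_prob 0 1) f mf); last by move=> x; exact: expR_EFin_ge0.
rewrite -normal_square_mgf//; apply: eq_integral => y _; rewrite /f /=.
transitivity (\int[P]_w (expR (\sum_i (Num.sqrt 2 * y * c i) * G i w))%:E)%E.
  apply: eq_integral => w _; congr (expR _)%:E.
  by rewrite /lin_form mulrAC mulr_sumr; apply: eq_bigr => i _; rewrite mulrA.
rewrite (gaussian_mgf _ s0 GG); congr (expR _)%:E.
rewrite (eq_bigr (fun i => 2 * y ^+ 2 * c i ^+ 2)); last first.
  by move=> i _; rewrite !exprMn sq2.
by rewrite -mulr_sumr /m; field.
Qed.

Lemma gaussian_square_mgf_le (c : 'I_n -> R) (m : R) :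
  s ^+ 2 * \sum_i c i ^+ 2 <= m -> m <= 1 / 4 ->
  (\int[P]_w (expR (lin_form c w ^+ 2))%:E <= (expR (m + 4 * m ^+ 2))%:E)%E.
Proof.
move=> cm m4; have c0 : 0 <= s ^+ 2 * \sum_i c i ^+ 2.
  by rewrite mulr_ge0 ?sqr_ge0// sumr_ge0// => i _; exact: sqr_ge0.
rewrite gaussian_square_mgf ?lee_fin; last by lra.
apply: le_trans (sqrt_inv_le_expR c0 _) _; first by lra.
rewrite ler_expR lerD// ler_pM2l// ler_pXn2r// nnegrE//.
exact: le_trans cm.
Qed.

(** The linear forms are correlated, so the expectation does not factor. The sum of squares is
    instead a convex combination, with weights [p j] proportional to the variances, of squares of
    forms rescaled to the total variance [q]. Jensen's inequality reduces to one such square, and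
    the bound depends on the trace but not on [K]. *)
Lemma gaussian_quadratic_mgf K (c : 'I_K -> 'I_n -> R) (m : R) :
  s ^+ 2 * \sum_j \sum_i c j i ^+ 2 <= m -> m <= 1 / 4 ->
  (\int[P]_w (expR (\sum_j lin_form (c j) w ^+ 2))%:E <=
   (expR (m + 4 * m ^+ 2))%:E)%E.
Proof.
move=> cm m4; pose q := s ^+ 2 * \sum_j \sum_i c j i ^+ 2.
have s2 : 0 < s ^+ 2 by rewrite exprn_even_gt0.
have cj0 j : 0 <= \sum_i c j i ^+ 2 by apply: sumr_ge0 => i _; exact: sqr_ge0.
have q0 : 0 <= q by rewrite mulr_ge0 ?(ltW s2)// sumr_ge0.
have m0 : 0 <= m by exact: le_trans cm.
(* The weights below divide by [q]; if it is 0, all coefficients vanish. *)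
have [qz|qn0] := eqVneq q 0.
  have cz j i : c j i = 0.
    move/eqP: qz; rewrite /q mulf_eq0 (gt_eqF s2) /= psumr_eq0//.
    move=> /allP/(_ j); rewrite mem_index_enum /= => /(_ isT).
    rewrite psumr_eq0; last by move=> *; exact: sqr_ge0.
    by move=> /allP/(_ i); rewrite mem_index_enum sqrf_eq0 /= => /(_ isT)/eqP.
  under eq_integral do
    (rewrite big1 ?expR0; last by move=> j _;
      rewrite /lin_form big1 ?expr0n// => i _; rewrite cz mul0r).
  rewrite integral_cst//= probability_setT mule1 lee_fin -expR0 ler_expR.
  by rewrite addr_ge0// mulr_ge0// sqr_ge0.
have qp : 0 < q by rewrite lt_neqAle eq_sym qn0.
pose p j := s ^+ 2 * (\sum_i c j i ^+ 2) / q.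
have p0 j : 0 <= p j by rewrite divr_ge0// mulr_ge0// (ltW s2).
have p1 : \sum_j p j = 1 by rewrite -mulr_suml -mulr_sumr divff.
(* For [p j = 0] the inverse is 0 by convention, which is consistent since [lin_form (c j)] is then
   0. *)
pose c' j i := (Num.sqrt (p j))^-1 * c j i.
have cE j w : lin_form (c j) w ^+ 2 = p j * lin_form (c' j) w ^+ 2.
  have -> : lin_form (c' j) w = (Num.sqrt (p j))^-1 * lin_form (c j) w.
    by rewrite /lin_form mulr_sumr; apply: eq_bigr => i _; rewrite mulrA.
  rewrite exprMn exprVn sqr_sqrtr//.
  have [pz|pn0] := eqVneq (p j) 0; last by rewrite mulrA divff// mul1r.
  have cz i : c j i = 0.
    move/eqP: pz; rewrite /p mulf_eq0 invr_eq0 (gt_eqF qp) orbF.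
    rewrite mulf_eq0 (gt_eqF s2) /= psumr_eq0; last by move=> *; exact: sqr_ge0.
    by move=> /allP/(_ i); rewrite mem_index_enum sqrf_eq0 /= => /(_ isT)/eqP.
  by rewrite pz mul0r /lin_form big1 ?expr0n// => i _; rewrite cz mul0r.
have c'm j : s ^+ 2 * \sum_i c' j i ^+ 2 <= m.
  rewrite (eq_bigr (fun i => (p j)^-1 * c j i ^+ 2)); last first.
    by move=> i _; rewrite exprMn exprVn sqr_sqrtr.
  rewrite -mulr_sumr mulrCA.
  have [->|pn0] := eqVneq (p j) 0; first by rewrite invr0 mul0r.
  apply: le_trans cm; rewrite -/q {1}/p invf_div -mulrA mulVf ?mulr1//.
  by apply: contra pn0 => /eqP; rewrite /p => ->; rewrite mul0r.
have mE j : measurable_fun setT (fun w => (expR (lin_form (c' j) w ^+ 2))%:E).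
  apply/measurable_EFinP; apply: measurableT_comp => //.
  by apply: measurable_funX; exact: measurable_lin_form.
apply: (@le_trans _ _ (\int[P]_w \sum_(j < K) ((p j)%:E * (expR (lin_form (c' j) w ^+ 2))%:E))%E).
  apply: ge0_le_integral => //.
  - apply/measurable_EFinP; apply: measurableT_comp => //.
    apply: measurable_sum => j; apply: measurable_funX; exact: measurable_lin_form.
  - apply: emeasurable_sum => j; exact: emeasurable_funM.
  - move=> w _; rewrite (eq_bigr _ (fun j _ => cE j w)).
    under [leRHS]eq_bigr do rewrite -EFinM.
    by rewrite sumEFin lee_fin expR_jensen.
rewrite ge0_integral_sum//; last 2 first.
  - by move=> j; exact: emeasurable_funM.
  - by move=> j w _; rewrite mule_ge0 ?lee_fin ?expR_ge0.
apply: (@le_trans _ _ (\sum_(j < K) (p j * expR (m + 4 * m ^+ 2))%:E)%E).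
  apply: lee_sum => j _.
  rewrite (ge0_integralZl P measurableT (mE j)) ?lee_fin//.
  rewrite [leRHS]EFinM; apply: lee_pmul; rewrite ?lee_fin//.
    by apply: integral_ge0 => w _; exact: expR_EFin_ge0.
  exact: gaussian_square_mgf_le.
by rewrite sumEFin -mulr_suml p1 mul1r.
Qed.
End gaussian_quadratic.

(** * One tamed Gaussian step with frozen past *)

Lemma measurable_inv1D d (T : measurableType d) (R : realType) (g : T -> R) :
  measurable_fun setT g -> (forall x, 0 <= g x) ->
  measurable_fun setT (fun x => (1 + g x)^-1).
Proof.
move=> mg g0; under eq_fun => x do rewrite -[_^-1]powR_inv1 ?(addr_ge0 ler01 (g0 _))//.
by apply: (measurableT_comp (measurable_powR (-1))); exact: measurable_funD.
Qed.

Section gaussian_step.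
Context d (Om : measurableType d) (R : realType) (P : probability Om R).
Variables (s : R) (n : nat) (G : 'I_n -> Om -> measurableTypeR R).
Hypotheses (s0 : s != 0) (GG : gaussian_family P s G).
Variables (K : nat) (z : 'I_K -> R) (B : 'I_K -> 'I_n -> R).

Definition noise (g : n.-tuple (measurableTypeR R)) (k : 'I_K) : R :=
  \sum_i B k i * tnth g i.

(** This is [|z + Z / (1 + |Z|^2)|^2] in orthonormal coordinates, with [Z] the vector [noise g]; the
    contracting semigroup is left out. *)
Definition tamed_sqr_norm (g : n.-tuple (measurableTypeR R)) : R :=
  \sum_k (z k + (1 + \sum_k noise g k ^+ 2)^-1 * noise g k) ^+ 2.

Let N g := \sum_k noise g k ^+ 2.
Let L g := \sum_k z k * noise g k.

Let N0 g : 0 <= N g. Proof. by apply: sumr_ge0 => k _; exact: sqr_ge0. Qed.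

Lemma tamed_sqr_normE g : tamed_sqr_norm g =
  \sum_k z k ^+ 2 + 2 * (1 + N g)^-1 * L g + (1 + N g)^-1 ^+ 2 * N g.
Proof.
rewrite /tamed_sqr_norm /N /L !mulr_sumr -!big_split/=.
by apply: eq_bigr => k _; rewrite -/(N g); ring.
Qed.

Let i1 g : (1 + N g)^-1 <= 1.
Proof. by rewrite invf_le1 ?ltr_wpDr// lerDl. Qed.

Let i0 g : 0 <= (1 + N g)^-1.
Proof. by rewrite invr_ge0 addr_ge0. Qed.

Let iN1 g : (1 + N g)^-1 * N g <= 1.
Proof. by rewrite mulrC ler_pdivrMr ?mul1r ?ltr_wpDr// lerDr. Qed.

(** The tamed noise [Z / (1 + |Z|^2)] has norm at most 1, so this holds for every realisation of the
    noise and for any variance. *)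
Lemma tamed_sqr_norm_le g : tamed_sqr_norm g <= 2 * (\sum_k z k ^+ 2) + 2.
Proof.
have -> : tamed_sqr_norm g <= 2 * (\sum_k z k ^+ 2) + 2 =
    (tamed_sqr_norm g <= 2 * (\sum_k z k ^+ 2) + 2 * 1) by rewrite mulr1.
apply: (@le_trans _ _ (2 * (\sum_k z k ^+ 2) + 2 * ((1 + N g)^-1 ^+ 2 * N g))).
  rewrite /tamed_sqr_norm !mulr_sumr -big_split/=; apply: ler_sum => k _.
  rewrite -/(N g); set a := (1 + N g)^-1; set b := noise g k.
  have := sqr_ge0 (z k - a * b); lra.
rewrite lerD2l ler_pM2l// expr2 -mulrA.
by rewrite -[leRHS]mulr1 ler_pM// mulr_ge0.
Qed.

Lemma measurable_noise k : measurable_fun setT (noise ^~ k).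
Proof.
apply: measurable_sum => i; apply: measurable_funM => //.
exact: (measurable_tnth i).
Qed.

Lemma measurable_tamed_sqr_norm : measurable_fun setT tamed_sqr_norm.
Proof.
apply: measurable_sum => k; apply: measurable_funX; apply: measurable_funD => //.
apply: measurable_funM; last exact: measurable_noise.
apply: measurable_inv1D => [|g]; last exact: N0.
by apply: measurable_sum => l; apply: measurable_funX; exact: measurable_noise.
Qed.

(** [mb] bounds the total variance of the quadratic form [2 a^2 <z, Z>^2 + a |Z|^2], whose first
    part comes from the cosh and whose second from the square of the noise; the damping factors are
    at most 1 and are dropped. *)
Lemma gaussian_step (a th : R) : 0 <= a -> \sum_k \sum_i B k i ^+ 2 <= th ->
  let mb := s ^+ 2 * th * (2 * a ^+ 2 * \sum_k z k ^+ 2 + a) in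
  mb <= 1 / 4 ->
  (\int[P]_w (expR (a * tamed_sqr_norm (vec G w)))%:E <=
   (expR (a * \sum_k z k ^+ 2 + mb + 4 * mb ^+ 2))%:E)%E.
Proof.
move=> a0 Bth mb mb4.
set Z2 := \sum_k z k ^+ 2.
have Z20 : 0 <= Z2 by apply: sumr_ge0 => k _; exact: sqr_ge0.
pose q g := (expR (a * tamed_sqr_norm g))%:E.
have mq : measurable_fun setT q.
  apply/measurable_EFinP; apply: measurableT_comp => //.
  by apply: measurable_funM => //; exact: measurable_tamed_sqr_norm.
have q0 g : (0 <= q g)%E by exact: expR_EFin_ge0.
pose Gm i w : measurableTypeR R := (- (G i w : R))%R.
have [mG _] := GG.
have mGm i : measurable_fun setT (Gm i) by apply: measurable_funN; exact: mG.
(* the quadratic form 2 a^2 <z, Z>^2 + a |Z|^2 as a sum of K + 1 squares *)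
pose c (j : 'I_K.+1) (i : 'I_n) : R :=
  if unlift ord0 j is Some k then Num.sqrt a * B k i
  else Num.sqrt 2 * a * \sum_k z k * B k i.
have c0E i : c ord0 i = Num.sqrt 2 * a * \sum_k z k * B k i.
  by rewrite /c unlift_none.
have cSE k i : c (lift ord0 k) i = Num.sqrt a * B k i by rewrite /c liftK.
have sq2 : Num.sqrt 2 ^+ 2 = 2 :> R by rewrite sqr_sqrtr.
have mbc : s ^+ 2 * \sum_j \sum_i c j i ^+ 2 <= mb.
  rewrite /mb -mulrA ler_wpM2l ?sqr_ge0// big_ord_recl mulrDr lerD//.
    (* Cauchy--Schwarz in [k] bounds the variance of [<z, Z>] by [|z|^2] times the trace of the
       covariance. *)
    apply: (@le_trans _ _ (\sum_i 2 * a ^+ 2 * (Z2 * \sum_k B k i ^+ 2))).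
      apply: ler_sum => i _; rewrite c0E !exprMn sq2.
      by rewrite ler_wpM2l ?mulr_ge0 ?sqr_ge0// sum_cauchy_schwarz.
    rewrite -mulr_sumr -mulr_sumr exchange_big/= -/Z2.
    have h : 0 <= 2 * a ^+ 2 * Z2 by rewrite !mulr_ge0 ?sqr_ge0.
    by have := ler_wpM2l h Bth; lra.
  rewrite (eq_bigr (fun k => a * \sum_i B k i ^+ 2)); last first.
    move=> k _; rewrite mulr_sumr; apply: eq_bigr => i _.
    by rewrite cSE exprMn sqr_sqrtr.
  by rewrite -mulr_sumr mulrC ler_wpM2r.
have cE w : \sum_j lin_form G (c j) w ^+ 2 =
    2 * a ^+ 2 * L (vec G w) ^+ 2 + a * N (vec G w).
  rewrite big_ord_recl; congr (_ + _).
    rewrite -sq2 -!exprMn; congr (_ ^+ 2).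
    rewrite /lin_form /L /noise (eq_bigr (fun i => Num.sqrt 2 * a *
      (\sum_k z k * (B k i * (G i w : R))))); last first.
      move=> i _; rewrite c0E -[LHS]mulrA mulr_suml; congr (_ * _).
      by apply: eq_bigr => k _; rewrite mulrA.
    rewrite -mulr_sumr; congr (_ * _); rewrite exchange_big/=.
    apply: eq_bigr => k _; rewrite -mulr_sumr; congr (_ * _).
    by apply: eq_bigr => i _; rewrite tnth_mktuple.
  rewrite /N mulr_sumr; apply: eq_bigr => k _.
  rewrite -[a in RHS]sqr_sqrtr// -exprMn; congr (_ ^+ 2).
  rewrite /lin_form /noise mulr_sumr; apply: eq_bigr => i _.
  by rewrite cSE tnth_mktuple mulrA.
have noiseN w k : noise (vec Gm w) k = - noise (vec G w) k.
  by rewrite /noise -sumrN; apply: eq_bigr => i _; rewrite !tnth_mktuple mulrN.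
have mlin j : measurable_fun setT (fun w => lin_form G (c j) w ^+ 2).
  by apply: measurable_funX; exact: (measurable_lin_form GG).
have mquad : measurable_fun setT (fun w => (expR (\sum_j lin_form G (c j) w ^+ 2))%:E).
  apply/measurable_EFinP; apply: measurableT_comp => //.
  by apply: measurable_sum => j; exact: mlin.
have mqG : measurable_fun setT (fun w => q (vec G w)).
  exact: (measurableT_comp mq (measurable_vec mG)).
have mqGm : measurable_fun setT (fun w => q (vec Gm w)).
  exact: (measurableT_comp mq (measurable_vec mGm)).
apply: (@le_trans _ _ (\int[P]_w ((expR (a * Z2))%:E *
    (expR (\sum_j lin_form G (c j) w ^+ 2))%:E))%E).
  rewrite [leLHS](gaussian_average s0 GG mq q0); apply: ge0_le_integral => //.
  - by move=> w _; rewrite mule_ge0 ?lee_fin ?invr_ge0// adde_ge0.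
  - by apply: emeasurable_funM => //; exact: emeasurable_funD.
  - exact: emeasurable_funM.
  move=> w _; rewrite cE /q -EFinD -!EFinM lee_fin.
  rewrite !tamed_sqr_normE.
  (* The denominator is even in the noise, hence equal for both signs, and only the linear term [L]
     changes; this is what leaves a pure cosh. *)
  have -> : N (vec Gm w) = N (vec G w).
    by apply: eq_bigr => k _; rewrite noiseN sqrrN.
  have -> : L (vec Gm w) = - L (vec G w).
    by rewrite /L -sumrN; apply: eq_bigr => k _; rewrite noiseN mulrN.
  set x := (1 + N _)^-1; set l := L _; set nn := N _.
  have x1 : x <= 1 by exact: i1.
  have x0 : 0 <= x by exact: i0.
  have nn0 : 0 <= nn by exact: N0.
  have := cosh_le_expR_sqr (2 * a * x * l) => ch.
  have x21 : x ^+ 2 <= 1 by rewrite expr_le1.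
  rewrite (_ : a * (\sum_k z k ^+ 2 + 2 * x * l + x ^+ 2 * nn) =
    (a * Z2 + a * x ^+ 2 * nn) + 2 * a * x * l); last by rewrite /Z2; ring.
  rewrite (_ : a * (\sum_k z k ^+ 2 + 2 * x * - l + x ^+ 2 * nn) =
    (a * Z2 + a * x ^+ 2 * nn) - 2 * a * x * l); last by rewrite /Z2; ring.
  rewrite !(expRD (a * Z2 + a * x ^+ 2 * nn)) -mulrDr mulrCA.
  apply: (@le_trans _ _ (expR (a * Z2 + a * x ^+ 2 * nn) * expR ((2 * a * x * l) ^+ 2 / 2))).
    by rewrite ler_wpM2l ?expR_ge0// mulrC.
  rewrite -!expRD ler_expR -addrA lerD2l addrC lerD//.
    rewrite (_ : (2 * a * x * l) ^+ 2 / 2 = 2 * a ^+ 2 * l ^+ 2 * x ^+ 2); last by field.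
    have h : 0 <= 2 * a ^+ 2 * l ^+ 2 by rewrite mulr_ge0 ?sqr_ge0// mulr_ge0 ?sqr_ge0.
    by rewrite -[leRHS]mulr1 ler_wpM2l.
  by rewrite mulrAC ler_piMr// mulr_ge0.
rewrite (ge0_integralZl P measurableT mquad) ?lee_fin ?expR_ge0//.
rewrite -addrA expRD EFinM lee_wpmul2l ?lee_fin ?expR_ge0//.
exact: (gaussian_quadratic_mgf s0 GG mbc mb4).
Qed.
End gaussian_step.

(** * Constants of the one-step estimate *)

Section step_constant.
Context (R : realType) (eta eps th T K2 : R).
Hypotheses (eta0 : 0 <= eta) (eps0 : 0 <= eps) (th0 : 0 <= th) (T0 : 0 <= T).
Hypothesis K20 : 0 <= K2.

(** Chosen, together with [noise_const], so that [eps * z2 <= drift_const * (1 + rho)] and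
    [mb <= noise_const * (h * (1 + rho))]. *)
Definition drift_const := 1 + 2 * eta * T + eps * T * K2.
Definition noise_const := th * eps * (2 * drift_const + 1).
(** The four summands pay, in this order, for the term [h ^+ 2 * rho ^+ 2] of the drift, for the
    trace term [a |Z|^2], for [4 * mb ^+ 2], and for the whole exponent when [mb] exceeds
    [1 / 4]. *)
Definition step_const := eps * (1 + 2 * eps * th * T) * K2 + eps * th +
  4 * noise_const ^+ 2 * K2 + 32 * (drift_const + eps) * noise_const ^+ 2 * K2.

Let D0 : 0 <= drift_const.
Proof. by rewrite /drift_const !addr_ge0 ?mulr_ge0. Qed.

Let N0 : 0 <= noise_const.
Proof. by rewrite /noise_const !(addr_ge0, mulr_ge0). Qed.

Lemma step_const_ge0 : 0 <= step_const.
Proof.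
have ? := sqr_ge0 noise_const.
by rewrite /step_const !(addr_ge0, mulr_ge0).
Qed.

Variables (h rho a y2 z2 : R).
Hypotheses (h0 : 0 <= h) (hT : h <= T) (rho0 : 0 <= rho).
Hypothesis hrho : h * (1 + rho) ^+ 3 <= K2.
Hypotheses (a0 : 0 <= a) (aeps : a <= eps) (y20 : 0 <= y2) (z20 : 0 <= z2).
Hypothesis y2rho : eps * y2 <= rho.
Hypothesis z2le : z2 <= (1 + 2 * eta * h) * y2 + h ^+ 2 * rho ^+ 2.

Let mb := h * th * (2 * a ^+ 2 * z2 + a).

Let hr2 : h * (1 + rho) ^+ 2 <= K2.
Proof.
apply: le_trans hrho; rewrite ler_wpM2l// [leRHS]exprS ler_peMl ?sqr_ge0//.
by rewrite lerDl.
Qed.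

Let h2rho2 : h ^+ 2 * rho ^+ 2 <= h * K2.
Proof.
rewrite expr2 -mulrA ler_wpM2l//; apply: le_trans hr2.
by rewrite ler_wpM2l// ler_pXn2r ?nnegrE ?addr_ge0// lerDr.
Qed.

Let epsz2 : eps * z2 <= drift_const * (1 + rho).
Proof.
have e1 : eps * z2 <= eps * ((1 + 2 * eta * h) * y2 + h * K2).
  by rewrite ler_wpM2l//; apply: le_trans z2le _; rewrite lerD2l.
have e2 : (1 + 2 * eta * h) * (eps * y2) <= (1 + 2 * eta * T) * rho.
  by rewrite ler_pM// ?(addr_ge0, mulr_ge0)// lerD2l ler_wpM2l// mulr_ge0.
have e3 : eps * (h * K2) <= eps * T * K2.
  by rewrite mulrA ler_wpM2r// ler_wpM2l.
have e4 : 0 <= (eps * T * K2) * rho by rewrite !mulr_ge0.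
have e5 : 0 <= 2 * eta * T by rewrite !mulr_ge0.
rewrite /drift_const; lra.
Qed.

Let mb0 : 0 <= mb.
Proof. by rewrite /mb !(mulr_ge0, addr_ge0) ?sqr_ge0. Qed.

Let mble : mb <= noise_const * (h * (1 + rho)).
Proof.
have e1 : a ^+ 2 * z2 <= eps * (drift_const * (1 + rho)).
  rewrite expr2 -mulrA ler_pM ?mulr_ge0//.
  by apply: le_trans epsz2; rewrite ler_wpM2r.
have e2 : 2 * a ^+ 2 * z2 + a <= eps * (2 * drift_const + 1) * (1 + rho).
  have e2 : 0 <= eps * rho by rewrite mulr_ge0.
  have e3 : 0 <= eps - a by rewrite subr_ge0.
  by lra.
have e3 : 0 <= h * th by rewrite mulr_ge0.
by have := ler_wpM2l e3 e2; rewrite /mb /noise_const; lra.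
Qed.

(** The coefficient of [a * y2] is at most [(1 + 2 eps th h) (1 + 2 eta h)], which the exponential
    growth factor dominates. Everything else is [O(h)] because [h * (1 + rho) ^+ 2 <= K2]. *)
Lemma step_exponent_small : a * z2 + mb + 4 * mb ^+ 2 <=
  a * expR (2 * (eta + eps * th) * h) * y2 + step_const * h.
Proof.
have e1 : a * z2 + 2 * a ^+ 2 * th * h * z2 <= a * (1 + 2 * eps * th * h) * z2.
  have : 0 <= (eps - a) * (2 * a * th * h * z2).
    by rewrite !mulr_ge0// subr_ge0.
  by lra.
have c0 : 0 <= 1 + 2 * eps * th * h by rewrite addr_ge0// !mulr_ge0.
have e2 : a * (1 + 2 * eps * th * h) * z2 <=
    a * (1 + 2 * eps * th * h) * ((1 + 2 * eta * h) * y2 + h * K2).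
  rewrite ler_wpM2l ?mulr_ge0//; apply: le_trans z2le _.
  by rewrite lerD2l.
have e3 : (1 + 2 * eps * th * h) * (1 + 2 * eta * h) <=
    expR (2 * (eta + eps * th) * h).
  rewrite (_ : 2 * (eta + eps * th) * h = 2 * eps * th * h + 2 * eta * h); last by ring.
  rewrite expRD ler_pM ?expR_ge1Dx//.
  by rewrite addr_ge0// !mulr_ge0.
have e4 : a * y2 * ((1 + 2 * eps * th * h) * (1 + 2 * eta * h)) <=
    a * y2 * expR (2 * (eta + eps * th) * h).
  by rewrite ler_wpM2l ?mulr_ge0.
have e5 : a * (1 + 2 * eps * th * h) * (h * K2) <=
    eps * (1 + 2 * eps * th * T) * (h * K2).
  rewrite ler_wpM2r ?mulr_ge0// ler_pM// lerD2l.
  by rewrite ler_wpM2l// !mulr_ge0.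
have e6 : h * th * a <= h * th * eps by rewrite ler_wpM2l ?mulr_ge0.
have e7 : 4 * mb ^+ 2 <= 4 * noise_const ^+ 2 * K2 * h.
  have q1 : mb ^+ 2 <= (noise_const * (h * (1 + rho))) ^+ 2.
    by have := ler_pM mb0 mb0 mble mble; rewrite -!expr2.
  have q2 : noise_const ^+ 2 * h * (h * (1 + rho) ^+ 2) <= noise_const ^+ 2 * h * K2.
    by rewrite ler_wpM2l// mulr_ge0 ?sqr_ge0.
  by move: q1 q2; rewrite !exprMn; lra.
have e8 : 0 <= 32 * (drift_const + eps) * noise_const ^+ 2 * K2 * h.
  by rewrite !(mulr_ge0, addr_ge0) ?sqr_ge0.
rewrite {1}/mb /step_const; move: e7 e8; move: noise_const drift_const => N D e7 e8; lra.
Qed.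

(** Here [1 <= 4 * noise_const * (h * (1 + rho))]. Multiplying the crude bound
    [2 * (drift_const + eps) * (1 + rho)] by the square of this gives [h ^+ 2 * (1 + rho) ^+ 3] up
    to the factor 32, which is the origin of the cube in [hrho] and of the last summand of
    [step_const]. *)
Lemma step_exponent_large : 1 / 4 < mb ->
  a * (2 * z2 + 2) <= a * expR (2 * (eta + eps * th) * h) * y2 + step_const * h.
Proof.
move=> mb4.
have r1 : 0 <= 1 + rho by rewrite addr_ge0.
have e1 : 1 <= 4 * noise_const * (h * (1 + rho)) by have := mble; lra.
have e2 : 1 <= (4 * noise_const * (h * (1 + rho))) ^+ 2 by rewrite expr_ge1 ?(le_trans _ e1).
have e3 : a * (2 * z2 + 2) <= 2 * (drift_const + eps) * (1 + rho).
  have e4 : 0 <= (eps - a) * z2 by rewrite mulr_ge0// subr_ge0.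
  have e5 : 0 <= eps * rho by rewrite mulr_ge0.
  have e6 : 0 <= eps - a by rewrite subr_ge0.
  have e7 : 0 <= drift_const * (1 + rho) - eps * z2 by rewrite subr_ge0.
  by lra.
have d0 : 0 <= 2 * (drift_const + eps) * (1 + rho) by rewrite !(mulr_ge0, addr_ge0).
have e4 := ler_wpM2l d0 e2.
have d1 : 0 <= 32 * (drift_const + eps) * noise_const ^+ 2 * h.
  by rewrite !(mulr_ge0, addr_ge0) ?sqr_ge0.
have e5 := ler_wpM2l d1 hrho.
have e6 : 0 <= eps * (1 + 2 * eps * th * T) * K2 * h by rewrite !(mulr_ge0, addr_ge0).
have e7 : 0 <= eps * th * h by rewrite !mulr_ge0.
have e8 : 0 <= 4 * noise_const ^+ 2 * K2 * h by rewrite !(mulr_ge0, addr_ge0) ?sqr_ge0.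
have e9 : 0 <= a * expR (2 * (eta + eps * th) * h) * y2 by rewrite mulr_ge0 // mulr_ge0 ?expR_ge0.
rewrite /step_const; lra.
Qed.
End step_constant.

(* Two regimes: if the exponential moment of the Gaussian quadratic form is
   under control the drift enters as 2 a eta h |y|^2; otherwise the taming bounds
   the increment by 1, which costs O(h) in the exponent because the radius rho
   grows more slowly than h^(-1/3). *)
Section one_step.
Context d (Om : measurableType d) (R : realType) (P : probability Om R).
Variables (F0 : set (set Om)) (s : R) (n : nat) (G : 'I_n -> Om -> measurableTypeR R).
Hypotheses (F0_sigma : sigma_algebra setT F0) (F0_sub : F0 `<=` measurable).
Hypotheses (s0 : s != 0) (GG : gaussian_family P s G).
Hypothesis G_indep : forall A E, F0 A -> (forall i, measurable (E i)) ->
  P (A `&` vec G @^-1` box E) = (P A * P (vec G @^-1` box E))%E.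

(** The sample space with the past as its sigma-algebra: being known at the start of the step
    becomes ordinary measurability, and the identity becomes a random variable carrying the whole
    past. *)
Let OmF := g_sigma_algebraType F0.

Let measurable_OmF (A : set OmF) : measurable A = F0 A.
Proof. by rewrite /measurable /= sigma_algebra_id. Qed.

Lemma measurable_past (X : Om -> measurableTypeR R) :
  (forall E : set (measurableTypeR R), measurable E -> F0 (X @^-1` E)) ->
  measurable_fun setT (X : OmF -> measurableTypeR R).
Proof. by move=> h _ E mE; rewrite setTI measurable_OmF; exact: h. Qed.

Variables (K : nat) (y f : 'I_K -> Om -> measurableTypeR R).
Variables (B : 'I_K -> 'I_n -> Om -> measurableTypeR R) (D : set Om).
Let past (X : Om -> measurableTypeR R) :=
  forall E : set (measurableTypeR R), measurable E -> F0 (X @^-1` E).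
Hypotheses (my : forall k, past (y k)) (mf : forall k, past (f k)).
Hypotheses (mB : forall k i, past (B k i)) (mD : F0 D).

Variables (eta eps th T K2 h rho a : R).
Hypotheses (eta0 : 0 <= eta) (eps0 : 0 <= eps) (th0 : 0 <= th) (T0 : 0 <= T).
Hypotheses (K20 : 0 <= K2) (h0 : 0 <= h) (hT : h <= T) (rho0 : 0 <= rho).
Hypotheses (hrho : h * (1 + rho) ^+ 3 <= K2) (a0 : 0 <= a) (aeps : a <= eps).
Hypothesis sh : s ^+ 2 = h.
Let y2 w : R := \sum_k (y k w : R) ^+ 2.
Let z k w : R := (y k w : R) + h * (f k w : R).
Hypothesis y2rho : forall w, D w -> eps * y2 w <= rho.
Hypothesis yf : forall w, D w -> \sum_k (y k w : R) * (f k w : R) <= eta * y2 w.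
Hypothesis f2 : forall w, D w -> \sum_k (f k w : R) ^+ 2 <= rho ^+ 2.
Hypothesis B2 : forall w, D w -> \sum_k \sum_i (B k i w : R) ^+ 2 <= th.

Variable Yn : Om -> measurableTypeR R.
Hypothesis mYn : measurable_fun setT Yn.
Hypothesis Yn_in : {ae P, forall w, D w ->
  (Yn w : R) <= tamed_sqr_norm (z ^~ w) (fun k i => B k i w) (vec G w)}.
Hypothesis Yn_out : {ae P, forall w, ~ D w -> (Yn w : R) <= y2 w}.

(** An almost sure bound for [exp (a Yn)] that separates the past from the increments and is jointly
    measurable, as Tonelli requires. *)
Let Psi (x : OmF * n.-tuple (measurableTypeR R)) : \bar R :=
  (if `[< D x.1 >] then
    (expR (a * tamed_sqr_norm (z ^~ x.1) (fun k i => B k i x.1) x.2))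
   else (expR (a * y2 x.1)))%:E.

Let mz k : measurable_fun setT (z k : OmF -> R).
Proof.
apply: measurable_funD; first exact: (measurable_past (my k)).
by apply: measurable_funM => //; exact: (measurable_past (mf k)).
Qed.

Let my2 : measurable_fun setT (y2 : OmF -> R).
Proof.
by apply: measurable_sum => k; apply: measurable_funX; exact: (measurable_past (my k)).
Qed.

Let mnoise k : measurable_fun setT
  (fun x : OmF * n.-tuple (measurableTypeR R) => noise (fun k i => B k i x.1) x.2 k).
Proof.
apply: measurable_sum => i; apply: measurable_funM.
  exact: (measurableT_comp (measurable_past (mB k i)) measurable_fst).
exact: (measurableT_comp (measurable_tnth i) measurable_snd).
Qed.

Let mPsi : measurable_fun setT Psi.
Proof.
apply/measurable_EFinP; apply: measurable_fun_ifT.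
- apply: (measurable_fun_bool true).
  rewrite setTI (_ : _ @^-1` _ = D `*` setT).
    by apply: measurableX => //; rewrite measurable_OmF.
  apply/seteqP; split=> -[x g] /=; first by move=> /asboolP.
  by move=> [Dx _]; exact/asboolP.
- apply: measurableT_comp => //; apply: measurable_funM => //.
  apply: measurable_sum => k; apply: measurable_funX; apply: measurable_funD.
    exact: (measurableT_comp (mz k) measurable_fst).
  apply: measurable_funM => //.
  apply: measurable_inv1D => [|x]; last by apply: sumr_ge0 => l _; exact: sqr_ge0.
  by apply: measurable_sum => l; exact: measurable_funX.
- apply: measurableT_comp => //; apply: measurable_funM => //.
  exact: (measurableT_comp my2 measurable_fst).
Qed.

Let Psi0 x : (0 <= Psi x)%E.
Proof. by rewrite /Psi lee_fin; case: ifP; rewrite expR_ge0. Qed.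

Let fiber w : (\int[P]_w' Psi (w, vec G w') <=
  (expR (step_const eta eps th T K2 * h))%:E *
  (expR (a * expR (2 * (eta + eps * th) * h) * y2 w))%:E)%E.
Proof.
have y20 : 0 <= y2 w by apply: sumr_ge0 => k _; exact: sqr_ge0.
have C0 : 0 <= step_const eta eps th T K2 * h by rewrite mulr_ge0// step_const_ge0.
rewrite -EFinM -expRD addrC /Psi /=.
have [wD|wD] := pselect (D w); last first.
  (* Off [D] drift and noise are switched off, so the integrand does not depend on the
     increments. *)
  rewrite (asboolF wD).
  rewrite integral_cst//= probability_setT mule1 lee_fin ler_expR.
  rewrite -[leLHS]addr0 lerD// ler_wpM2r// -[leLHS]mulr1 ler_wpM2l//.
  by rewrite -expR0 ler_expR !(mulr_ge0, addr_ge0).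
rewrite (asboolT wD).
set z2 := \sum_k z k w ^+ 2.
have z20 : 0 <= z2 by apply: sumr_ge0 => k _; exact: sqr_ge0.
have z2le : z2 <= (1 + 2 * eta * h) * y2 w + h ^+ 2 * rho ^+ 2.
  have -> : z2 = y2 w + 2 * h * (\sum_k (y k w : R) * (f k w : R)) +
      h ^+ 2 * \sum_k (f k w : R) ^+ 2.
    rewrite /z2 /y2 !mulr_sumr -!big_split/=.
    by apply: eq_bigr => k _; rewrite /z; ring.
  have h20 : 0 <= 2 * h by rewrite mulr_ge0.
  have e1 := ler_wpM2l h20 (yf wD).
  have e2 := ler_wpM2l (sqr_ge0 h) (f2 wD).
  by lra.
have [mb4|mb4] := leP (h * th * (2 * a ^+ 2 * z2 + a)) (1 / 4).
  have := @gaussian_step _ _ _ P s n G s0 GG K (z ^~ w) (fun k i => B k i w) a th a0 (B2 wD).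
  rewrite /= sh => /(_ mb4) /le_trans; apply; rewrite lee_fin ler_expR.
  apply: (@step_exponent_small _ _ _ _ T _ _ _ _ _ _ h rho) => //.
  exact: y2rho.
apply: (@le_trans _ _ (\int[P]_w' (expR (a * (2 * z2 + 2)))%:E)%E).
  apply: ge0_le_integral => //.
  - apply/measurable_EFinP; apply: measurableT_comp => //.
    apply: measurable_funM => //.
    have [mG _] := GG.
    exact: (measurableT_comp (measurable_tamed_sqr_norm _ _) (measurable_vec mG)).
  - move=> w' _; rewrite lee_fin ler_expR ler_wpM2l//; exact: tamed_sqr_norm_le.
rewrite integral_cst//= probability_setT mule1 lee_fin ler_expR.
apply: (@step_exponent_large _ _ _ _ T _ _ _ _ _ _ h rho) => //.
exact: y2rho.
Qed.

Lemma one_step_moment : (\int[P]_w (expR (a * Yn w))%:E <=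
  (expR (step_const eta eps th T K2 * h))%:E *
  \int[P]_w (expR (a * expR (2 * (eta + eps * th) * h) * y2 w))%:E)%E.
Proof.
have [mG _] := GG.
have mX : measurable_fun setT (id : Om -> OmF).
  by move=> _ A; rewrite measurable_OmF setTI => /F0_sub.
pose X : {mfun Om >-> OmF} := mfun_Sub (mem_set mX).
have mV := measurable_vec mG.
have mPV : measurable_fun setT (fun w => Psi (w, vec G w)).
  exact: (measurableT_comp mPsi (measurable_fun_pair mX mV)).
apply: (@le_trans _ _ (\int[P]_w Psi (w, vec G w))%E).
  apply: ae_ge0_le_integral => //.
  - by apply/measurable_EFinP; apply: measurableT_comp => //; exact: measurable_funM.
  apply: filterS2 Yn_in Yn_out => w h1 h2 _; rewrite /Psi lee_fin /=.
  by case: ifPn => /asboolP wD; rewrite ler_expR ler_wpM2l//; [exact: h1|exact: h2].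
(* The increments are integrated first, with the past [X = id] frozen; independence is exactly
   [G_indep]. *)
rewrite (@integral_indep_vec _ _ _ P _ _ X n G Psi mG _ mPsi Psi0); last first.
  by move=> A E; rewrite measurable_OmF; exact: G_indep.
have my2' : measurable_fun setT (fun w => (expR (a * expR (2 * (eta + eps * th) * h) * y2 w))%:E).
  apply/measurable_EFinP; apply: measurableT_comp => //; apply: measurable_funM => //.
  exact: (measurableT_comp my2 mX).
rewrite -(ge0_integralZl P measurableT my2' _ (expR_EFin_ge0 _)); last first.
  by move=> w _; exact: expR_EFin_ge0.
apply: ge0_le_integral => //.
- by move=> w _; apply: integral_ge0.
- pose f2' (x : Om * Om) := Psi (x.1, vec G x.2).
  have mf2 : measurable_fun setT f2'.
    apply: (measurableT_comp mPsi); apply: measurable_fun_pair.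
      exact: (measurableT_comp mX measurable_fst).
    exact: (measurableT_comp mV measurable_snd).
  exact: (@measurable_fun_fubini_tonelli_F _ _ _ _ _ P f2' mf2 (fun _ => Psi0 _)).
- exact: emeasurable_funM.
Qed.
End one_step.

(** * Periodic fields on the unit square *)

Section unit_square.
Context (R : realType).
Implicit Types (f g : R * R -> R) (p : R * R).

(** The sigma-algebra of [plane R] is a product one, so an open set has to be exhausted by countably
    many products of intervals, here with rational centres and radii [1 / (n + 1)]. *)
Lemma open_measurable_plane (A : set (R * R)) : open A -> measurable (A : set (plane R)).
Proof.
move=> oA.
pose bx (a b : rat) (n : nat) : set (plane R) :=
  (ball (ratr a : R) n.+1%:R^-1) `*` (ball (ratr b : R) n.+1%:R^-1).
pose F a b n := if `[< bx a b n `<=` A >] then bx a b n else set0.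
have -> : A = \bigcup_a \bigcup_b \bigcup_n F a b n.
  apply/seteqP; split=> [[x y] Axy|p [a _] [b _] [n _]]; last first.
    by rewrite /F; case: ifPn => // /asboolP; apply.
  have /nbhs_ballP [e /= e0 eA] : nbhs (x, y) A by exact: open_nbhs_nbhs.
  (* Centres within [q < e / 2] of the coordinates give a box that contains the point and stays
     inside the ball of radius [e]. *)
  have [n nE] : exists n : nat, n.+1%:R^-1 < e / 2.
    have e20 : 0 < e / 2 by rewrite divr_gt0.
    have [N _ /(_ N (leqnn _)) h] := near_infty_natSinv_lt (PosNum e20).
    by exists N; exact: h.
  set q := n.+1%:R^-1 : R; have q0 : 0 < q by rewrite invr_gt0.
  rewrite -/q in nE.
  have [a /[!in_itv]/= /andP[a1 a2]] : exists a : rat, (ratr a : R) \in `]x - q, x + q[.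
    by apply: rat_in_itvoo; lra.
  have [b /[!in_itv]/= /andP[b1 b2]] : exists b : rat, (ratr b : R) \in `]y - q, y + q[.
    by apply: rat_in_itvoo; lra.
  exists a => //; exists b => //; exists n => //; rewrite /F asboolT.
    by split=> /=; rewrite /ball /= ltr_norml; apply/andP; split; rewrite -/q; lra.
  move=> [u v] [/=]; rewrite /ball /= -/q !ltr_norml => /andP[u1 u2] /andP[v1 v2].
  apply: eA; split; rewrite /ball /= ltr_norml; apply/andP; split; lra.
apply: bigcupT_measurable_rat => a; apply: bigcupT_measurable_rat => b.
apply: bigcupT_measurable => n; rewrite /F; case: ifPn => // _.
by apply: measurableX; exact: measurable_ball.
Qed.

Lemma continuous_measurable_plane f : continuous f ->
  measurable_fun setT (f : plane R -> R).
Proof.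
move=> /continuousP cf; apply: (measurability _ (RGenOpens.measurableE R)).
move=> _ [_ [a [b ->] <-]]; rewrite setTI; apply: open_measurable_plane.
exact/cf/interval_open.
Qed.

Local Notation N := (uniform_prob (@ltr01 R)).

Lemma uniform_prob01 (A : set (measurableTypeR R)) : measurable A ->
  N A = lebesgue_measure (A `&` `]0, 1[).
Proof.
move=> mA; rewrite -[LHS]mul1e -[in LHS](setIT A).
rewrite mul1e -integral_indic// integral_uniform; last 2 first.
- exact/measurable_EFinP/measurable_indic.
- by move=> x; rewrite lee_fin.
rewrite subr0 invr1 mul1e integral_itv_bndoo; last first.
  exact/measurable_EFinP/measurable_funTS/measurable_indic.
by rewrite integral_indic.
Qed.

(** Turns the restricted planar measure into a product of probability measures, to which the Fubini
    theorems apply. *)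
Lemma muD_prod (A : set (plane R)) : measurable A -> muD R A = (N \x N)%E A.
Proof.
move=> mA; apply/esym; apply: product_measure_unique => // B C mB mC.
rewrite /muD /= /mrestr /sqD -setXI product_measure1E; first last.
- by apply: measurableI => //; exact: measurable_itv.
- by apply: measurableI => //; exact: measurable_itv.
by congr (_ * _)%E; exact/esym/uniform_prob01.
Qed.

Lemma integral_muD (f : plane R -> \bar R) :
  (\int[muD R]_p f p = \int[N \x N]_p f p)%E.
Proof. by apply: eq_measure_integral => A mA _; exact: muD_prod. Qed.

Lemma integrable_muD (f : plane R -> \bar R) :
  (muD R).-integrable setT f -> (N \x N)%E.-integrable setT f.
Proof.
move=> /integrableP[mf fi]; apply/integrableP; split => //.
by rewrite -integral_muD.
Qed.

Lemma muD_setT : muD R setT = 1%E.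
Proof. by rewrite muD_prod// probability_setT. Qed.

Lemma integral_uniform01 (f : R -> R) : continuous f ->
  (\int[N]_x (f x)%:E = \int[lebesgue_measure]_(x in `[0%R, 1%R]) (f x)%:E)%E.
Proof.
move=> cf; have mf : measurable_fun setT (EFin \o f).
  by apply/measurable_EFinP; exact: continuous_measurable_fun.
rewrite integralE [in RHS]integralE !integral_uniform//; last 2 first.
- exact: measurable_funeneg.
- exact: measurable_funepos.
by rewrite subr0 invr1 !mul1e.
Qed.

Lemma integral_deriv_periodic (f g : R -> R) :
  (forall x : R, is_derive x (1 : R) f (g x)) -> continuous g -> f 0 = f 1 ->
  (\int[N]_x (g x)%:E = 0)%E.
Proof.
move=> fg cg f01; rewrite integral_uniform01//.
have df x : derivable f x 1 by have [] := fg x.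
have cf : continuous f by move=> x; apply: differentiable_continuous; exact/derivable1_diffP.
rewrite (@continuous_FTC2 _ g f)//.
- by rewrite f01 subee.
- exact: continuous_subspaceT.
- split.
  + by move=> x _.
  + by apply: cvg_at_right_filter; exact: cf.
  + by apply: cvg_at_left_filter; exact: cf.
- by move=> x _; rewrite derive1E; have [] := fg x.
Qed.

Definition bounded_continuous f :=
  continuous f /\ exists C, forall p, `|f p| <= C.

Lemma bounded_continuous_integrable f : bounded_continuous f ->
  (muD R).-integrable setT (EFin \o f).
Proof.
move=> [cf [C fC]]; apply: measurable_bounded_integrable => //.
- by have -> := muD_setT; rewrite ltry.
- exact: continuous_measurable_plane.
- exists C; split; first exact: num_real.
  by move=> M CM p _; apply: le_trans (fC p) _; exact: ltW.
Qed.

Lemma bounded_continuousD f g : bounded_continuous f -> bounded_continuous g ->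
  bounded_continuous (fun p => f p + g p).
Proof.
move=> [cf [C fC]] [cg [D gD]]; split.
  by move=> p; apply: cvgD; [exact: cf|exact: cg].
exists (C + D) => p; apply: le_trans (ler_normD _ _) _; exact: lerD.
Qed.

Lemma bounded_continuousM f g : bounded_continuous f -> bounded_continuous g ->
  bounded_continuous (fun p => f p * g p).
Proof.
move=> [cf [C fC]] [cg [D gD]]; split.
  by move=> p; apply: cvgM; [exact: cf|exact: cg].
by exists (C * D) => p; rewrite normrM ler_pM.
Qed.

Lemma bounded_continuous_cst (a : R) : bounded_continuous (fun=> a).
Proof. by split; [move=> p; exact: cvg_cst|exists `|a|]. Qed.

(** Stable under sums and products, so that each integration by parts becomes
    [integral_pderiv_periodic] applied to a product. Periodicity is only the equality of values on
    opposite edges of the square. *)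
Definition periodicC1 (i : 'I_2) f g :=
  [/\ bounded_continuous f, bounded_continuous g,
      forall p, is_derive (pcoord i p) 1 (pslice i f p) (g p) &
      forall p, pslice i f p 0 = pslice i f p 1].

Lemma continuous_pairl (b : R) : continuous (fun s : R => (s, b)).
Proof.
move=> x A [[A1 A2] [/= h1 h2] hA]; apply: filterS h1 => s As.
by apply: hA; split => //=; exact: nbhs_singleton.
Qed.

Lemma continuous_pairr (a : R) : continuous (fun s : R => (a, s)).
Proof.
move=> x A [[A1 A2] [/= h1 h2] hA]; apply: filterS h2 => s As.
by apply: hA; split => //=; exact: nbhs_singleton.
Qed.

(** With direction [i] integrated first, every slice contributes a difference of equal boundary
    values. *)
Lemma integral_pderiv_periodic i f g : periodicC1 i f g ->
  Rintegral (muD R) setT g = 0.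
Proof.
move=> [_ bg fg per]; rewrite /Rintegral.
have ig := integrable_muD (bounded_continuous_integrable bg).
case: bg => cg _; rewrite integral_muD.
move: fg per; rewrite /pcoord /pslice; case: (i == 0) => fg per.
- rewrite -(integral21_prod_meas1 ig) /fubini_G.
  rewrite (eq_integral (cst 0%E)); first by rewrite integral0.
  move=> y _; apply: (@integral_deriv_periodic (fun s => f (s, y))).
  + by move=> x; exact: (fg (x, y)).
  + move=> x; apply: (@continuous_comp _ _ _ (fun s : R => (s, y)) g); last exact: cg.
    exact: continuous_pairl.
  + exact: (per (0, y)).
- rewrite -(integral12_prod_meas1 ig) /fubini_F.
  rewrite (eq_integral (cst 0%E)); first by rewrite integral0.
  move=> x _; apply: (@integral_deriv_periodic (fun s => f (x, s))).
  + by move=> y; exact: (fg (x, y)).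
  + move=> y; apply: (@continuous_comp _ _ _ (fun s : R => (x, s)) g); last exact: cg.
    exact: continuous_pairr.
  + exact: (per (x, 0)).
Qed.

Lemma pslice_pcoord (i : 'I_2) f p : pslice i f p (pcoord i p) = f p.
Proof. by case: p => x y; rewrite /pslice /pcoord; case: ifP. Qed.

Lemma periodicC1D i f g f' g' : periodicC1 i f g -> periodicC1 i f' g' ->
  periodicC1 i (fun p => f p + f' p) (fun p => g p + g' p).
Proof.
move=> [bf bg fg per] [bf' bg' fg' per']; split.
- exact: bounded_continuousD.
- exact: bounded_continuousD.
- move=> p; have -> : pslice i (fun q => f q + f' q) p = pslice i f p + pslice i f' p.
    by rewrite /pslice; case: ifP.
  have ? := fg p; have ? := fg' p; exact: is_deriveD.
- move=> p; move: (per p) (per' p); rewrite /pslice.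
  by case: ifP => _ -> ->.
Qed.

Lemma periodicC1M i f g f' g' : periodicC1 i f g -> periodicC1 i f' g' ->
  periodicC1 i (fun p => f p * f' p) (fun p => g p * f' p + f p * g' p).
Proof.
move=> [bf bg fg per] [bf' bg' fg' per']; split.
- exact: bounded_continuousM.
- by apply: bounded_continuousD; exact: bounded_continuousM.
- move=> p; have -> : pslice i (fun q => f q * f' q) p = pslice i f p * pslice i f' p.
    by rewrite /pslice; case: ifP.
  have ? := fg p; have ? := fg' p; apply: is_derive_eq.
  by rewrite !pslice_pcoord /GRing.scale /=; ring.
- move=> p; move: (per p) (per' p); rewrite /pslice.
  by case: ifP => _ -> ->.
Qed.

Lemma periodicC1_cst i (a : R) : periodicC1 i (fun=> a) (fun=> 0).
Proof.
split; try exact: bounded_continuous_cst.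
- by move=> p; rewrite /pslice; case: ifP => _; exact: is_derive_cst.
- by move=> p; rewrite /pslice; case: ifP.
Qed.

Lemma periodicC1_sum (I : Type) (s : seq I) i (f g : I -> R * R -> R) :
  (forall k, periodicC1 i (f k) (g k)) ->
  periodicC1 i (fun p => \sum_(k <- s) f k p) (fun p => \sum_(k <- s) g k p).
Proof.
move=> fg; elim: s => [|k s IHs].
  under eq_fun do rewrite big_nil. under [X in periodicC1 _ _ X]eq_fun do rewrite big_nil.
  exact: periodicC1_cst.
under eq_fun do rewrite big_cons. under [X in periodicC1 _ _ X]eq_fun do rewrite big_cons.
exact: periodicC1D.
Qed.
End unit_square.

(** * Trigonometric modes and solenoidal eigenfields *)

Section fourier_modes.
Context (R : realType).
Implicit Types (p : R * R) (k l : int).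

Definition trig k (x : R) : R :=
  if k == 0 then 1 else
  if 0 < k then Num.sqrt 2 * cos (2 * pi * k%:~R * x)
  else Num.sqrt 2 * sin (2 * pi * (- k)%:~R * x).

(** Coding cosines by positive and sines by negative indices gives one formula for all [k]:
    differentiation reverses the sign of the index. *)
Lemma is_derive_trig k (x : R) :
  is_derive x (1 : R) (trig k) (- (2 * pi * k%:~R) * trig (- k) x).
Proof.
have lin (a : R) : is_derive x (1 : R) (fun y => a * y) a.
  by apply: is_derive_eq; rewrite /GRing.scale /= mulr1.
rewrite /trig; case: (ltgtP k 0) => [k0|k0|->].
- rewrite oppr_eq0 (lt_eqF k0) oppr_gt0 k0.
  have h := is_derive1_comp (is_derive_sin _) (lin (2 * pi * (- k)%:~R)).
  refine (is_derive_eq (is_deriveM (is_derive_cst (Num.sqrt 2 : R) x (1 : R)) h) _).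
  by rewrite /GRing.scale /= /cst mulrNz; ring.
- rewrite oppr_eq0 (gt_eqF k0) oppr_gt0 ltNge (ltW k0) /= opprK.
  have h := is_derive1_comp (is_derive_cos _) (lin (2 * pi * k%:~R)).
  refine (is_derive_eq (is_deriveM (is_derive_cst (Num.sqrt 2 : R) x (1 : R)) h) _).
  by rewrite /GRing.scale /= /cst; ring.
- rewrite eqxx mulr0z mulr0 oppr0 mul0r; exact: is_derive_cst.
Qed.

Lemma continuous_trig k : continuous (trig k : R -> R).
Proof.
move=> x; apply: differentiable_continuous; apply/derivable1_diffP.
by have [] := is_derive_trig k x.
Qed.

Lemma trig_le k (x : R) : `|trig k x| <= Num.sqrt 2.
Proof.
have s2 : 1 <= Num.sqrt 2 :> R by rewrite -{1}sqrtr1 ler_sqrt ?ler1n.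
rewrite /trig; case: ifP => _; first by rewrite normr1.
case: ifP => _; rewrite normrM ger0_norm ?sqrtr_ge0// ler_piMr ?sqrtr_ge0//.
  by rewrite ler_norml cos_geN1 cos_le1.
by rewrite ler_norml sin_geN1 sin_le1.
Qed.

Lemma trig_periodic k : trig k 0 = trig k 1 :> R.
Proof.
have cs n : cos (2 * pi * n%:R) = 1 :> R /\ sin (2 * pi * n%:R) = 0 :> R.
  elim: n => [|n [cn sn]]; first by rewrite mulr0n mulr0 cos0 sin0.
  rewrite -[n.+1]addn1 natrD mulrDr mulr1 cosD sinD cn sn mulr_natl cos2pi sin2pi.
  by rewrite !(mulr1, mulr0, mul0r) subr0 addr0.
have c n := (cs n).1; have s n := (cs n).2.
rewrite /trig !mulr0 !mulr1 cos0 sin0.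
case: ifP => // _; case: ifPn => [|].
  by case: k => // n _; rewrite -pmulrn c.
rewrite -leNgt; case: k => [n|n] k0; last by rewrite NegzE opprK -pmulrn s.
have /eqP -> : n == 0%N by rewrite -leqn0 -lez_nat.
by rewrite mulrNz mulr0z oppr0 !mulr0 sin0 ?mulr0.
Qed.

Definition wave k l p : R := trig k p.1 * trig l p.2.

Lemma bounded_continuous_wave k l : bounded_continuous (wave k l).
Proof.
split.
  move=> p; apply: (@cvgM R (R * R)%type); apply: continuous_comp.
  - exact: cvg_fst.
  - exact: continuous_trig.
  - exact: cvg_snd.
  - exact: continuous_trig.
exists 2 => p; rewrite /wave normrM.
have s2 : Num.sqrt 2 * Num.sqrt 2 = 2 :> R by rewrite -expr2 sqr_sqrtr.
by rewrite -s2 ler_pM ?trig_le.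
Qed.

Lemma wave_le k l p : `|wave k l p| <= 2.
Proof.
have s2 : Num.sqrt 2 * Num.sqrt 2 = 2 :> R by rewrite -expr2 sqr_sqrtr.
by rewrite /wave normrM -s2 ler_pM ?trig_le.
Qed.

Lemma bounded_continuousZ (a : R) (f : R * R -> R) : bounded_continuous f ->
  bounded_continuous (fun p => a * f p).
Proof. by move=> bf; apply: bounded_continuousM => //; exact: bounded_continuous_cst. Qed.

Lemma periodicC1Z i (a : R) f g : periodicC1 i f g ->
  periodicC1 i (fun p => a * f p) (fun p => a * g p).
Proof.
move=> fg; have := periodicC1M (periodicC1_cst i a) fg.
congr periodicC1; apply/funext => p /=; by rewrite mul0r add0r.
Qed.

Lemma periodicC1_wave0 k l :
  periodicC1 0 (wave k l) (fun p => - (2 * pi * k%:~R) * wave (- k) l p).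
Proof.
split.
- exact: bounded_continuous_wave.
- by apply: bounded_continuousZ; exact: bounded_continuous_wave.
- move=> p; rewrite /pslice /pcoord /= /wave.
  refine (is_derive_eq (is_deriveM (is_derive_trig k p.1)
    (is_derive_cst (trig l p.2 : R) p.1 (1 : R))) _).
  by rewrite /GRing.scale /= /cst; ring.
- by move=> p; rewrite /pslice /= /wave /= trig_periodic.
Qed.

Lemma periodicC1_wave1 k l :
  periodicC1 1 (wave k l) (fun p => - (2 * pi * l%:~R) * wave k (- l) p).
Proof.
split.
- exact: bounded_continuous_wave.
- by apply: bounded_continuousZ; exact: bounded_continuous_wave.
- move=> p; rewrite /pslice /pcoord /= /wave.
  refine (is_derive_eq (is_deriveM (is_derive_cst (trig k p.1 : R) p.2 (1 : R))
    (is_derive_trig l p.2)) _).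
  by rewrite /GRing.scale /= /cst; ring.
- by move=> p; rewrite /pslice /= /wave /= trig_periodic.
Qed.

Definition periodic_field (i : 'I_2) (V V' : R * R -> R * R) : Prop :=
  periodicC1 i (fun p => (V p).1) (fun p => (V' p).1) /\
  periodicC1 i (fun p => (V p).2) (fun p => (V' p).2).


(* V is a solenoidal eigenfunction of the periodic Laplacian; V1 i and V2 i are
   its first and pure second derivatives in direction i. *)
Record mode (V : R * R -> R * R) (V1 V2 : 'I_2 -> R * R -> R * R) (m : R) : Prop := {
  mode_deriv : forall i, periodic_field i V (V1 i);
  mode_deriv2 : forall i, periodic_field i (V1 i) (V2 i);
  mode_div : forall p, (V1 0 p).1 + (V1 1 p).2 = 0;
  mode_eigen1 : forall p, (V2 0 p).1 + (V2 1 p).1 = - m * (V p).1;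
  mode_eigen2 : forall p, (V2 0 p).2 + (V2 1 p).2 = - m * (V p).2;
  mode_bound : forall p, pnorm (V p) <= 2;
  mode_gap : m = 0 \/ 1 <= m }.

Lemma mode_const (a b : R) : a ^+ 2 + b ^+ 2 = 1 ->
  mode (fun=> (a, b)) (fun=> fun=> (0, 0)) (fun=> fun=> (0, 0)) 0.
Proof.
move=> ab; split => //=.
- by move=> i; split; exact: periodicC1_cst.
- by move=> i; split; exact: periodicC1_cst.
- by move=> _; rewrite addr0.
- by move=> _; rewrite addr0 oppr0 mul0r.
- by move=> _; rewrite addr0 oppr0 mul0r.
- by move=> _; rewrite /pnorm /= ab sqrtr1 ler1n.
- by left.
Qed.

Definition wave_field (a b : R) (k l k' l' : int) p : R * R :=
  (a * wave k l p, b * wave k' l' p).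

Lemma periodic_wave_field0 a b k l k' l' :
  periodic_field 0 (wave_field a b k l k' l')
    (wave_field (- (2 * pi * k%:~R * a)) (- (2 * pi * k'%:~R * b)) (- k) l (- k') l').
Proof.
split => /=.
  have := periodicC1Z a (periodicC1_wave0 k l).
  by congr periodicC1; apply/funext => p; ring.
have := periodicC1Z b (periodicC1_wave0 k' l').
by congr periodicC1; apply/funext => p; ring.
Qed.

Lemma periodic_wave_field1 a b k l k' l' :
  periodic_field 1 (wave_field a b k l k' l')
    (wave_field (- (2 * pi * l%:~R * a)) (- (2 * pi * l'%:~R * b)) k (- l) k' (- l')).
Proof.
split => /=.
  have := periodicC1Z a (periodicC1_wave1 k l).
  by congr periodicC1; apply/funext => p; ring.
have := periodicC1Z b (periodicC1_wave1 k' l').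
by congr periodicC1; apply/funext => p; ring.
Qed.

(** Both terms of the divergence are multiples of [wave (- k) l] with opposite coefficients. Two
    derivatives in one direction restore the wave with factor [- 4 pi^2 k^2] or [- 4 pi^2 l^2]. The
    bound 2 follows from [q^2 (k^2 + l^2) = 1], and the eigenvalue exceeds 1 since
    [k^2 + l^2 >= 1]. *)
Lemma mode_wave_field k l : (k, l) <> (0, 0) ->
  let q := (Num.sqrt (k ^+ 2 + l ^+ 2)%:~R)^-1 in
  exists V1 V2, mode (wave_field (q * l%:~R) (q * k%:~R) k l (- k) (- l)) V1 V2
    (4 * pi ^+ 2 * (k ^+ 2 + l ^+ 2)%:~R).
Proof.
move=> kl q.
have n1 : 1 <= k ^+ 2 + l ^+ 2.
  have k2 : 0 <= k ^+ 2 by exact: sqr_ge0.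
  have l2 : 0 <= l ^+ 2 by exact: sqr_ge0.
  have [k0|k0] := eqVneq k 0.
    have l0 : l != 0 by apply/eqP => l0; apply: kl; rewrite k0 l0.
    by rewrite k0 expr0n add0r -gtz0_ge1 lt_neqAle l2 andbT eq_sym sqrf_eq0.
  by rewrite -gtz0_ge1 ltr_pwDl// lt_neqAle k2 andbT eq_sym sqrf_eq0.
have n1R : 1 <= (k ^+ 2 + l ^+ 2)%:~R :> R by rewrite -[1]/(1%:~R) ler_int.
set a := q * l%:~R; set b := q * k%:~R.
pose V1 (i : 'I_2) := if i == 0
  then wave_field (- (2 * pi * k%:~R * a)) (- (2 * pi * (- k)%:~R * b)) (- k) l (- - k) (- l)
  else wave_field (- (2 * pi * l%:~R * a)) (- (2 * pi * (- l)%:~R * b)) k (- l) (- k) (- - l).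
pose V2 (i : 'I_2) := if i == 0
  then wave_field (- (2 * pi * (- k)%:~R * - (2 * pi * k%:~R * a)))
    (- (2 * pi * (- - k)%:~R * - (2 * pi * (- k)%:~R * b))) (- - k) l (- - - k) (- l)
  else wave_field (- (2 * pi * (- l)%:~R * - (2 * pi * l%:~R * a)))
    (- (2 * pi * (- - l)%:~R * - (2 * pi * (- l)%:~R * b))) k (- - l) (- k) (- - - l).
have i01 (i : 'I_2) : (i == 0) || (i == 1) by case: i => -[|[|]].
exists V1, V2; split.
- move=> i; rewrite /V1; case/orP: (i01 i) => /eqP -> /=.
    exact: periodic_wave_field0.
  exact: periodic_wave_field1.
- move=> i; rewrite /V1 /V2; case/orP: (i01 i) => /eqP -> /=.
    exact: periodic_wave_field0.
  exact: periodic_wave_field1.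
- move=> p; rewrite /V1 /= !opprK /a /b !mulrNz; ring.
- move=> p; rewrite /V2 /= !opprK /a /b !mulrNz.
  by rewrite intrD !rmorphXn /=; ring.
- move=> p; rewrite /V2 /= !opprK /a /b !mulrNz.
  by rewrite intrD !rmorphXn /=; ring.
- move=> p; rewrite /pnorm /wave_field /=.
  have -> : 2 = Num.sqrt (2 ^+ 2) :> R by rewrite sqrtr_sqr ger0_norm.
  rewrite ler_sqrt//.
  have w2 k' l' : wave k' l' p ^+ 2 <= 2 ^+ 2 :> R.
    by rewrite -real_normK ?num_real// ler_pXn2r ?nnegrE// wave_le.
  have q2 : q ^+ 2 * (k ^+ 2 + l ^+ 2)%:~R = 1.
    rewrite exprVn sqr_sqrtr ?(le_trans ler01)// mulVf// gt_eqF//.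
    exact: lt_le_trans n1R.
  rewrite intrD !rmorphXn /= mulrDr in q2.
  have h1 := ler_wpM2l (mulr_ge0 (sqr_ge0 q) (sqr_ge0 (l%:~R : R))) (w2 k l).
  have h2 := ler_wpM2l (mulr_ge0 (sqr_ge0 q) (sqr_ge0 (k%:~R : R))) (w2 (- k) (- l)).
  rewrite (_ : (a * wave k l p) ^+ 2 + (b * wave (- k) (- l) p) ^+ 2 =
    q ^+ 2 * l%:~R ^+ 2 * wave k l p ^+ 2 +
    q ^+ 2 * k%:~R ^+ 2 * wave (- k) (- l) p ^+ 2); last by rewrite /a /b; ring.
  apply: le_trans (lerD h1 h2) _.
  by rewrite -mulrDl addrC q2 mul1r.
- right; have pi1 : 1 <= pi :> R by apply: le_trans (pi_ge2 R); rewrite ler1n.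
  have pi2 : 1 <= pi ^+ 2 :> R by rewrite expr_ge1// (le_trans ler01).
  have : 0 <= (pi ^+ 2 - 1) * (k ^+ 2 + l ^+ 2)%:~R :> R.
    by rewrite mulr_ge0 ?subr_ge0// (le_trans ler01).
  by lra.
Qed.
End fourier_modes.

Lemma measurable_fun_pairS d d1 d2 (T : measurableType d) (T1 : measurableType d1)
    (T2 : measurableType d2) (D : set T) (f : T -> T1) (g : T -> T2) :
  measurable_fun D f -> measurable_fun D g -> measurable_fun D (fun x => (f x, g x)).
Proof.
move=> mf mg mD; move: (mD); apply: (measurability _ (measurable_prod_measurableType T1 T2)).
move=> _ [_ [A mA [B mB <-]] <-].
rewrite (_ : D `&` _ = (D `&` f @^-1` A) `&` (D `&` g @^-1` B)).
  by apply: measurableI; [exact: mf|exact: mg].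
by apply/seteqP; split=> x /= [] => [Dx [Ax Bx]|[Dx Ax] [_ Bx]].
Qed.

(** * Classes of square integrable fields *)

Section classes.
Context (R : realType).
Local Notation U := (Uspace R).
Local Notation mu := (muD R).
Implicit Types (u : U) (v : plane R -> plane R).

Lemma ae_sqD : {ae mu, forall x, @sqD R x}.
Proof.
exists (~` @sqD R); split => //.
- by apply: measurableC; exact: measurable_sqD.
- by rewrite /muD /= /mrestr setICl measure0.
Qed.

Lemma is_class_Uval u : is_class (Uval u) u.
Proof.
split; last exact: nearW.
apply: measurable_funTS; apply: measurable_fun_pair.
- exact: (measurable_funPT (L2rep u).1).
- exact: (measurable_funPT (L2rep u).2).
Qed.

Lemma is_class_uniq v u u' : is_class v u -> is_class v u' -> u = u'.
Proof.
move=> [_ h] [_ h']; rewrite -[u]L2repK -[u']L2repK; apply/L2_eqP.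
by apply: filterS2 h h' => x <- [].
Qed.

Lemma is_class_ae v v' u : is_class v u -> measurable_fun (@sqD R) v' ->
  {ae mu, forall x, v x = v' x} -> is_class v' u.
Proof. by move=> [_ h] mv' vv'; split=> //; apply: filterS2 h vv' => x ->. Qed.

Lemma measurable_class1 v u : is_class v u ->
  measurable_fun (@sqD R) (fun x => (v x).1 : measurableTypeR R).
Proof. by move=> [mv _]; exact: (measurableT_comp measurable_fst mv). Qed.

Lemma measurable_class2 v u : is_class v u ->
  measurable_fun (@sqD R) (fun x => (v x).2 : measurableTypeR R).
Proof. by move=> [mv _]; exact: (measurableT_comp measurable_snd mv). Qed.

Lemma is_classP v u a v' u' : is_class v u -> is_class v' u' ->
  is_class (fun x => (a * (v x).1 + (v' x).1, a * (v x).2 + (v' x).2))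
    (a *: u + u').
Proof.
move=> h h'; split.
  apply: measurable_fun_pairS.
  - apply: measurable_funD; last exact: measurable_class1 h'.
    by apply: measurable_funM => //; exact: measurable_class1 h.
  - apply: measurable_funD; last exact: measurable_class2 h'.
    by apply: measurable_funM => //; exact: measurable_class2 h.
case: h h' => [_ h] [_ h'].
have := @L2_reprP _ _ _ mu (a *: u + u') (a *: L2rep u + L2rep u') _.
rewrite L2piD L2piZ !L2repK => /(_ erefl) hr.
by apply: filterS3 h h' hr => x; rewrite /Uval => <- <- /= [-> ->].
Qed.

Lemma is_class0 : is_class (fun=> (0, 0)) (0 : U).
Proof.
have := is_classP 0 (is_class_Uval (0 : U)) (is_class_Uval (0 : U)).
rewrite scale0r addr0 => h; apply: is_class_ae h _ _; first exact: measurable_cst.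
have := @L2_reprP _ _ _ mu (0 : U) 0 _.
have -> : 0 = L2class 0 :> U by rewrite -[L2class 0](addrK (L2class 0 : U)) -L2piD addr0 subrr.
move=> /(_ erefl); apply: filterS => x; rewrite /Uval /= => -[-> ->].
by congr pair; rewrite mul0r add0r.
Qed.

Lemma is_class_sum (I : Type) (s : seq I) (a : I -> R) (v : I -> plane R -> plane R)
    (u : I -> U) : (forall i, is_class (v i) (u i)) ->
  is_class (fun x => (\sum_(i <- s) a i * (v i x).1, \sum_(i <- s) a i * (v i x).2))
    (\sum_(i <- s) a i *: u i).
Proof.
move=> vu; elim: s => [|i s IHs].
  rewrite big_nil; have -> : (fun x => (\sum_(i <- [::]) a i * (v i x).1,
      \sum_(i <- [::]) a i * (v i x).2)) = fun=> (0, 0).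
    by apply/funext => x; rewrite !big_nil.
  exact: is_class0.
rewrite big_cons.
have -> : (fun x => (\sum_(j <- i :: s) a j * (v j x).1, \sum_(j <- i :: s) a j * (v j x).2)) =
    fun x => (a i * (v i x).1 + \sum_(j <- s) a j * (v j x).1,
              a i * (v i x).2 + \sum_(j <- s) a j * (v j x).2).
  by apply/funext => x; rewrite !big_cons.
exact: (is_classP _ (vu i) IHs).
Qed.

Definition dot_fun v v' x : R := (v x).1 * (v' x).1 + (v x).2 * (v' x).2.

Lemma is_class_dot v u v' u' : is_class v u -> is_class v' u' ->
  (L2dot u u')%:E = (\int[mu]_(x in @sqD R) (dot_fun v v' x)%:E)%E.
Proof.
move=> h h'; have iU := L2dot_integrable (L2rep u) (L2rep u').
rewrite /L2dot /L2dot_fun /Rintegral fineK; last exact: integrable_fin_num.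
have mD := @measurable_sqD R.
rewrite (@negligible_integral _ _ _ _ _ (~` @sqD R))//; last 2 first.
- exact: measurableC.
- by rewrite /muD /= /mrestr setICl measure0.
rewrite setDE setCK setTI.
apply: ae_eq_integral => //.
- by apply: measurable_funTS; exact: measurable_int iU.
- apply/measurable_EFinP; apply: measurable_funD; apply: measurable_funM.
  + exact: measurable_class1 h.
  + exact: measurable_class1 h'.
  + exact: measurable_class2 h.
  + exact: measurable_class2 h'.
case: h h' => [_ h] [_ h'].
by apply: filterS2 h h' => x; rewrite /Uval /dot_fun => <- <- _.
Qed.

Lemma is_class_cls v : measurable_fun (@sqD R) v ->
  (\int[mu]_(x in @sqD R) (dot_fun v v x)%:E < +oo)%E -> is_class v (cls v).
Proof.
move=> mv iv; apply: xgetPex.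
have mD := @measurable_sqD R.
have m1 : measurable_fun (@sqD R) (fun x => (v x).1 : measurableTypeR R).
  exact: (measurableT_comp measurable_fst mv).
have m2 : measurable_fun (@sqD R) (fun x => (v x).2 : measurableTypeR R).
  exact: (measurableT_comp measurable_snd mv).
(* Representatives live on the whole plane, whereas [v] is controlled on the square only; hence the
   extension by 0. *)
have inL (f : plane R -> R) : measurable_fun (@sqD R) f ->
    (forall x, f x ^+ 2 <= dot_fun v v x) -> f \_ (@sqD R) \in Lfun mu 2%:E.
  move=> mf fle; have mfD : measurable_fun setT (f \_ (@sqD R)).
    by apply/(measurable_restrict _ mD measurableT); rewrite setTI.
  rewrite inE; apply/andP; split; rewrite inE/=; first exact: mfD.
  rewrite /finite_norm unlock /Lnorm; apply: poweR_lty; apply: le_lt_trans iv.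
  rewrite [leRHS]integral_mkcond; apply: ge0_le_integral => //.
  - by move=> x _; exact: poweR_ge0.
  - apply/measurable_EFinP/(@measurableT_comp _ _ _ _ _ _ (fun x : R => x `^ 2)%R) => //.
    exact/measurableT_comp.
  - apply/(measurable_restrict _ mD measurableT); rewrite setTI.
    by apply/measurable_EFinP; apply: measurable_funD; exact: measurable_funM.
  move=> x _; rewrite /= !patchE; case: ifPn => xD.
    by rewrite lee_fin powR_mulrn// real_normK ?num_real.
  by rewrite normr0 powR0.
have L1 : (fun x => (v x).1) \_ (@sqD R) \in Lfun mu 2%:E.
  by apply: inL => // x; rewrite /dot_fun expr2 lerDl -expr2 sqr_ge0.
have L2 : (fun x => (v x).2) \_ (@sqD R) \in Lfun mu 2%:E.
  by apply: inL => // x; rewrite /dot_fun expr2 lerDr -expr2 sqr_ge0.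
pose f : L2fun mu := (Lfun_Sub (lee1n 2) L1, Lfun_Sub (lee1n 2) L2).
exists (L2class f); split => //.
have := @L2_reprP _ _ _ mu (L2class f) f erefl.
move=> h; apply: filterS2 h ae_sqD => x; rewrite /Uval => -[-> ->] xD.
by rewrite /f /= !patchE mem_set//; case: (v x).
Qed.

Lemma normr_sqr u : `|u| ^+ 2 = L2dot u u.
Proof. by rewrite L2normE sqr_sqrtr ?L2dot_ge0. Qed.

Lemma is_class_norm_le v u (C : R) : is_class v u ->
  (\int[mu]_(x in @sqD R) (dot_fun v v x)%:E <= C%:E)%E -> `|u| ^+ 2 <= C.
Proof. by move=> h; rewrite -(is_class_dot h h) lee_fin normr_sqr. Qed.

Lemma L2dotDr (u v w : U) : L2dot u (v + w) = L2dot u v + L2dot u w.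
Proof. by rewrite L2dotC L2dotDl !(L2dotC u). Qed.

Lemma L2dotZr a (u v : U) : L2dot u (a *: v) = a * L2dot u v.
Proof. by rewrite L2dotC L2dotZl L2dotC. Qed.

Lemma L2dot_suml (I : Type) (s : seq I) (f : I -> U) u :
  L2dot (\sum_(i <- s) f i) u = \sum_(i <- s) L2dot (f i) u.
Proof.
elim: s => [|i s IHs]; first by rewrite !big_nil L2dot0l.
by rewrite !big_cons L2dotDl IHs.
Qed.

Lemma L2dot_sumr (I : Type) (s : seq I) (f : I -> U) u :
  L2dot u (\sum_(i <- s) f i) = \sum_(i <- s) L2dot u (f i).
Proof. by rewrite L2dotC L2dot_suml; apply: eq_bigr => i _; rewrite L2dotC. Qed.

Lemma is_class_dotT v u v' u' : is_class v u -> is_class v' u' ->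
  measurable_fun setT (dot_fun v v') -> L2dot u u' = Rintegral mu setT (dot_fun v v').
Proof.
move=> [_ h] [_ h'] md; have iU := L2dot_integrable (L2rep u) (L2rep u').
congr fine; apply: ae_eq_integral => //.
- exact: measurable_int iU.
- exact/measurable_EFinP.
by apply: filterS2 h h' => x; rewrite /Uval /dot_fun => <- <- _.
Qed.

Lemma cls_eq v u : is_class v u -> cls v = u.
Proof.
move=> h; have h' : is_class v (cls v) by apply: xgetPex; exists u.
exact: is_class_uniq h' h.
Qed.

Section orthonormal_family.
Context (I : finType) (e : I -> U).
Hypothesis eo : forall i j, L2dot (e i) (e j) = (i == j)%:R.

Lemma orthonormal_coord (x : I -> R) k : L2dot (e k) (\sum_i x i *: e i) = x k.
Proof.
rewrite L2dot_sumr (bigD1 k)//= L2dotZr eo eqxx mulr1 big1 ?addr0// => i ik.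
by rewrite L2dotZr eo eq_sym (negbTE ik) mulr0.
Qed.

Lemma orthonormal_dot (x y : I -> R) :
  L2dot (\sum_i x i *: e i) (\sum_i y i *: e i) = \sum_i x i * y i.
Proof.
rewrite L2dot_suml; apply: eq_bigr => i _.
by rewrite L2dotZl orthonormal_coord.
Qed.

Lemma orthonormal_norm (x : I -> R) : `|\sum_i x i *: e i| ^+ 2 = \sum_i x i ^+ 2.
Proof. by rewrite normr_sqr orthonormal_dot; apply: eq_bigr => i _; rewrite expr2. Qed.

Lemma bessel u : \sum_i L2dot (e i) u ^+ 2 <= `|u| ^+ 2.
Proof.
rewrite normr_sqr; set S := \sum_i L2dot (e i) u *: e i; pose w := u - S.
have SS : L2dot S S = \sum_i L2dot (e i) u ^+ 2 by rewrite -normr_sqr orthonormal_norm.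
have Su : L2dot S u = \sum_i L2dot (e i) u ^+ 2.
  by rewrite L2dot_suml; apply: eq_bigr => i _; rewrite L2dotZl.
have -> : \sum_i L2dot (e i) u ^+ 2 = L2dot u u - L2dot w w.
  have -> : w = -1 *: S + u by rewrite scaleN1r addrC.
  rewrite L2dotP !(L2dotC _ (_ + _)) !L2dotP (L2dotC u S) SS Su; ring.
by rewrite lerBlDr lerDl L2dot_ge0.
Qed.
End orthonormal_family.
End classes.

Section square_fields.
Context (R : realType).
Local Notation U := (Uspace R).
Local Notation mu := (muD R).
Implicit Types (u w : U) (v : plane R -> plane R).

Lemma Rintegral_bcD (f g : R * R -> R) : bounded_continuous f -> bounded_continuous g ->
  Rintegral mu setT (fun p => f p + g p) = Rintegral mu setT f + Rintegral mu setT g.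
Proof. by move=> bf bg; rewrite RintegralD//; exact: bounded_continuous_integrable. Qed.

Lemma ler_Rintegral_bc (f g : R * R -> R) : bounded_continuous f -> bounded_continuous g ->
  (forall p, f p <= g p) -> Rintegral mu setT f <= Rintegral mu setT g.
Proof.
move=> bf bg fg; apply: le_Rintegral => //; exact: bounded_continuous_integrable.
Qed.

Lemma Rintegral_bcZ a (f : R * R -> R) : bounded_continuous f ->
  Rintegral mu setT (fun p => a * f p) = a * Rintegral mu setT f.
Proof. by move=> bf; rewrite RintegralZl//; exact: bounded_continuous_integrable. Qed.

Definition bc_field v :=
  bounded_continuous (fun p => (v p).1) /\ bounded_continuous (fun p => (v p).2).

Lemma bounded_continuous_dot v v' : bc_field v -> bc_field v' ->
  bounded_continuous (dot_fun v v').
Proof.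
move=> [b1 b2] [b1' b2'].
by apply: bounded_continuousD; exact: bounded_continuousM.
Qed.

Lemma bc_field_measurable v : bc_field v -> measurable_fun setT v.
Proof.
move=> [[c1 _] [c2 _]].
have -> : v = fun p => ((v p).1, (v p).2) by apply/funext => p; case: (v p).
by apply: measurable_fun_pairS; exact: continuous_measurable_plane.
Qed.

Lemma bc_field_class v : bc_field v -> is_class v (cls v).
Proof.
move=> bv; have mv := bc_field_measurable bv.
apply: is_class_cls; first exact: measurable_funTS.
have /integrableP[md] := bounded_continuous_integrable (bounded_continuous_dot bv bv).
apply: le_lt_trans; rewrite integral_mkcond; apply: ge0_le_integral => //.
- by move=> p _; apply: erestrict_ge0 => q _; rewrite lee_fin /dot_fun addr_ge0// -expr2 sqr_ge0.
- apply/(measurable_restrictT _ (@measurable_sqD R)); exact: measurable_funTS.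
- exact: measurableT_comp.
move=> p _; rewrite patchE; case: ifPn => _.
  by rewrite lee_fin ler_norm.
exact: abse_ge0.
Qed.

Lemma bc_field_dot v u v' u' : bc_field v -> bc_field v' ->
  is_class v u -> is_class v' u' -> L2dot u u' = Rintegral mu setT (dot_fun v v').
Proof.
move=> bv bv' h h'; apply: is_class_dotT => //.
by apply: continuous_measurable_plane; case: (bounded_continuous_dot bv bv').
Qed.

Lemma Uval_measurable u : measurable_fun setT (Uval u).
Proof.
apply: measurable_fun_pair; first exact: (measurable_funPT (L2rep u).1).
exact: (measurable_funPT (L2rep u).2).
Qed.

Lemma measurable_pcoord i : measurable_fun setT (@pcoord R i).
Proof.
by rewrite /pcoord; case: (_ == 0); [exact: measurable_fst|exact: measurable_snd].
Qed.

Lemma pcoord_bc i v : bc_field v -> bounded_continuous (fun p => pcoord i (v p)).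
Proof. by case=> b1 b2; rewrite /pcoord; case: (_ == 0). Qed.

Lemma Rintegral_pcoord j u v (f : R * R -> R) : is_class v u -> bc_field v ->
  continuous f ->
  Rintegral mu setT (fun p => pcoord j (Uval u p) * f p) =
  Rintegral mu setT (fun p => pcoord j (v p) * f p).
Proof.
move=> [_ h] bv cf; have mf := continuous_measurable_plane cf.
congr fine; apply: ae_eq_integral => //.
- apply/measurable_EFinP; apply: measurable_funM => //.
  by apply: measurableT_comp; [exact: measurable_pcoord|exact: Uval_measurable].
- apply/measurable_EFinP; apply: measurable_funM => //.
  by apply: measurableT_comp; [exact: measurable_pcoord|exact: bc_field_measurable].
by apply: filterS h => p -> _.
Qed.

Lemma pcoord_periodic i j v v' : periodic_field i v v' ->
  periodicC1 i (fun p => pcoord j (v p)) (fun p => pcoord j (v' p)).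
Proof. by case=> h1 h2; rewrite /pcoord; case: (_ == 0). Qed.

Lemma periodic_field_bc i v v' : periodic_field i v v' -> bc_field v /\ bc_field v'.
Proof. by case=> -[b1 b1' _ _] [b2 b2' _ _]; split; split. Qed.

(** A function with compact support in the open square vanishes on all edges, hence is periodic, and
    continuity on the support makes it bounded. *)
Lemma test_fun_periodic i (f : R * R -> R) : test_fun f -> periodicC1 i f (pderiv i f).
Proof.
move=> [sf [K [cK KD fK]]].
have [cf df] := sf [::]; have [cg _] := sf [:: i]; rewrite /= in cf df cg.
have clK : closed K by apply: compact_closed => //; exact: norm_hausdorff.
have bdd (g : R * R -> R) : continuous g -> (forall p, ~ K p -> g p = 0) ->
    bounded_continuous g.
  move=> cg' gK; split => //.
  have cn : {within K, continuous g} by exact: continuous_subspaceT.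
  have [M [_ hM]] := compact_bounded (continuous_compact cn cK).
  exists (`|M| + 1) => p; have [Kp|nKp] := pselect (K p); last by rewrite gK// normr0 addr_ge0.
  by apply: (hM (`|M| + 1)); [rewrite ltr_pwDr// ler_norm|exists p].
(* The complement of [K] is open, so near such a point the slice is locally constant. *)
have g0 p : ~ K p -> pderiv i f p = 0.
  move=> nKp; have oK : nbhs p (~` K) by apply: open_nbhs_nbhs; split => //; exact: closed_openC.
  rewrite /pderiv derive1E (@near_eq_derive _ _ _ (pslice i f p) (cst 0)) ?derive_cst//.
  rewrite /pslice /pcoord; move: oK; case: p {nKp} => a b oK; case: ifP => _ /=.
    have h : nbhs a [set s | ~ K (s, b)] := @continuous_pairl R b a _ oK.
    by apply: filterS h => s /fK.
  have h : nbhs b [set s | ~ K (a, s)] := @continuous_pairr R a b _ oK.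
  by apply: filterS h => s /fK.
split; [exact: bdd|exact: bdd| |].
- by move=> p; rewrite /pderiv derive1E; exact/derivableP/df.
- move=> p; rewrite /pslice; case: ifP => _.
    by rewrite !fK// => /KD [/=]; rewrite in_itv/= ltxx ?andbF.
  by rewrite !fK// => /KD [/= _]; rewrite in_itv/= ltxx ?andbF.
Qed.

(** The derivative of the product of a component of [v] with the test function has integral 0 over
    the period square. *)
Lemma periodic_wderiv i v v' w : is_class v w -> periodic_field i v v' ->
  is_wderiv i w (cls v').
Proof.
move=> vw vv' f tf j; have [bv bv'] := periodic_field_bc vv'.
have pf := test_fun_periodic i tf; have [[cf bf] [cg bg] _ _] := pf.
rewrite (Rintegral_pcoord j vw bv cg) (Rintegral_pcoord j (bc_field_class bv') bv' cf).
have h := integral_pderiv_periodic (periodicC1M (pcoord_periodic j vv') pf).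
rewrite Rintegral_bcD in h; last 2 first.
- by apply: bounded_continuousM; [exact: pcoord_bc|].
- by apply: bounded_continuousM; [exact: pcoord_bc|].
by apply/eqP; rewrite -addr_eq0 addrC h.
Qed.
End square_fields.

(** * Convection on finite sums of modes *)

Section galerkin.
Context (R : realType) (K : nat).
Local Notation U := (Uspace R).
Local Notation mu := (muD R).
Variables (e : 'I_K -> U) (V : 'I_K -> R * R -> R * R).
Variables (V1 V2 : 'I_K -> 'I_2 -> R * R -> R * R) (m : 'I_K -> R).
Hypothesis eo : forall i j, L2dot (e i) (e j) = (i == j)%:R.
Hypothesis Ve : forall i, is_class (V i) (e i).
Hypothesis Vm : forall i, mode (V i) (V1 i) (V2 i) (m i).
Implicit Types (x y : 'I_K -> R).

Definition field_sum x (v : 'I_K -> R * R -> R * R) (p : R * R) : R * R :=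
  (\sum_i x i * (v i p).1, \sum_i x i * (v i p).2).

Lemma is_class_field_sum x : is_class (field_sum x V) (\sum_i x i *: e i).
Proof. exact: is_class_sum. Qed.

Lemma periodic_field_sum a x (v v' : 'I_K -> R * R -> R * R) :
  (forall i, periodic_field a (v i) (v' i)) ->
  periodic_field a (field_sum x v) (field_sum x v').
Proof.
by move=> h; split; apply: periodicC1_sum => i; apply: periodicC1Z; case: (h i).
Qed.

Definition grad_sum x (a : 'I_2) := field_sum x (fun i => V1 i a).
Definition grad2_sum x (a : 'I_2) := field_sum x (fun i => V2 i a).

Lemma grad_sum_periodic x a : periodic_field a (field_sum x V) (grad_sum x a).
Proof. by apply: periodic_field_sum => i; exact: mode_deriv (Vm i) a. Qed.

Lemma grad2_sum_periodic x a : periodic_field a (grad_sum x a) (grad2_sum x a).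
Proof. by apply: periodic_field_sum => i; exact: mode_deriv2 (Vm i) a. Qed.

Lemma grad_sum_div x p : (grad_sum x 0 p).1 + (grad_sum x 1 p).2 = 0.
Proof.
rewrite -big_split big1// => i _.
by rewrite /= -mulrDr (mode_div (Vm i)) mulr0.
Qed.

Lemma bc_field_sum x : bc_field (field_sum x V).
Proof. by case: (periodic_field_bc (grad_sum_periodic x 0)). Qed.

Lemma bc_grad_sum x a : bc_field (grad_sum x a).
Proof. by case: (periodic_field_bc (grad_sum_periodic x a)). Qed.

Lemma bc_grad2_sum x a : bc_field (grad2_sum x a).
Proof. by case: (periodic_field_bc (grad2_sum_periodic x a)). Qed.

Lemma pnormD (a b : R * R) : pnorm (a.1 + b.1, a.2 + b.2) <= pnorm a + pnorm b.
Proof.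
rewrite -(@ler_pXn2r _ 2)// ?nnegrE ?addr_ge0 ?sqrtr_ge0// sqrrD.
rewrite !sqr_sqrtr ?addr_ge0 ?sqr_ge0//=.
have cs : a.1 * b.1 + a.2 * b.2 <= pnorm a * pnorm b.
  rewrite /pnorm -sqrtrM ?addr_ge0 ?sqr_ge0//.
  apply: le_trans (ler_norm _) _; rewrite -sqrtr_sqr ler_sqrt; last first.
    by rewrite mulr_ge0 ?addr_ge0 ?sqr_ge0.
  rewrite -subr_ge0 (_ : _ - _ = (a.1 * b.2 - a.2 * b.1) ^+ 2) ?sqr_ge0//.
  by ring.
by move: cs; set s := pnorm a * pnorm b; lra.
Qed.

Lemma pnormZ (c : R) (a : R * R) : pnorm (c * a.1, c * a.2) = `|c| * pnorm a.
Proof.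
by rewrite /pnorm /= !exprMn -mulrDr sqrtrM ?sqr_ge0// sqrtr_sqr.
Qed.

Lemma field_sum_le x p : pnorm (field_sum x V p) <= 2 * \sum_i `|x i|.
Proof.
rewrite /field_sum; elim: (index_enum _) => [|i s IHs].
  by rewrite !big_nil /pnorm /= expr0n addr0 sqrtr0 mulr0.
rewrite !big_cons mulrDr; apply: le_trans (pnormD (_, _) (_, _)) _ => /=.
apply: lerD => //=; rewrite pnormZ mulrC ler_wpM2r//.
exact: mode_bound (Vm i) p.
Qed.

Lemma dot_fun_sumr x (v : R * R -> R * R) (v' : 'I_K -> R * R -> R * R) p :
  dot_fun v (field_sum x v') p = \sum_i x i * dot_fun v (v' i) p.
Proof.
rewrite /dot_fun /= !mulr_sumr -big_split; apply: eq_bigr => i _ /=; ring.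
Qed.

Lemma laplacian_sum x (v : R * R -> R * R) p :
  dot_fun v (grad2_sum x 0) p + dot_fun v (grad2_sum x 1) p =
  - dot_fun v (field_sum (fun i => m i * x i) V) p.
Proof.
rewrite !dot_fun_sumr -big_split -sumrN; apply: eq_bigr => i _ /=.
have := mode_eigen1 (Vm i) p; have := mode_eigen2 (Vm i) p.
rewrite /dot_fun; move: (V2 i 0 p) (V2 i 1 p) (V i p) (v p) => [a1 a2] [b1 b2] [c1 c2] [d1 d2] /=.
move=> /(canRL (addrK _)) -> /(canRL (addrK _)) ->; ring.
Qed.

Lemma dot_fun_periodic a (v v' w w' : R * R -> R * R) : periodic_field a v v' -> periodic_field a w w' ->
  periodicC1 a (dot_fun v w) (fun p => dot_fun v' w p + dot_fun v w' p).
Proof.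
move=> [h1 h2] [k1 k2].
have := periodicC1D (periodicC1M h1 k1) (periodicC1M h2 k2).
by congr periodicC1; apply/funext => p; rewrite /dot_fun; ring.
Qed.

(* Integration by parts turns the Dirichlet energy into [- <w, Laplacian w>]. *)
Lemma dirichlet_energy x :
  Rintegral mu setT (fun p => dot_fun (grad_sum x 0) (grad_sum x 0) p +
    dot_fun (grad_sum x 1) (grad_sum x 1) p) = \sum_i m i * x i ^+ 2.
Proof.
have ibp a := integral_pderiv_periodic
  (dot_fun_periodic (grad_sum_periodic x a) (grad2_sum_periodic x a)).
have bW := bc_field_sum x.
have b1 a := bounded_continuous_dot (bc_grad_sum x a) (bc_grad_sum x a).
have b2 a := bounded_continuous_dot bW (bc_grad2_sum x a).
have := ibp 0; have := ibp 1.
rewrite !(Rintegral_bcD (b1 _) (b2 _)) => i1 i0.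
have lap : Rintegral mu setT (dot_fun (field_sum x V) (grad2_sum x 0)) +
    Rintegral mu setT (dot_fun (field_sum x V) (grad2_sum x 1)) =
    - \sum_i m i * x i ^+ 2.
  rewrite -Rintegral_bcD//.
  have -> : (fun p => dot_fun (field_sum x V) (grad2_sum x 0) p +
      dot_fun (field_sum x V) (grad2_sum x 1) p) =
      fun p => -1 * dot_fun (field_sum x V) (field_sum (fun i => m i * x i) V) p.
    by apply/funext => p; rewrite laplacian_sum mulN1r.
  have bW' := bc_field_sum (fun i => m i * x i).
  rewrite Rintegral_bcZ; last exact: bounded_continuous_dot.
  rewrite -(bc_field_dot bW bW' (is_class_field_sum _) (is_class_field_sum _)).
  rewrite (orthonormal_dot eo) mulN1r; congr (- _).
  by apply: eq_bigr => i _; ring.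
by rewrite (Rintegral_bcD (b1 0) (b1 1)); move: lap i0 i1; lra.
Qed.

Definition convection x (a : 'I_2) p : R * R :=
  pscale (pcoord a (field_sum x V p)) (grad_sum x a p).

Lemma bc_convection x a : bc_field (convection x a).
Proof.
have bc := pcoord_bc a (bc_field_sum x); have [b1 b2] := bc_grad_sum x a.
by split; exact: bounded_continuousM.
Qed.

(* As the field is solenoidal, [<w, (w.grad) w>] is half the integral of the
   divergence of [|w|^2 w]. *)
Lemma convection_orthogonal x :
  Rintegral mu setT (fun p => dot_fun (field_sum x V) (convection x 0) p +
    dot_fun (field_sum x V) (convection x 1) p) = 0.
Proof.
pose W := field_sum x V.
have gW a := grad_sum_periodic x a.
have ibp a := integral_pderiv_periodic (periodicC1M (pcoord_periodic a (gW a))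
  (dot_fun_periodic (gW a) (gW a))).
have bW : bc_field W := bc_field_sum x.
have bcW a := pcoord_bc a bW; have bcD a := pcoord_bc a (bc_grad_sum x a).
have bWW := bounded_continuous_dot bW bW.
have bWD a : bounded_continuous (fun p => dot_fun (grad_sum x a) W p + dot_fun W (grad_sum x a) p).
  by apply: bounded_continuousD; apply: bounded_continuous_dot => //; exact: bc_grad_sum.
have b1 a := bounded_continuousM (bcD a) bWW.
have b2 a := bounded_continuousM (bcW a) (bWD a).
have bc a := bounded_continuous_dot bW (bc_convection x a).
have tot := ibp 0; have {}tot := congr2 +%R tot (ibp 1).
rewrite addr0 -Rintegral_bcD in tot; last 2 first.
- exact: bounded_continuousD.
- exact: bounded_continuousD.
apply: (@mulfI _ 2) => //; rewrite mulr0 -[RHS]tot -Rintegral_bcZ; last exact: bounded_continuousD.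
apply: eq_Rintegral => p _.
have := grad_sum_div x p; rewrite /convection /pscale /pcoord /dot_fun -/W.
move: (grad_sum x 0 p) (grad_sum x 1 p) (W p) => [a1 a2] [c1 c2] [w1 w2] /=.
move=> /(canRL (addKr _)) ->; ring.
Qed.

Lemma sum_I2 (f : 'I_2 -> U) : \sum_(a < 2) f a = f 0 + f 1.
Proof.
by rewrite !big_ord_recl big_ord0 addr0; congr (_ + f _); exact/val_inj.
Qed.

Definition burgers (eta : R) x : U :=
  eta *: (\sum_i x i *: e i) - \sum_(a < 2) cls (convection x a).

Lemma burgers_dot eta x : L2dot (\sum_i x i *: e i) (burgers eta x) = eta * \sum_i x i ^+ 2.
Proof.
have bW := bc_field_sum x; have bC := bc_convection x.
have cc a := bc_field_class (bC a).
rewrite /burgers -scaleN1r L2dotDr !L2dotZr -normr_sqr (orthonormal_norm eo).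
rewrite sum_I2 L2dotDr.
rewrite !(bc_field_dot bW (bC _) (is_class_field_sum _) (cc _)).
rewrite -Rintegral_bcD; try exact: bounded_continuous_dot.
by rewrite convection_orthogonal mulr0 addr0.
Qed.

(** Pointwise [|(w.grad) w| <= |w| |grad w|]; the first factor is bounded uniformly, and the second
    integrates to the Dirichlet energy. *)
Lemma convection_norm x : (forall i, 0 <= m i) ->
  `|\sum_(a < 2) cls (convection x a)| ^+ 2 <=
  (2 * \sum_i `|x i|) ^+ 2 * \sum_i m i * x i ^+ 2.
Proof.
move=> m0.
have bW := bc_field_sum x; have bC := bc_convection x.
have cc a := bc_field_class (bC a).
pose T p : R * R := ((convection x 0 p).1 + (convection x 1 p).1,
                     (convection x 0 p).2 + (convection x 1 p).2).
have bT : bc_field T.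
  by split; apply: bounded_continuousD; case: (bC 0) => ? ?; case: (bC 1) => ? ?.
have cT : is_class T (\sum_(a < 2) cls (convection x a)).
  rewrite sum_I2 -[cls (convection x 0)]scale1r.
  have := is_classP 1 (cc 0) (cc 1); congr is_class.
  by apply/funext => p; rewrite !mul1r.
rewrite normr_sqr (bc_field_dot bT bT cT cT) -dirichlet_energy -Rintegral_bcZ; last first.
  by apply: bounded_continuousD; apply: bounded_continuous_dot; exact: bc_grad_sum.
apply: ler_Rintegral_bc.
- exact: bounded_continuous_dot.
- apply: bounded_continuousZ.
  by apply: bounded_continuousD; apply: bounded_continuous_dot; exact: bc_grad_sum.
move=> p; set M := 2 * _; set W := field_sum x V p.
have hM : W.1 ^+ 2 + W.2 ^+ 2 <= M ^+ 2.
  rewrite -[leLHS]sqr_sqrtr ?addr_ge0 ?sqr_ge0// ler_pXn2r ?nnegrE ?sqrtr_ge0//.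
    exact: field_sum_le.
  by rewrite mulr_ge0 ?sumr_ge0.
rewrite /T /convection /dot_fun /pscale /pcoord -/W; move: hM.
move: (grad_sum x 0 p) (grad_sum x 1 p) W => [a1 a2] [b1 b2] [w1 w2] /= hM.
have h : 0 <= (a1 * a1 + a2 * a2) + (b1 * b1 + b2 * b2).
  by rewrite -!expr2 !addr_ge0 ?sqr_ge0.
apply: le_trans (ler_wpM2r h hM); rewrite -subr_ge0.
(* Lagrange's identity for the two components of the convection term. *)
have -> : (w1 ^+ 2 + w2 ^+ 2) * (a1 * a1 + a2 * a2 + (b1 * b1 + b2 * b2)) -
  ((w1 * a1 + w2 * b1) * (w1 * a1 + w2 * b1) + (w1 * a2 + w2 * b2) * (w1 * a2 + w2 * b2)) =
  (w2 * a1 - w1 * b1) ^+ 2 + (w2 * a2 - w1 * b2) ^+ 2 by ring.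
by rewrite addr_ge0 ?sqr_ge0.
Qed.

(* m <= (eta + m)^(2 gamma) uses 2 gamma >= 1 and the absence of m in (0, 1). *)
Lemma burgers_norm (eta gamma : R) x : 0 < eta -> 1 / 2 < gamma ->
  `|burgers eta x| <= eta * Num.sqrt (\sum_i x i ^+ 2) +
   2 * Num.sqrt (\sum_i (eta + m i) `^ (- 2 * gamma)) *
     \sum_i (eta + m i) `^ (2 * gamma) * x i ^+ 2.
Proof.
move=> eta0 hg; have m0 i : 0 <= m i.
  by case: (mode_gap (Vm i)) => [->//|]; apply: le_trans.
have l0 i : 0 < eta + m i by rewrite ltr_pwDl.
have g1 : 1 <= 2 * gamma by lra.
have lp i : 0 <= (eta + m i) `^ (2 * gamma) by exact: powR_ge0.
set X := \sum_i _ * x i ^+ 2; set L := \sum_i (eta + m i) `^ (- 2 * gamma).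
have X0 : 0 <= X by apply: sumr_ge0 => i _; rewrite mulr_ge0 ?sqr_ge0.
have L0 : 0 <= L by apply: sumr_ge0 => i _; exact: powR_ge0.
have mX : \sum_i m i * x i ^+ 2 <= X.
  apply: ler_sum => i _; rewrite ler_wpM2r ?sqr_ge0//.
  case: (mode_gap (Vm i)) => [mi0|m1]; first by rewrite [leLHS]mi0.
  apply: le_trans (_ : (eta + m i) `^ 1 <= _).
    by rewrite powRr1 ?(ltW (l0 i))// lerDr ltW.
  by apply: ler_powR => //; rewrite (le_trans m1)// lerDr ltW.
(* Cauchy--Schwarz with the weights [(eta + m)^(- gamma)] and [(eta + m)^gamma]: this produces the
   sum of powers in the lower bound on [r], next to the squared norm of [H_gamma]. *)
have xX : (\sum_i `|x i|) ^+ 2 <= L * X.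
  have := sum_cauchy_schwarz (fun i => (eta + m i) `^ (- gamma))
    (fun i => (eta + m i) `^ gamma * `|x i|).
  rewrite (eq_bigr (fun i => `|x i|)); last first.
    by move=> i _; rewrite mulrA -powRD ?addNr ?powRr0 ?mul1r// (gt_eqF (l0 i)) implybT.
  congr (_ <= _ * _); apply: eq_bigr => i _.
    by rewrite -powR_mulrn ?powR_ge0// -powRrM; congr (_ `^ _); ring.
  rewrite exprMn real_normK ?num_real//; congr (_ * _).
  by rewrite -powR_mulrn ?powR_ge0// -powRrM; congr (_ `^ _); ring.
apply: le_trans (ler_normB _ _) _; apply: lerD.
  rewrite normrZ gtr0_norm// ler_wpM2l ?(ltW eta0)//.
  by rewrite -(orthonormal_norm eo) sqrtr_sqr normr_id.
rewrite -(@ler_pXn2r _ 2)// ?nnegrE ?mulr_ge0 ?sqrtr_ge0//.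
apply: le_trans (convection_norm x m0) _.
have E0 : 0 <= \sum_i m i * x i ^+ 2 by apply: sumr_ge0 => i _; rewrite mulr_ge0 ?sqr_ge0.
have := ler_pM (sqr_ge0 (\sum_i `|x i|)) E0 xX mX => h.
rewrite !exprMn (sqr_sqrtr L0).
rewrite (_ : 2 ^+ 2 * L * X ^+ 2 = 2 ^+ 2 * (L * X * X)); last by ring.
by rewrite -[leLHS]mulrA ler_wpM2l ?sqr_ge0.
Qed.
End galerkin.

(** * Finite orthonormal families and Galerkin coordinates *)

Section finite_families.
Context (T : choiceType).

Lemma finite_family (A : set T) : finite_set A ->
  exists (K : nat) (e : 'I_K -> T), injective e /\ range e = A.
Proof.
move=> /finite_seqP [s ->]; pose t := undup s.
exists (size t), (tnth (in_tuple t)); split.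
  by apply/tuple_uniqP; exact: undup_uniq.
apply/seteqP; split=> [_ [i _ <-]|u /=]; first by rewrite /= -mem_undup mem_tnth.
by rewrite -mem_undup => /(tnthP (in_tuple t))[i ->]; exists i.
Qed.

Lemma fsbig_family (X : eqType) (idx : X) (op : Monoid.com_law idx) K (e : 'I_K -> T)
    (S : set T) (f : T -> X) : injective e -> (forall i, S (e i)) ->
  (forall u, S u -> ~ range e u -> f u = idx) ->
  \big[op/idx]_(u \in S) f u = \big[op/idx]_(i < K) f (e i).
Proof.
move=> ei eS f0; rewrite -(@fsbig_widen _ _ _ op (range e)); last 2 first.
- by move=> _ [i _ <-].
- by move=> u [Su nu]; exact: f0.
rewrite fsbig_image; last by move=> i j _ _; exact: ei.
apply: fsbig_fwiden => //; first by move=> i _ /=; rewrite mem_index_enum.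
- exact: index_enum_uniq.
- by move=> i [_ /=].
Qed.
End finite_families.

Section hilbert_families.
Context (R : realType).
Local Notation U := (Uspace R).
Implicit Types (S : set U) (f : U -> U).

Section family.
Context (K : nat) (e : 'I_K -> U).
Hypothesis ei : injective e.

(** [usum] is merely a chosen limit, so uniqueness has to be shown: the partial sums are constant
    once the index set contains [range e]. *)
Lemma usum_family S f : (forall i, S (e i)) ->
  (forall u, S u -> ~ range e u -> f u = 0) -> usum S f = \sum_i f (e i).
Proof.
move=> eS f0.
have sumE B : finite_set B -> range e `<=` B -> B `<=` S ->
    \sum_(u \in B) f u = \sum_i f (e i).
  move=> _ eB BS; apply: fsbig_family => //; first by move=> i; apply: eB; exists i.
  by move=> u /BS; exact: f0.
have fe : finite_set (range e) by exact: finite_image.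
have eSS : range e `<=` S by move=> _ [i _ <-].
have hs : has_usum S f (\sum_i f (e i)).
  move=> c c0; exists (range e) => // B fB eB BS.
  by rewrite sumE// subrr normr0.
apply/eqP; rewrite -subr_eq0 -normr_le0; apply/ler_addgt0Pl => c c0; rewrite addr0.
have /(_ c c0) [A [fA AS] hA] : has_usum S f (usum S f) by apply: xgetPex; exists (\sum_i f (e i)).
(* This set is large enough both for the chosen limit and for the explicit sum. *)
have := hA (A `|` range e).
rewrite sumE ?finite_setU//; last by move=> u [/AS|/eSS].
move=> /(_ _ _ _)/ltW; rewrite distrC; apply => //.
by move=> u [/AS|/eSS].
Qed.

Lemma projI_family v : projI (range e) v = \sum_i L2dot (e i) v *: e i.
Proof. by rewrite /projI usum_family// => i; exists i. Qed.
End family.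

Section basis.
Context (S : set U) (K : nat) (e : 'I_K -> U).
Hypotheses (oS : Defs.orthonormal S) (ei : injective e) (eS : forall i, S (e i)).

Lemma orthonormal_family i j : L2dot (e i) (e j) = (i == j)%:R.
Proof. by rewrite oS// (inj_eq ei); case: (i == j). Qed.

Lemma dot_outside h (x : 'I_K -> R) : S h -> ~ range e h ->
  L2dot h (\sum_i x i *: e i) = 0.
Proof.
move=> Sh nh; rewrite L2dot_sumr big1// => i _; rewrite L2dotZr oS//.
by case: eqP => [hE|]; rewrite ?mulr0//; case: nh; exists i.
Qed.

Lemma projI_outside h : S h -> ~ range e h -> projI (range e) h = 0.
Proof.
move=> Sh nh; rewrite projI_family// big1// => i _; rewrite oS//.
by case: eqP => [hE|]; rewrite ?scale0r//; case: nh; exists i.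
Qed.

Lemma projI_inside i : projI (range e) (e i) = e i.
Proof.
rewrite projI_family// (bigD1 i)//= orthonormal_family eqxx scale1r big1 ?addr0// => j ji.
by rewrite orthonormal_family (negbTE ji) scale0r.
Qed.

Lemma diag_op_family lam g (x : 'I_K -> R) :
  diag_op S lam g (\sum_i x i *: e i) = \sum_i (g (lam (e i)) * x i) *: e i.
Proof.
rewrite /diag_op (usum_family ei eS).
  by apply: eq_bigr => i _; rewrite (orthonormal_coord orthonormal_family).
by move=> u Su nu; rewrite dot_outside// mulr0 scale0r.
Qed.

Lemma esum_family (a : U -> \bar R) : (forall u, S u -> (0 <= a u)%E) ->
  (forall u, S u -> ~ range e u -> a u = 0%E) -> \esum_(u in S) a u = (\sum_i a (e i))%E.
Proof.
move=> a0 an; apply/eqP; rewrite eq_le; apply/andP; split.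
  apply: ge_ereal_sup => _ [A [fA AS] <-].
  rewrite -(@fsbig_family _ _ _ _ _ e (A `|` range e) a) => //; last 2 first.
  - by move=> i; right; exists i.
  - by move=> u [/AS|//]; exact: an.
  apply: lee_fsum_nneg_subset => //.
  - by rewrite finite_setU; split => //; exact: finite_image.
  - by move=> u; rewrite !inE; left.
  - by move=> u; rewrite inE => /andP[_]; rewrite inE => -[/AS|[i _ <-]]; apply: a0.
apply: esum_ge; exists (range e); first by split; [exact: finite_image|move=> _ [i _ <-]].
by rewrite (@fsbig_family _ _ _ _ _ e)// => i; exists i.
Qed.

Lemma Hs_norm_family lam s (x : 'I_K -> R) :
  Hs_norm S lam s (\sum_i x i *: e i) ^+ 2 =
  \sum_i ((- lam (e i)) `^ s) ^+ 2 * x i ^+ 2.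
Proof.
rewrite /Hs_norm diag_op_family (orthonormal_norm orthonormal_family).
by apply: eq_bigr => i _; rewrite exprMn.
Qed.

Lemma Hs_family H lam s (x : 'I_K -> R) : closed_subspace H -> S `<=` H ->
  Hs H S lam s (\sum_i x i *: e i).
Proof.
move=> [_ H0 HP] SH; split.
  elim: (index_enum _) => [|i t IHt]; first by rewrite big_nil.
  by rewrite big_cons; apply: HP => //; exact: SH.
rewrite esum_family.
- by rewrite sumEFin ltry.
- by move=> u _; rewrite lee_fin mulr_ge0// ?powR_ge0 ?exprn_ge0.
- by move=> u Su nu; rewrite dot_outside// normr0 expr0n mulr0.
Qed.
End basis.

Lemma basis_sub H S : orthonormal_basis H S -> S `<=` H.
Proof.
move=> [_ <-] u Su; apply: subset_closure; exists [:: u], (fun=> 1).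
split; first by move=> v; rewrite mem_seq1 => /eqP ->.
by rewrite big_cons big_nil scale1r addr0.
Qed.

Lemma orth_projection_dot H (P : U -> U) h u : orth_projection H P -> H h ->
  L2dot h (P u) = L2dot h u.
Proof.
move=> /(_ u)[_ /(_ h)] hP Hh; apply/eqP; rewrite eq_sym -subr_eq0.
by rewrite -mulN1r -L2dotZr -L2dotDr scaleN1r hP.
Qed.
End hilbert_families.

(** * The Stokes eigenbasis *)

Section stokes_basis.
Context (R : realType).
Local Notation U := (Uspace R).
Variables (eta gamma : R) (H HH : set U) (lam : U -> R).
Variables (vphi : int -> R -> R) (phi : int -> int -> R * R -> R)
  (e : int -> int -> U) (e001 : U).
Hypotheses (heta : 0 < eta) (hgamma : 1 / 2 < gamma).
Hypothesis hHHe : HH = [set e001] `|` [set h | exists i j, h = e i j].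
Hypothesis hvphi0 : forall x, 0 < x < 1 -> vphi 0 x = 1.
Hypothesis hvphicos : forall (n : nat) x, (0 < n)%N -> 0 < x < 1 ->
  vphi n%:Z x = Num.sqrt 2 * cos (2 * n%:R * pi * x).
Hypothesis hvphisin : forall (n : nat) x, (0 < n)%N -> 0 < x < 1 ->
  vphi (- n%:Z) x = Num.sqrt 2 * sin (2 * n%:R * pi * x).
Hypothesis hphi : forall (k l : int) (x y : R), (k, l) <> (0, 0) ->
  0 < x < 1 -> 0 < y < 1 -> phi k l (x, y) = vphi k x * vphi l y.
Hypothesis he000 : is_class (fun=> (1, 0)) (e 0 0).
Hypothesis he001 : is_class (fun=> (0, 1)) e001.
Hypothesis he : forall k l : int, (k, l) <> (0, 0) ->
  is_class (fun x => pscale (Num.sqrt (k ^+ 2 + l ^+ 2)%:~R)^-1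
              (l%:~R * phi k l x, k%:~R * phi (- k) (- l) x)) (e k l).
Hypothesis hlame : forall k l : int, (k, l) <> (0, 0) ->
  lam (e k l) = - eta - 4 * pi ^+ 2 * (k ^+ 2 + l ^+ 2)%:~R.
Hypotheses (hlam000 : lam (e 0 0) = - eta) (hlam001 : lam e001 = - eta).

Lemma vphi_trig k x : 0 < x < 1 -> vphi k x = trig k x.
Proof.
move=> x01; rewrite /trig; case: ifPn => [/eqP->|k0]; first exact: hvphi0.
case: k k0 => n k0.
  have n0 : (0 < n)%N by rewrite lt0n.
  rewrite ltz_nat n0 (hvphicos n0 x01); congr (_ * cos _); rewrite -pmulrn; ring.
rewrite NegzE (hvphisin (ltn0Sn n) x01) oppr_gt0 opprK /=.
by congr (_ * sin _); rewrite -pmulrn; ring.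
Qed.

(** Supplies representatives that are explicit and periodic on the whole plane, as integration by
    parts requires; the two constant fields are the modes with [m = 0]. *)
Lemma stokes_mode h : HH h -> exists V V1 V2 m,
  [/\ is_class V h, mode V V1 V2 m & lam h = - eta - m].
Proof.
rewrite hHHe => -[->|[k [l ->]]].
  exists (fun=> (0, 1)), (fun=> fun=> (0, 0)), (fun=> fun=> (0, 0)), 0; split => //.
    by apply: mode_const; rewrite expr0n expr1n add0r.
  by rewrite subr0.
have [kl|kl] := pselect ((k, l) = (0, 0)).
  case: kl => -> ->.
  exists (fun=> (1, 0)), (fun=> fun=> (0, 0)), (fun=> fun=> (0, 0)), 0; split => //.
    by apply: mode_const; rewrite expr0n expr1n addr0.
  by rewrite subr0.
have [V1 [V2 mV]] := mode_wave_field R kl.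
set q := (Num.sqrt _)^-1 in mV.
exists (wave_field (q * l%:~R) (q * k%:~R) k l (- k) (- l)), V1, V2, (4 * pi ^+ 2 * (k ^+ 2 + l ^+ 2)%:~R).
split; [|exact: mV|exact: hlame].
apply: is_class_ae (he kl) _ _.
  have [bV _] := periodic_field_bc (mode_deriv mV 0).
  by apply: measurable_funTS; exact: bc_field_measurable.
(* The hypotheses describe the fields only inside the open square, which carries all the mass of
   [muD]. *)
apply: filterS (ae_sqD R) => -[x y] [/=]; rewrite !in_itv /= => x01 y01.
have nkl : (- k, - l) <> (0, 0).
  by move=> [/eqP + /eqP]; rewrite !oppr_eq0 => /eqP k0 /eqP l0; apply: kl; rewrite k0 l0.
rewrite /pscale /wave_field /wave /= !hphi// !vphi_trig//.
by rewrite /q -!mulrA.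
Qed.

Lemma stokes_lam_lt0 h : HH h -> lam h <= - eta.
Proof.
move=> /stokes_mode [V [V1 [V2 [m [_ mV ->]]]]]; rewrite gerBl.
by case: (mode_gap mV) => [->//|]; apply: le_trans.
Qed.

(* The double sum does not see the mode e001, which is paid for by the extra term. *)
Lemma stokes_trace K (f : 'I_K -> U) : injective f -> (forall i, HH (f i)) ->
  ((\sum_i (- lam (f i)) `^ (- 2 * gamma))%:E <=
   (eta `^ (- 2 * gamma))%:E + \esum_(ij in [set: int * int])
     ((eta + 4 * pi ^+ 2 * (ij.1 ^+ 2 + ij.2 ^+ 2)%:~R) `^ (- 2 * gamma))%:E)%E.
Proof.
move=> fi fHH; set g := fun ij : int * int => (_ `^ _)%:E.
(* [None] stands for [e001]. A chosen index determines its vector, so the choice [q] inherits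
   injectivity from [f]. *)
have qex i : exists o : option (int * int),
    f i = if o is Some ij then e ij.1 ij.2 else e001.
  have := fHH i; rewrite hHHe => -[->|[k [l ->]]]; first by exists None.
  by exists (Some (k, l)).
have {qex}[q qP] := choice qex.
have qi : injective q by move=> i j ij; apply: fi; rewrite !qP ij.
have lamE i : ((- lam (f i)) `^ (- 2 * gamma))%:E =
    if q i is Some ij then g ij else (eta `^ (- 2 * gamma))%:E.
  rewrite qP; case: (q i) => [[k l] /=|]; last by rewrite hlam001 opprK.
  rewrite /g /=; have [kl|kl] := pselect ((k, l) = (0, 0)).
    by case: kl => -> ->; rewrite hlam000 opprK !expr0n addr0 mulr0z mulr0 addr0.
  by rewrite hlame// opprB opprK addrC.
have g0 ij : (0 <= g ij)%E by rewrite lee_fin powR_ge0.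
rewrite -sumEFin (eq_bigr _ (fun i _ => lamE i)) (bigID (fun i => q i == None)) /=.
apply: leeD.
  have [[i0 /eqP qi0]|nq] := pselect (exists i, q i == None); last first.
    by rewrite big1 ?lee_fin ?powR_ge0// => i qiN; case: nq; exists i.
  rewrite (big_pred1 i0) ?qi0// => i.
  by apply/eqP/eqP => [qiN|->//]; apply: qi; rewrite qiN.
pose p i := odflt (0, 0) (q i).
have pE i : q i != None -> q i = Some (p i) by rewrite /p; case: (q i).
rewrite (eq_bigr (g \o p)); last by move=> i /pE ->.
apply: esum_ge; exists (p @` [set i | q i != None]).
  by split => //; exact: finite_image.
rewrite fsbig_image; last first.
  by move=> i j; rewrite !inE => /pE qE /pE qE' pij; apply: qi; rewrite qE qE' pij.
rewrite fsbig_mkcond (@fsbig_family _ _ _ _ _ id) => //.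
rewrite big_mkcond /=; apply: lee_sum => i _; rewrite patchE.
by rewrite (_ : (i \in _) = (q i != None)) ?if_same//; apply/idP/idP; rewrite inE.
Qed.
End stokes_basis.

(** * The drift in Galerkin coordinates *)

Lemma measurable_Rintegral_param (R : realType) d (T : measurableType d)
    (f : T * plane R -> measurableTypeR R) : measurable_fun setT f ->
  measurable_fun setT (fun t => Rintegral (muD R) setT (fun p => f (t, p)) : measurableTypeR R).
Proof.
move=> mf; pose N := uniform_prob (@ltr01 R).
have mE : measurable_fun setT (EFin \o f) by exact/measurable_EFinP.
have h (g : T * plane R -> \bar R) : measurable_fun setT g -> (forall z, (0 <= g z)%E) ->
    measurable_fun setT (fun t => (\int[muD R]_p g (t, p))%E).
  move=> mg g0; under eq_fun do rewrite integral_muD.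
  pose NN : probability _ R := (N \x N)%E.
  exact: (@measurable_fun_fubini_tonelli_F _ _ _ _ R NN).
apply: (measurableT_comp (@fine_measurable R setT measurableT)).
under eq_fun do rewrite integralE; apply: emeasurable_funB.
- have := h _ (measurable_funepos mE) (fun z => funepos_ge0 _ z).
  by apply: eq_measurable_fun => t _; apply: eq_integral => p _; rewrite !funeposE.
- have := h _ (measurable_funeneg mE) (fun z => funeneg_ge0 _ z).
  by apply: eq_measurable_fun => t _; apply: eq_integral => p _; rewrite !funenegE.
Qed.

Section galerkin_drift.
Context (R : realType).
Local Notation U := (Uspace R).
Variables (eta gamma eps : R) (H HH : set U) (lam : U -> R) (projH F : U -> U).
Variables (r : U -> R) (vt : R) (Sg : \bar R).
Hypotheses (heta : 0 < eta) (hgamma : 1 / 2 < gamma).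
Hypotheses (hH : closed_subspace H) (hHH : orthonormal_basis H HH).
Hypothesis hprojH : orth_projection H projH.
Hypothesis hF : forall (w : U) (dw : 'I_2 -> U),
  Hs H HH lam gamma w -> (forall i, is_wderiv i w (dw i)) -> ess_bounded w ->
  F w = projH (eta *: w -
    \sum_(i < 2) cls (fun x => pscale (pcoord i (Uval w x)) (Uval (dw i) x))).
Hypothesis hr : forall v, Hs H HH lam gamma v ->
  (maxe (Num.sqrt vt + eps * `|v| ^+ 2)%:E
    ((eta * `|v|)%:E + 6%:E * Sg `^ (1 / 2) *
      (Hs_norm HH lam gamma v ^+ 2)%:E) <= (r v)%:E)%E.
Variables (K : nat) (e : 'I_K -> U).
Hypotheses (ei : injective e) (eHH : forall i, HH (e i)).
Hypothesis hSg : ((\sum_i (- lam (e i)) `^ (- 2 * gamma))%:E <= Sg)%E.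
Variables (V : 'I_K -> R * R -> R * R) (V1 V2 : 'I_K -> 'I_2 -> R * R -> R * R) (m : 'I_K -> R).
Hypothesis Ve : forall i, is_class (V i) (e i).
Hypothesis Vm : forall i, mode (V i) (V1 i) (V2 i) (m i).
Hypothesis lam_m : forall i, lam (e i) = - eta - m i.
Implicit Types x : 'I_K -> R.

Let eo : forall i j, L2dot (e i) (e j) = (i == j)%:R.
Proof. by apply: orthonormal_family eHH => //; case: hHH. Qed.

Lemma measurable_pscale (a : plane R -> R) (v : plane R -> plane R) :
  measurable_fun setT (a : _ -> measurableTypeR R) -> measurable_fun setT v ->
  measurable_fun setT (fun p => pscale (a p) (v p)).
Proof.
move=> ma mv; apply: measurable_fun_pair; apply: measurable_funM => //.
- exact: (measurableT_comp measurable_fst mv).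
- exact: (measurableT_comp measurable_snd mv).
Qed.

Lemma Hs_galerkin x : Hs H HH lam gamma (\sum_i x i *: e i).
Proof.
by apply: Hs_family => //; [case: hHH|exact: basis_sub].
Qed.

(** Finite sums of modes are bounded and have classical periodic derivatives, which are also weak
    ones, so the formula for [F] applies to them. *)
Lemma drift_burgers x : F (\sum_i x i *: e i) = projH (burgers e V V1 eta x).
Proof.
have bG a := bc_grad_sum Vm x a; have bC a := bc_convection Vm x a.
rewrite (hF (dw := fun a => cls (grad_sum V1 x a)) (Hs_galerkin x)).
- congr (projH (_ - _)); apply: eq_bigr => a _; apply: cls_eq.
  apply: is_class_ae (bc_field_class (bC a)) _ _.
    apply: measurable_funTS; apply: measurable_pscale; last exact: Uval_measurable.
    by apply: measurableT_comp; [exact: measurable_pcoord|exact: Uval_measurable].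
  have [_ h1] := is_class_field_sum Ve x; have [_ h2] := bc_field_class (bG a).
  by apply: filterS2 h1 h2 => p -> ->.
- move=> a; apply: periodic_wderiv (is_class_field_sum Ve x) _.
  exact: (grad_sum_periodic Vm x a).
- exists (2 * \sum_i `|x i|); have [_ h1] := is_class_field_sum Ve x.
  by apply: filterS h1 => p ->; exact: field_sum_le Vm x p.
Qed.

Definition drift x k : R := L2dot (e k) (F (\sum_i x i *: e i)).

Lemma driftE x k : drift x k = L2dot (e k) (burgers e V V1 eta x).
Proof.
rewrite /drift drift_burgers (orth_projection_dot _ hprojH)//.
exact: (basis_sub hHH).
Qed.

Lemma drift_energy x : \sum_k x k * drift x k = eta * \sum_k x k ^+ 2.
Proof.
rewrite -(burgers_dot eo Ve Vm) L2dot_suml; apply: eq_bigr => k _.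
by rewrite L2dotZl driftE.
Qed.

Lemma growth_ge x : eps * (\sum_k x k ^+ 2) <= r (\sum_i x i *: e i).
Proof.
have := hr (Hs_galerkin x); rewrite ge_max lee_fin (orthonormal_norm eo) => /andP[+ _].
by apply: le_trans; rewrite lerDr sqrtr_ge0.
Qed.

(** Bessel's inequality discards the projection. The powers of the eigenvalues of the finitely many
    active modes sum to at most [Sg], so one condition on [r] serves all Galerkin spaces. *)
Lemma drift_norm x : \sum_k drift x k ^+ 2 <= r (\sum_i x i *: e i) ^+ 2.
Proof.
rewrite (eq_bigr (fun k => L2dot (e k) (burgers e V V1 eta x) ^+ 2)); last first.
  by move=> k _; rewrite driftE.
apply: le_trans (bessel eo _) _.
have := hr (Hs_galerkin x); rewrite ge_max => /andP[_ hr2].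
suff h : `|burgers e V V1 eta x| <= r (\sum_i x i *: e i).
  by rewrite ler_pXn2r ?nnegrE// (le_trans _ h).
(* The comparison takes place in the extended reals, as nothing here says that [Sg] is finite. *)
rewrite -lee_fin; apply: le_trans hr2.
have l0 i : 0 <= - lam (e i).
  rewrite lam_m opprB opprK; apply: addr_ge0; last exact: ltW.
  by case: (mode_gap (Vm i)) => [->//|]; apply: le_trans.
apply: le_trans (_ : _ <= (eta * Num.sqrt (\sum_i x i ^+ 2) + 2 * Num.sqrt
   (\sum_i (- lam (e i)) `^ (- 2 * gamma)) * Hs_norm HH lam gamma (\sum_i x i *: e i) ^+ 2)%:E)%E _.
  rewrite lee_fin; apply: (le_trans (burgers_norm eo Ve Vm x heta hgamma)).
  have lE i : - lam (e i) = eta + m i by rewrite lam_m opprB opprK addrC.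
  rewrite (Hs_norm_family _ ei eHH); last by case: hHH.
  rewrite lerD2l (eq_bigr (fun i => (- lam (e i)) `^ (- 2 * gamma))); last by move=> i _; rewrite lE.
  rewrite le_eqVlt; apply/orP; left; apply/eqP; congr (_ * _); apply: eq_bigr => i _.
  rewrite lE; congr (_ * _).
  by rewrite -[RHS]powR_mulrn ?powR_ge0// -powRrM mulrC.
rewrite EFinD; apply: leeD.
  by rewrite -(orthonormal_norm eo) sqrtr_sqr normr_id.
rewrite EFinM; apply: lee_pmul; [|by rewrite lee_fin sqr_ge0| |exact: lexx].
  by rewrite lee_fin mulr_ge0 ?sqrtr_ge0.
rewrite EFinM; apply: lee_pmul; [by rewrite lee_fin|by rewrite lee_fin sqrtr_ge0| |].
  by rewrite lee_fin ler_nat.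
have := hSg; set L := \sum_i _ => hL; have L0 : 0 <= L by apply: sumr_ge0 => i _; exact: powR_ge0.
rewrite -powR12_sqrt// -poweR_EFin div1r; apply: gt0_ler_poweR => //.
- by rewrite in_itv/= lee_fin L0 leey.
- by rewrite in_itv/= (le_trans _ hL) ?lee_fin// leey.
Qed.

Section measurability.
Let T := (K.-tuple (measurableTypeR R))%type.

Lemma measurable_tuple_sum (v : 'I_K -> plane R -> measurableTypeR R) :
  (forall i, measurable_fun setT (v i)) ->
  measurable_fun setT (fun z : T * plane R => \sum_i tnth z.1 i * v i z.2 : measurableTypeR R).
Proof.
move=> mv; apply: measurable_sum => i; apply: measurable_funM.
  exact: (measurableT_comp (measurable_tnth i) measurable_fst).
exact: (measurableT_comp (mv i) measurable_snd).
Qed.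

Lemma measurable_drift k :
  measurable_fun setT (fun t : T => drift (tnth t) k : measurableTypeR R).
Proof.
have bV i : bc_field (V i) by case: (periodic_field_bc (mode_deriv (Vm i) 0)).
have bV1 i a : bc_field (V1 i a) by case: (periodic_field_bc (mode_deriv (Vm i) a)).
have mc (v : plane R -> plane R) : bc_field v ->
    measurable_fun setT (fun p => (v p).1 : measurableTypeR R) /\
    measurable_fun setT (fun p => (v p).2 : measurableTypeR R).
  by move=> [[c1 _] [c2 _]]; split; exact: continuous_measurable_plane.
have mW j : measurable_fun setT (fun z : T * plane R =>
    pcoord j (field_sum (tnth z.1) V z.2) : measurableTypeR R).
  rewrite /pcoord; case: (_ == 0).
    by apply: (measurable_tuple_sum (v := fun i p => (V i p).1)) => i; case: (mc _ (bV i)).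
  by apply: (measurable_tuple_sum (v := fun i p => (V i p).2)) => i; case: (mc _ (bV i)).
have mG a j : measurable_fun setT (fun z : T * plane R =>
    pcoord j (grad_sum V1 (tnth z.1) a z.2) : measurableTypeR R).
  rewrite /pcoord; case: (_ == 0).
    by apply: (measurable_tuple_sum (v := fun i p => (V1 i a p).1)) => i; case: (mc _ (bV1 i a)).
  by apply: (measurable_tuple_sum (v := fun i p => (V1 i a p).2)) => i; case: (mc _ (bV1 i a)).
(* Measurability is read off this formula: the integrands are quadratic in the coordinates with
   fixed continuous fields as coefficients. *)
have -> : (fun t : T => drift (tnth t) k : measurableTypeR R) = fun t =>
    eta * (tnth t k) - (Rintegral (muD R) setT (dot_fun (V k) (convection V V1 (tnth t) 0)) +
      Rintegral (muD R) setT (dot_fun (V k) (convection V V1 (tnth t) 1))).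
  apply/funext => t; rewrite driftE /burgers -scaleN1r L2dotDr !L2dotZr (orthonormal_coord eo).
  rewrite sum_I2 L2dotDr mulN1r.
  have bC a := bc_convection Vm (tnth t) a.
  by rewrite !(bc_field_dot (bV k) (bC _) (Ve k) (bc_field_class (bC _))).
apply: measurable_funB.
  by apply: measurable_funM => //; exact: measurable_tnth.
have mI a : measurable_fun setT (fun t : T => Rintegral (muD R) setT
    (dot_fun (V k) (convection V V1 (tnth t) a)) : measurableTypeR R).
  apply: (@measurable_Rintegral_param _ _ _ (fun z =>
    dot_fun (V k) (convection V V1 (tnth z.1) a) z.2)).
  rewrite /dot_fun /convection /pscale /=; have [m1 m2] := mc _ (bV k).
  apply: measurable_funD; apply: measurable_funM.
  - exact: (measurableT_comp m1 measurable_snd).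
  - by apply: measurable_funM; [exact: mW|exact: (mG a 0)].
  - exact: (measurableT_comp m2 measurable_snd).
  - by apply: measurable_funM; [exact: mW|exact: (mG a 1)].
by apply: measurable_funD; exact: mI.
Qed.
End measurability.
End galerkin_drift.

(** * The diffusion coefficient *)

Section operator_norm.
Context (R : realType).
Implicit Types (M : 'M[R]_2) (y : plane R).

Lemma pnorm_ge0 (y : R * R) : 0 <= pnorm y. Proof. exact: sqrtr_ge0. Qed.

(** A supremum is informative only for a non-empty bounded set; on the unit ball the sum of the two
    column norms is an upper bound. *)
Lemma opnorm_has_sup M : has_sup [set pnorm (mxact M y) | y in [set y | pnorm y <= 1]].
Proof.
have y1 (y : R * R) : pnorm y <= 1 -> `|y.1| <= 1 /\ `|y.2| <= 1.
  move=> h; have h2 : y.1 ^+ 2 + y.2 ^+ 2 <= 1.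
    rewrite -[leLHS]sqr_sqrtr ?addr_ge0 ?sqr_ge0//.
    by rewrite -[leRHS](expr1n _ 2) ler_pXn2r ?nnegrE ?sqrtr_ge0.
  have s1 := sqr_ge0 y.1; have s2 := sqr_ge0 y.2.
  split; rewrite -(@ler_pXn2r _ 2)// ?nnegrE// expr1n real_normK ?num_real//.
    by apply: le_trans h2; rewrite lerDl.
  by apply: le_trans h2; rewrite lerDr.
split; first by exists (pnorm (mxact M (0, 0))), (0, 0) => //=; rewrite /pnorm /= expr0n addr0 sqrtr0.
exists (pnorm (M 0 0, M 1 0) + pnorm (M 0 1, M 1 1)) => _ [y /= /y1[h1 h2] <-].
have -> : mxact M y = (y.1 * M 0 0 + y.2 * M 0 1, y.1 * M 1 0 + y.2 * M 1 1).
  by rewrite /mxact; congr pair; ring.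
apply: le_trans (pnormD (_, _) (_, _)) _ => /=.
by apply: lerD; rewrite (pnormZ _ (_, _)) ler_piMl// pnorm_ge0.
Qed.

Lemma opnorm_ge0 M : 0 <= opnorm M.
Proof.
apply: le_trans (pnorm_ge0 (mxact M (0, 0))) _.
apply: ub_le_sup; first by case: (opnorm_has_sup M).
by exists (0, 0) => //=; rewrite /pnorm /= expr0n addr0 sqrtr0.
Qed.

Lemma pnorm_mxact_le M y : pnorm (mxact M y) <= opnorm M * pnorm y.
Proof.
have [y0|y0] := eqVneq (pnorm y) 0.
  have : y.1 ^+ 2 + y.2 ^+ 2 = 0.
    by rewrite -[LHS]sqr_sqrtr ?addr_ge0 ?sqr_ge0// -/(pnorm y) y0 expr0n.
  move/eqP; rewrite paddr_eq0 ?sqr_ge0// !sqrf_eq0 => /andP[/eqP h1 /eqP h2].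
  rewrite y0 mulr0 /mxact h1 h2 !mulr0 !addr0 /pnorm /= expr0n addr0 sqrtr0.
  exact: lexx.
have yp : 0 < pnorm y by rewrite lt_def y0 pnorm_ge0.
rewrite -ler_pdivrMr// mulrC -[X in X * _]gtr0_norm ?invr_gt0// -pnormZ.
apply: ub_le_sup; first by case: (opnorm_has_sup M).
exists ((pnorm y)^-1 * y.1, (pnorm y)^-1 * y.2).
  by rewrite /= pnormZ gtr0_norm ?invr_gt0// mulVf.
by rewrite /mxact /=; congr (pnorm (_, _)); ring.
Qed.
End operator_norm.

(** * Finiteness of the trace *)

Section trace.
Context (R : realType).
Local Notation U := (Uspace R).
Implicit Types (u v : U) (Q : U -> U).

Lemma L2dot_norm_le u v : `|L2dot u v| <= `|u| * `|v|.
Proof.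
have cs w : L2dot w v <= `|w| * `|v| := L2cauchy_schwarz w v.
rewrite ler_norml cs andbT lerNl -mulN1r -L2dotZl scaleN1r.
by apply: le_trans (cs _) _; rewrite normrN.
Qed.

Lemma L2dot_cvg v (f : nat -> U) u : f @ \oo --> u ->
  (fun n => L2dot v (f n)) @ \oo --> L2dot v u.
Proof.
move=> /cvgrPdist_le fu; apply/cvgrPdist_le => c c0.
have v0 : 0 < `|v| + 1 by rewrite ltr_pwDr.
have := fu (c / (`|v| + 1)); rewrite divr_gt0// => /(_ isT); apply: filterS => n hn.
rewrite -mulN1r -L2dotZr -L2dotDr scaleN1r; apply: le_trans (L2dot_norm_le _ _) _.
apply: le_trans (_ : (`|v| + 1) * (c / (`|v| + 1)) <= _); last by rewrite mulrC divfK// gt_eqF.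
by apply: ler_pM => //; rewrite lerDl.
Qed.

(** After exchanging the sums, each rank-one term contributes at most [|a k| |b k|], by
    Cauchy--Schwarz and Bessel's inequality, whatever the finite orthonormal family. *)
Lemma trace_partial_le Q (UU : set U) : trace_class Q -> Defs.orthonormal UU ->
  exists C : R, forall n (e : 'I_n -> U), injective e -> (forall i, UU (e i)) ->
    \sum_i L2dot (e i) (Q (e i)) <= C.
Proof.
move=> [a [b [ab Qab]]] oU.
set S := (\sum_(0 <= k <oo) _)%E in ab.
have S0 : (0 <= S)%E by apply: nneseries_ge0 => k _ _; rewrite lee_fin mulr_ge0.
exists (fine S) => n e ei eU; have eo := orthonormal_family oU ei eU.
have cv : (fun N => \sum_i L2dot (e i) (\sum_(0 <= k < N) L2dot (a k) (e i) *: b k)) @ \oo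
    --> \sum_i L2dot (e i) (Q (e i)).
  elim: (index_enum _) => [|i s IHs].
    by under eq_fun do rewrite big_nil; rewrite big_nil; exact: cvg_cst.
  under eq_fun do rewrite big_cons; rewrite big_cons.
  by apply: cvgD => //; apply: L2dot_cvg; exact: Qab.
rewrite -(cvg_lim (@Rhausdorff R) cv); apply: limr_le; first by apply/cvg_ex; eexists; exact: cv.
apply: nearW => N.
have -> : \sum_i L2dot (e i) (\sum_(0 <= k < N) L2dot (a k) (e i) *: b k) =
    \sum_(0 <= k < N) \sum_i L2dot (e i) (a k) * L2dot (e i) (b k).
  rewrite exchange_big /=; apply: eq_bigr => i _; rewrite L2dot_sumr.
  by apply: eq_bigr => k _; rewrite L2dotZr (L2dotC (a k)).
rewrite -lee_fin fineK; last by rewrite ge0_fin_numE.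
apply: le_trans (_ : (\sum_(0 <= k < N) (`|a k| * `|b k|)%:E <= S)%E); last first.
  by apply: nneseries_lim_ge => k _ _; rewrite lee_fin mulr_ge0.
rewrite sumEFin lee_fin; apply: ler_sum => k _.
apply: le_trans (ler_norm _) _.
rewrite -(@ler_pXn2r _ 2)// ?nnegrE ?mulr_ge0// real_normK ?num_real//.
apply: le_trans (sum_cauchy_schwarz _ _) _; rewrite exprMn.
by apply: ler_pM; rewrite ?(bessel eo)//; apply: sumr_ge0 => i _; exact: sqr_ge0.
Qed.

(** [fine] would send an infinite sum to 0, so the uniform bound on partial traces is needed before
    [optrace] can dominate anything. *)
Lemma optrace_ge Q (UU : set U) n (e : 'I_n -> U) : trace_class Q -> nonneg_op Q ->
  Defs.orthonormal UU -> injective e -> (forall i, UU (e i)) ->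
  \sum_i L2dot (e i) (Q (e i)) <= optrace UU Q.
Proof.
move=> tQ pQ oU ei eU; have [C hC] := trace_partial_le tQ oU.
have Q0 u : (0 <= (L2dot u (Q u))%:E)%E by rewrite lee_fin.
have le1 : ((\sum_i L2dot (e i) (Q (e i)))%:E <= \esum_(u in UU) (L2dot u (Q u))%:E)%E.
  apply: esum_ge; exists (range e).
    by split; [exact: finite_image|move=> _ [i _ <-]].
  by rewrite (@fsbig_family _ _ _ _ _ e)// ?sumEFin// => i; exists i.
have le2 : (\esum_(u in UU) (L2dot u (Q u))%:E <= C%:E)%E.
  apply: ge_ereal_sup => _ [A [fA AU] <-].
  have [k [f [fi fA']]] := finite_family fA.
  have fR i : A (f i) by rewrite -fA'; exists i.
  rewrite (@fsbig_family _ _ _ _ _ f)//; last by move=> u Au; rewrite fA'.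
  by rewrite sumEFin lee_fin; apply: hC => // i; exact/AU/fR.
rewrite -lee_fin fineK//; rewrite ge0_fin_numE; last exact: esum_ge0.
exact: le_lt_trans le2 (ltry _).
Qed.
End trace.

(** * The noise in Galerkin coordinates *)

Section galerkin_noise.
Context (R : realType).
Local Notation U := (Uspace R).
Local Notation mu := (muD R).
Variables (gamma : R) (UU H HH : set U) (lam : U -> R) (projH Q sqrtQ : U -> U).
Variables (b : plane R -> plane R -> 'M[R]_2) (B : U -> U -> U).
Hypotheses (hUU : Defs.orthonormal UU) (hH : closed_subspace H) (hHH : orthonormal_basis H HH).
Hypotheses (hprojH : orth_projection H projH) (hQnneg : nonneg_op Q) (hQtr : trace_class Q).
Hypothesis hsqrtQ : is_sqrt_op Q sqrtQ.
Hypothesis hbm : forall i j : 'I_2, measurable_fun (@sqD R `*` [set: plane R])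
  (fun p => b p.1 p.2 i j : measurableTypeR R).
Hypothesis hb : (ereal_sup
  [set q | exists x y z : plane R, [/\ sqD x, z <> y &
     q = (opnorm (b x y) + opnorm (b x y - b x z) / pnorm (psub y z))%:E]] < +oo)%E.
Hypothesis hB : forall (v : plane R -> plane R) (w : U),
  is_class v w -> Hs H HH lam gamma w ->
  forall u, B w u = projH (cls (fun x => mxact (b x (v x)) (Uval (sqrtQ u) x))).
Variables (K : nat) (e : 'I_K -> U).
Hypotheses (ei : injective e) (eHH : forall i, HH (e i)).
Variables (V : 'I_K -> R * R -> R * R).
Hypothesis Ve : forall i, is_class (V i) (e i).
Hypothesis bV : forall i, bc_field (V i).
Implicit Types x : 'I_K -> R.

Local Notation beta := (sup [set q | exists x y : plane R, sqD x /\ q = opnorm (b x y)]).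

Lemma opnorm_coef_le p y : sqD p -> opnorm (b p y) <= beta.
Proof.
move=> Dp; apply: ub_le_sup; last by exists p, y.
have := hb; set X := ereal_sup _ => Xoo.
have le (q : R) : (exists x y : plane R, sqD x /\ q = opnorm (b x y)) -> (q%:E <= X)%E.
  (* The supremum in [hb] ranges over pairs of distinct points, so some second point has to be
     supplied. *)
  move=> [x [z [Dx ->]]]; pose z' : plane R := ((z.1 + 1 : R), z.2).
  apply: le_trans (_ : (opnorm (b x z) + opnorm (b x z - b x z') / pnorm (psub z z'))%:E <= _)%E.
    by rewrite lee_fin lerDl divr_ge0 ?opnorm_ge0 ?pnorm_ge0.
  apply: ereal_sup_ubound; exists x, z, z'; split => //.
  by move=> /(congr1 fst) /eqP /=; rewrite eq_sym -subr_eq0 opprD addrA subrr sub0r oppr_eq0 oner_eq0.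
have Xfin : X \is a fin_num.
  rewrite ge0_fin_numE//; apply: le_trans (le _ (ex_intro _ p (ex_intro _ y (conj Dp erefl)))).
  by rewrite lee_fin opnorm_ge0.
by exists (fine X) => q /le; rewrite -{1}(fineK Xfin) lee_fin.
Qed.

Lemma coef_bound_ge0 : 0 <= beta.
Proof.
have Dp : sqD (2^-1 : R, 2^-1 : R).
  by split; rewrite /= in_itv/= invr_gt0 ltr0n invf_lt1// ltr1n.
exact: le_trans (opnorm_ge0 (b (2^-1, 2^-1) (0, 0))) (opnorm_coef_le _ Dp).
Qed.

(* the coefficient b, extended by 0 outside the square to be measurable on the plane *)
Definition bext (i j : 'I_2) : plane R * plane R -> measurableTypeR R :=
  (fun p => b p.1 p.2 i j : measurableTypeR R) \_ (@sqD R `*` [set: plane R]).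

Definition diffusion_field x (u : U) (p : plane R) : plane R :=
  let y := (p, field_sum x V p) in let q := Uval (sqrtQ u) p in
  (bext 0 0 y * q.1 + bext 0 1 y * q.2, bext 1 0 y * q.1 + bext 1 1 y * q.2).

Lemma measurable_bext i j : measurable_fun setT (bext i j).
Proof.
have mD : measurable (@sqD R `*` [set: plane R]).
  by apply: measurableX => //; exact: measurable_sqD.
exact: ((measurable_restrictT _ mD).1 (hbm i j)).
Qed.

Lemma measurable_diffusion_field d (T : measurableType d) (X : T -> 'I_K -> R) u :
  measurable_fun setT (fun z : T * plane R => field_sum (X z.1) V z.2 : plane R) ->
  measurable_fun setT (fun z : T * plane R => diffusion_field (X z.1) u z.2).
Proof.
move=> mX; have mU := Uval_measurable (sqrtQ u).
have mb i j : measurable_fun setT (fun z : T * plane R =>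
    bext i j (z.2, field_sum (X z.1) V z.2)).
  apply: (measurableT_comp (measurable_bext i j)).
  by apply: measurable_fun_pair => //; exact: measurable_snd.
have m1 : measurable_fun setT (fun z : T * plane R => (Uval (sqrtQ u) z.2).1 : measurableTypeR R).
  exact: (measurableT_comp measurable_fst (measurableT_comp mU measurable_snd)).
have m2 : measurable_fun setT (fun z : T * plane R => (Uval (sqrtQ u) z.2).2 : measurableTypeR R).
  exact: (measurableT_comp measurable_snd (measurableT_comp mU measurable_snd)).
by apply: measurable_fun_pair; apply: measurable_funD; apply: measurable_funM => //;
  exact: mb.
Qed.

Lemma field_sum_measurable x : measurable_fun setT (field_sum x V : plane R -> plane R).
Proof.
apply: bc_field_measurable; split; rewrite /field_sum /=.
  elim: (index_enum _) => [|i s IHs].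
    by under eq_fun do rewrite big_nil; exact: bounded_continuous_cst.
  under eq_fun do rewrite big_cons; apply: bounded_continuousD => //.
  by apply: bounded_continuousZ; case: (bV i).
elim: (index_enum _) => [|i s IHs].
  by under eq_fun do rewrite big_nil; exact: bounded_continuous_cst.
under eq_fun do rewrite big_cons; apply: bounded_continuousD => //.
by apply: bounded_continuousZ; case: (bV i).
Qed.

Lemma diffusion_field_measurable x u : measurable_fun setT (diffusion_field x u).
Proof.
(* A one-point parameter space specialises the joint statement to a single field. *)
have h : measurable_fun setT (fun z : unit * plane R => field_sum x V z.2 : plane R).
  exact: (measurableT_comp (field_sum_measurable x) measurable_snd).
have := @measurable_diffusion_field _ unit (fun=> x) u h.
move=> /measurable_fun_pair2; exact.
Qed.

Lemma diffusion_fieldE x u p : sqD p ->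
  diffusion_field x u p = mxact (b p (field_sum x V p)) (Uval (sqrtQ u) p).
Proof. by move=> Dp; rewrite /diffusion_field /bext !patchE mem_set. Qed.

Lemma diffusion_field_le x u p : sqD p ->
  dot_fun (diffusion_field x u) (diffusion_field x u) p <=
  beta ^+ 2 * dot_fun (Uval (sqrtQ u)) (Uval (sqrtQ u)) p.
Proof.
move=> Dp; rewrite /dot_fun (diffusion_fieldE _ _ Dp) -!expr2.
set y := Uval _ p; set z := mxact _ _.
have sq (a : R * R) : a.1 ^+ 2 + a.2 ^+ 2 = pnorm a ^+ 2.
  by rewrite sqr_sqrtr// addr_ge0 ?sqr_ge0.
rewrite (sq z) (sq y) -exprMn ler_pXn2r ?nnegrE ?mulr_ge0 ?pnorm_ge0 ?coef_bound_ge0//.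
apply: le_trans (pnorm_mxact_le _ _) _.
by rewrite ler_wpM2r ?pnorm_ge0// opnorm_coef_le.
Qed.

Lemma diffusion_integral_le x u :
  (\int[mu]_(p in @sqD R) (dot_fun (diffusion_field x u) (diffusion_field x u) p)%:E <=
   (beta ^+ 2 * L2dot u (Q u))%:E)%E.
Proof.
have [_ symG _ GG] := hsqrtQ; rewrite -GG -symG EFinM.
rewrite (is_class_dot (is_class_Uval (sqrtQ u)) (is_class_Uval (sqrtQ u))).
have mD := @measurable_sqD R.
have md v : measurable_fun setT v -> measurable_fun (@sqD R) (fun p => (dot_fun v v p)%:E).
  move=> mv; apply: measurable_funTS; apply/measurable_EFinP.
  have m1 := measurableT_comp measurable_fst mv; have m2 := measurableT_comp measurable_snd mv.
  by apply: measurable_funD; apply: measurable_funM.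
have d0 v p : (0 <= (dot_fun v v p : R)%:E)%E.
  by rewrite lee_fin /dot_fun addr_ge0// -expr2 sqr_ge0.
have mU := Uval_measurable (sqrtQ u).
rewrite -ge0_integralZl//; last 2 first.
- exact: (md _ mU).
- by rewrite lee_fin sqr_ge0.
apply: ge0_le_integral => //.
- by apply: md; exact: diffusion_field_measurable.
- by apply: measurable_funeM; exact: md.
- by move=> p Dp; rewrite -EFinM lee_fin diffusion_field_le.
Qed.

Lemma diffusion_field_class x u : is_class (diffusion_field x u) (cls (diffusion_field x u)).
Proof.
apply: is_class_cls.
  by apply: measurable_funTS; exact: diffusion_field_measurable.
exact: le_lt_trans (diffusion_integral_le x u) (ltry _).
Qed.

Definition diffusion x k u : R := L2dot (e k) (B (\sum_i x i *: e i) u).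

Lemma diffusionE x k u : diffusion x k u = L2dot (e k) (cls (diffusion_field x u)).
Proof.
rewrite /diffusion (hB (v := field_sum x V)); last 2 first.
- exact: is_class_field_sum.
- by apply: Hs_family => //; [case: hHH|exact: basis_sub].
rewrite (orth_projection_dot _ hprojH); last exact: (basis_sub hHH).
congr (L2dot _ _); apply: cls_eq; apply: is_class_ae (diffusion_field_class x u) _ _.
  apply: (eq_measurable_fun (diffusion_field x u)).
    by move=> p; rewrite inE => /diffusion_fieldE.
  by apply: measurable_funTS; exact: diffusion_field_measurable.
by apply: filterS (ae_sqD R) => p /diffusion_fieldE.
Qed.

(** Bessel's inequality removes the coordinates in [e], the operator norm of [b] contributes
    [beta ^+ 2], and the values [<u, Q u> = |sqrtQ u|^2] sum over [f] to at most the trace. Neither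
    [K] nor [n] enters. *)
Lemma diffusion_bound x n (f : 'I_n -> U) : injective f -> (forall j, UU (f j)) ->
  \sum_k \sum_j diffusion x k (f j) ^+ 2 <= optrace UU Q * beta ^+ 2.
Proof.
move=> fi fU; rewrite exchange_big /=.
have eo : forall i j, L2dot (e i) (e j) = (i == j)%:R.
  by apply: orthonormal_family eHH => //; case: hHH.
apply: le_trans (_ : \sum_j beta ^+ 2 * L2dot (f j) (Q (f j)) <= _).
  apply: ler_sum => j _; rewrite (eq_bigr (fun k => L2dot (e k) (cls (diffusion_field x (f j))) ^+ 2)).
    apply: le_trans (bessel eo _) _.
    exact: is_class_norm_le (diffusion_field_class _ _) (diffusion_integral_le _ _).
  by move=> k _; rewrite diffusionE.
by rewrite -mulr_sumr mulrC ler_wpM2r ?sqr_ge0// optrace_ge.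
Qed.

Lemma measurable_diffusion k u : measurable_fun setT
  (fun t : K.-tuple (measurableTypeR R) => diffusion (tnth t) k u : measurableTypeR R).
Proof.
pose T : Type := (K.-tuple (measurableTypeR R))%type.
have mV i := bc_field_measurable (bV i).
have mF : measurable_fun setT (fun z : (K.-tuple (measurableTypeR R)) * plane R =>
    field_sum (tnth z.1) V z.2 : plane R).
  apply: measurable_fun_pair.
    by apply: (measurable_tuple_sum (v := fun i p => (V i p).1)) => i;
      exact: (measurableT_comp measurable_fst (mV i)).
  by apply: (measurable_tuple_sum (v := fun i p => (V i p).2)) => i;
    exact: (measurableT_comp measurable_snd (mV i)).
have mG := measurable_diffusion_field u mF.
have mdot : measurable_fun setT (fun z : (K.-tuple (measurableTypeR R)) * plane R =>
    dot_fun (V k) (diffusion_field (tnth z.1) u) z.2 : measurableTypeR R).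
  apply: measurable_funD; apply: measurable_funM.
  - exact: (measurableT_comp measurable_fst (measurableT_comp (mV k) measurable_snd)).
  - exact: (measurableT_comp measurable_fst mG).
  - exact: (measurableT_comp measurable_snd (measurableT_comp (mV k) measurable_snd)).
  - exact: (measurableT_comp measurable_snd mG).
have := measurable_Rintegral_param mdot; congr measurable_fun; apply/funext => t.
rewrite diffusionE (is_class_dotT (Ve k) (diffusion_field_class _ _))//.
have := measurable_fun_pair2 t mdot; exact.
Qed.
End galerkin_noise.

(** * Moments of the scheme *)

Section grid_facts.
Context (R : realType).
Implicit Types (A theta : set R) (t T : R).

Lemma finite_max A : finite_set A -> A !=set0 -> A (sup A) /\ forall x, A x -> x <= sup A.
Proof.
move=> fA A0; have [K [e [_ eA]]] := finite_family fA.
have [i0 _] : exists i0 : 'I_K, True by case: A0 => x; rewrite -eA => -[i _ _]; exists i.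
have [i _ imax] := @Order.TotalTheory.arg_maxP _ _ _ i0 xpredT e isT.
have eub : ubound A (e i) by move=> x; rewrite -eA => -[j _ <-]; exact: imax.
have Aei : A (e i) by rewrite -eA; exists i.
have -> : sup A = e i.
  apply/eqP; rewrite eq_le ge_sup//=; apply: ub_le_sup => //.
  by exists (e i).
by split.
Qed.

Lemma gfloor_grid T theta t : grid T theta -> 0 < t <= T ->
  [/\ theta (gfloor theta t), 0 <= gfloor theta t, gfloor theta t < t &
      forall s, theta s -> s < t -> s <= gfloor theta t].
Proof.
move=> [fth thT th0 thT'] /andP[t0 tT].
have f1 : finite_set (`[0, t[ `&` theta) by apply: sub_finite_set fth => x [].
have [|[/= + th] hmax] := finite_max f1.
  by exists 0; split => //=; rewrite in_itv/= lexx.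
rewrite in_itv/= => /andP[g0 gt]; split => // s ths st.
apply: hmax; split => //=; rewrite in_itv/= st andbT.
by have := thT _ ths; rewrite /= in_itv/= => /andP[].
Qed.

Lemma gfloor_mesh T theta t : grid T theta -> 0 < t <= T -> t - gfloor theta t <= mesh theta.
Proof.
move=> gth t0T; have [thg g0 gt gmax] := gfloor_grid gth t0T.
have [fth thT th0 thT'] := gth; have /andP[t0 tT] := t0T.
(* Negation turns the least grid point that is not before [t] into a maximum; it follows
   [gfloor theta t] immediately in the grid. *)
pose A := [set - s | s in theta `&` [set s | t <= s]].
have [| |[s [ths /= ts] sE] smax] := @finite_max A.
- by apply: finite_image; apply: sub_finite_set fth => x [].
- by exists (- T), T.
apply: le_trans (_ : s - gfloor theta t <= _); first by rewrite lerD2r.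
apply: ub_le_sup.
  exists T => _ [a [b [tha thb _ _ ->]]].
  have := thT _ tha; have := thT _ thb; rewrite /= !in_itv/= => /andP[_ bT] /andP[a0 _].
  lra.
exists (gfloor theta t), s; split => //; first exact: lt_le_trans ts.
move=> u thu; apply/negP => /andP[gu us].
have [ut|tu] := ltP u t; first by have := gmax _ thu ut; rewrite leNgt gu.
have := smax (- u); rewrite -sE lerN2 leNgt us => h.
by suff : false by []; apply: h; exists u.
Qed.

(** With [p = h^(- delta)], [h p^3 = h^(1 - 3 delta)] is at most the larger of 1 and [h]. The factor
    4 is that of [(1 + u)^3 <= 4 (1 + u^3)], where the difference is [3 (1 + u) (1 - u)^2]. *)
Lemma step_size_bound (T c delta h : R) : 0 <= T -> 0 <= c -> 0 <= delta -> 3 * delta <= 1 ->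
  0 < h -> h <= T ->
  h * (1 + c * h `^ (- delta)) ^+ 3 <= 4 * T + 4 * c ^+ 3 * (1 + T).
Proof.
move=> T0 c0 d0 d1 h0 hT; set p := h `^ (- delta).
have p0 : 0 <= p by exact: powR_ge0.
have hp : h * p ^+ 3 <= 1 + T.
  have -> : h * p ^+ 3 = h `^ (1 - 3 * delta).
    rewrite -powR_mulrn// -powRrM -{1}[h]powRr1 ?(ltW h0)// -powRD; last first.
      by rewrite (gt_eqF h0) implybT.
    by congr (_ `^ _); ring.
  have [h1|h1] := leP h 1.
    apply: le_trans (_ : 1 <= _); last by rewrite lerDl.
    rewrite [leRHS](_ : _ = 1 `^ (1 - 3 * delta)); last by rewrite powR1.
    apply: ge0_ler_powR; rewrite ?nnegrE ?subr_ge0//.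
    exact: ltW.
  apply: le_trans (_ : h `^ 1 <= _); last by rewrite powRr1 ?(ltW h0)// (le_trans hT)// lerDr.
  by apply: ler_powR; [exact: ltW|rewrite gerBl mulr_ge0].
have x0 : 0 <= c * p by exact: mulr_ge0.
have cub : (1 + c * p) ^+ 3 <= 4 * (1 + (c * p) ^+ 3).
  rewrite -subr_ge0 (_ : _ - _ = 3 * ((1 + c * p) * (1 - c * p) ^+ 2)); last by ring.
  by rewrite mulr_ge0// mulr_ge0 ?sqr_ge0// addr_ge0.
apply: le_trans (ler_wpM2l (ltW h0) cub) _.
have c3 : 0 <= 4 * c ^+ 3 by rewrite mulr_ge0// exprn_ge0.
have e1 := ler_wpM2l c3 hp.
rewrite (_ : h * _ = 4 * h + 4 * c ^+ 3 * (h * p ^+ 3)); last by ring.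
by apply: lerD => //; rewrite ler_wpM2l.
Qed.
End grid_facts.

Section past_measurability.
Context d (Om : measurableType d) (R : realType).
Variable F0 : set (set Om).
Hypothesis F0_sigma : sigma_algebra setT F0.

Let OmF := g_sigma_algebraType F0.

Let measurable_OmF (A : set OmF) : measurable A = F0 A.
Proof. by rewrite /measurable /= sigma_algebra_id. Qed.

Lemma past_comp K (y : 'I_K -> Om -> measurableTypeR R)
    (g : K.-tuple (measurableTypeR R) -> measurableTypeR R) :
  (forall k (E : set (measurableTypeR R)), measurable E -> F0 (y k @^-1` E)) ->
  measurable_fun setT g ->
  forall E : set (measurableTypeR R), measurable E -> F0 ((fun w => g (vec y w)) @^-1` E).
Proof.
move=> my mg E mE; rewrite -measurable_OmF.
have mv : measurable_fun setT (vec y : OmF -> _).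
  apply: (@measurable_vec _ OmF) => k _ E' mE'.
  by rewrite setTI measurable_OmF; exact: my.
by have := measurableT_comp mg mv measurableT mE; rewrite setTI.
Qed.

Lemma past_open (X : Om -> measurableTypeR R) :
  (forall A : set R, open A -> F0 (X @^-1` A)) ->
  forall E : set (measurableTypeR R), measurable E -> F0 (X @^-1` E).
Proof.
move=> h E mE; rewrite -measurable_OmF -[_ @^-1` _]setTI.
suff : measurable_fun setT (X : OmF -> measurableTypeR R) by apply.
apply: (measurability _ (RGenOpens.measurableE R)).
move=> _ [_ [a [b ->] <-]]; rewrite setTI measurable_OmF; apply: h.
exact: interval_open.
Qed.
End past_measurability.

(** The integral of a nonnegative function is a supremum over simple functions below it, so
    monotonicity is an inclusion of sets and asks for no measurability. *)
Lemma le_integral_nonneg d (T : measurableType d) (R : realType)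
    (mu : {measure set T -> \bar R}) (f g : T -> \bar R) :
  (forall x, (0 <= f x)%E) -> (forall x, (f x <= g x)%E) ->
  (\int[mu]_x f x <= \int[mu]_x g x)%E.
Proof.
move=> f0 fg; have g0 x : (0 <= g x)%E by exact: le_trans (f0 x) (fg x).
rewrite !ge0_integralTE//; apply: le_ereal_sup => _ [h hf <-].
by exists h => // x; exact: le_trans (hf x) (fg x).
Qed.

(** * Increments of the cylindrical Wiener process *)

Section wiener_increments.
Context (R : realType) d (Omega : measurableType d) (P : probability Omega R).
Local Notation U := (Uspace R).
Variables (T : R) (Ft : R -> set (set Omega)) (W : R -> U -> Omega -> R).
Hypotheses (hFt : filtration T Ft) (hW : cyl_wiener P T Ft W).
Variables (UU : set U) (n : nat) (f : 'I_n -> U).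
Hypotheses (oUU : Defs.orthonormal UU) (fi : injective f) (fU : forall i, UU (f i)).
Variables (s t : R).
Hypotheses (s0 : 0 <= s) (st : s < t) (tT : t <= T).

Definition increment i w : measurableTypeR R := W t (f i) w - W s (f i) w.

Let mW u q : 0 <= q <= T -> measurable_fun setT (W q u : Omega -> measurableTypeR R).
Proof.
move=> qT _ E mE; rewrite setTI; have [_ sub _] := hFt.
by apply: (sub _ qT); exact: (cyl_wiener_adapted hW u qT mE).
Qed.

Lemma measurable_increment i : measurable_fun setT (increment i).
Proof.
apply: measurable_funB; apply: mW; apply/andP; split => //.
- by rewrite (le_trans s0)// ltW.
- by rewrite (le_trans (ltW st)).
Qed.

Lemma increment_law A E : Ft s A -> (forall i, measurable (E i)) ->
  P (A `&` vec increment @^-1` box E) =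
  (P A * \prod_(i < n) normal_prob 0 (Num.sqrt (t - s)) (E i))%E.
Proof.
move=> FA mE; pose us := [seq f i | i <- index_enum 'I_n].
(* Events are indexed by vectors in [cyl_wiener_increments]; injectivity of [f] transports the
   family [E], with the full line elsewhere. *)
pose E' u : set (measurableTypeR R) := if [pick i | f i == u] is Some i then E i else setT.
have E'f i : E' (f i) = E i.
  by rewrite /E'; case: pickP => [j /eqP/fi->//|/(_ i)]; rewrite eqxx.
have uus : uniq us by rewrite map_inj_uniq// index_enum_uniq.
have ous : Defs.orthonormal [set` us].
  by move=> u v /mapP[i _ ->] /mapP[j _ ->]; exact: oUU.
have mE' u : measurable (E' u) by rewrite /E'; case: pickP.
have := cyl_wiener_increments hW s0 st tT uus ous mE' FA.
rewrite big_map (eq_bigr (fun i => normal_prob 0 (Num.sqrt (t - s)) (E i))); last first.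
  by move=> i _; rewrite E'f.
move=> <-; congr (P (A `&` _)); rewrite vec_box; apply/seteqP; split=> w /=.
  by move=> h _ /mapP[i _ ->] /=; rewrite E'f; exact: h.
move=> h i; have := h (f i); rewrite /= E'f; apply.
by apply/mapP; exists i => //; rewrite mem_index_enum.
Qed.

Lemma increment_gaussian : gaussian_family P (Num.sqrt (t - s)) increment.
Proof.
split; first exact: measurable_increment.
move=> E mE; rewrite -[X in P X]setTI increment_law//; first by rewrite probability_setT mul1e.
have sT : 0 <= s <= T by rewrite s0 (le_trans (ltW st)).
have [/(_ s sT)[F0 FC _] _ _] := hFt.
by rewrite -[setT]setD0; exact: FC.
Qed.

Lemma increment_indep A E : Ft s A -> (forall i, measurable (E i)) ->
  P (A `&` vec increment @^-1` box E) = (P A * P (vec increment @^-1` box E))%E.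
Proof.
by move=> FA mE; rewrite increment_law//; have [_ ->] := increment_gaussian.
Qed.
End wiener_increments.

(** Adaptedness of the scheme is stated for the norm of [H], while [r] is Borel for that of
    [H_gamma]. A Lipschitz bound between the two norms on a Galerkin space turns relatively open
    sets of the second kind into ones of the first. *)
Lemma borel_on_trace (R : realType) (S S' : set (Uspace R)) (N N' : Uspace R -> R) (C : R) :
  S `<=` S' -> 0 < C -> (forall x y, S x -> S y -> N' (y - x) <= C * N (y - x)) ->
  forall A, borel_on S' N' A -> borel_on S N (A `&` S).
Proof.
move=> SS C0 NN; apply: smallest_sub.
  split=> [|A hA|A hA].
  - by rewrite set0I; exact: sigma_algebra0.
  - rewrite (_ : _ `&` S = S `\` (A `&` S)); first exact: sigma_algebraCD.
    apply/seteqP; split=> x /= [].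
      by move=> [_ nA] Sx; split => // -[].
    by move=> Sx nAS; split => //; split; [exact: SS|move=> Ax; apply: nAS].
  - by rewrite setI_bigcupl; exact: sigma_algebra_bigcup.
move=> O [OS' hO]; apply: sub_sigma_algebra; split; first by move=> x [].
move=> x [Ox Sx]; have [c c0 hc] := hO x Ox.
exists (c / C); first by rewrite divr_gt0.
move=> y Sy xy; split => //; apply: hc; first exact: SS.
by apply: le_lt_trans (NN _ _ Sx Sy) _; rewrite mulrC -ltr_pdivlMr.
Qed.

(** * The tamed scheme on a fixed grid and Galerkin space *)

Section tamed_scheme.
Context (R : realType) d (Omega : measurableType d) (P : probability Omega R).
Local Notation U := (Uspace R).
Variables (eta gamma T eps delta c vt : R) (UU H HH : set U) (lam : U -> R).
Hypotheses (heta : 0 < eta) (hT : 0 < T) (heps : 0 < eps) (hdelta : 0 < delta < 1 / 18).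
Hypotheses (hc : 0 <= c) (hvt : 0 <= vt).
Hypotheses (oUU : Defs.orthonormal UU) (hH : closed_subspace H) (hHH : orthonormal_basis H HH).
Hypothesis lam_le0 : forall h, HH h -> lam h <= 0.
Variables (Ft : R -> set (set Omega)) (W : R -> U -> Omega -> R).
Hypotheses (hFt : filtration T Ft) (hW : cyl_wiener P T Ft W).
Variables (r : U -> R) (F : U -> U) (B : U -> U -> U).
Hypothesis hrm : forall E : set (measurableTypeR R), measurable E ->
  borel_on (Hs H HH lam gamma) (Hs_norm HH lam gamma) (Hs H HH lam gamma `&` r @^-1` E).
Hypothesis hBHS : forall w, Hs H HH lam gamma w -> hilbert_schmidt UU H (B w).
Variables (K n : nat) (e : 'I_K -> U) (f : 'I_n -> U) (theta : set R).
Hypotheses (ei : injective e) (eHH : forall i, HH (e i)).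
Hypotheses (fi : injective f) (fU : forall i, UU (f i)) (gth : grid T theta).
Implicit Types x : 'I_K -> R.
Hypothesis drift_eq : forall x, \sum_k x k * drift F e x k = eta * \sum_k x k ^+ 2.
Hypothesis drift_le : forall x, \sum_k drift F e x k ^+ 2 <= r (\sum_i x i *: e i) ^+ 2.
Hypothesis growth : forall x, eps * (\sum_k x k ^+ 2) <= r (\sum_i x i *: e i).
Hypothesis mdrift : forall k, measurable_fun setT
  (fun t : K.-tuple (measurableTypeR R) => drift F e (tnth t) k : measurableTypeR R).
Hypothesis noise_le : forall x, \sum_k \sum_j diffusion B e x k (f j) ^+ 2 <= vt.
Hypothesis mnoise : forall k u, measurable_fun setT
  (fun t : K.-tuple (measurableTypeR R) => diffusion B e (tnth t) k u : measurableTypeR R).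
Variable Y : R -> Omega -> U.
Hypothesis hYval : forall t om, 0 <= t <= T -> (projI (range e) @` H) (Y t om).
Hypothesis hYadapted : forall t, 0 <= t <= T ->
  forall A, borel_on (projI (range e) @` H) (fun v => `|v|) A -> Ft t (Y t @^-1` A).
Hypothesis hY : forall t, 0 < t <= T ->
  let tau := gfloor theta t in
  let Ytau := Y tau in
  let chi := fun om => if r (Ytau om) <= c * mesh theta `^ (- delta) then 1 else 0 in
  let S := semigroup HH lam (t - tau) in
  {ae P, forall om,
    Y t om =
      S (Ytau om + (chi om * (t - tau)) *: projI (range e) (F (Ytau om))) +
      (1 + `| stoch_int UU W
                (fun om u => projI (range e) (B (Ytau om) (projI (range f) u)))
                tau t om | ^+ 2)^-1 *:
      stoch_int UU W
        (fun om u => S (chi om *: projI (range e) (B (Ytau om) (projI (range f) u))))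
        tau t om}.

Let eo : forall i j, L2dot (e i) (e j) = (i == j)%:R.
Proof. by apply: orthonormal_family eHH => //; case: hHH. Qed.

Definition coord t k om : measurableTypeR R := L2dot (e k) (Y t om).

Lemma scheme_coord t om : 0 <= t <= T -> Y t om = \sum_k (coord t k om : R) *: e k.
Proof.
move=> t0T; have [v _ vY] := hYval om t0T; rewrite -vY (projI_family ei); apply: eq_bigr => k _.
by rewrite /coord -vY (projI_family ei) (orthonormal_coord eo).
Qed.

Lemma scheme_norm t om : 0 <= t <= T -> `|Y t om| ^+ 2 = \sum_k (coord t k om : R) ^+ 2.
Proof. by move=> t0T; rewrite (scheme_coord om t0T) (orthonormal_norm eo). Qed.

Lemma span_projI v : (projI (range e) @` H) v -> exists x, v = \sum_k x k *: e k.
Proof. by move=> [u _ <-]; rewrite (projI_family ei); exists (fun k => L2dot (e k) u). Qed.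

Lemma past_coord t k (E : set (measurableTypeR R)) : 0 <= t <= T -> measurable E ->
  Ft t (coord t k @^-1` E).
Proof.
move=> t0T; have [/(_ t t0T) sF _ _] := hFt; move: E.
apply: (past_open sF) => A oA.
pose S := projI (range e) @` H.
have -> : coord t k @^-1` A = Y t @^-1` (S `&` [set v | A (L2dot (e k) v)]).
  by apply/seteqP; split=> om /= => [h|[]//]; split => //; exact: hYval.
apply: hYadapted => //; apply: sub_sigma_algebra; split; first by move=> v [].
move=> v [Sv Av]; have /nbhs_ballP [q /= q0 qA] : nbhs (L2dot (e k) v) A.
  exact: open_nbhs_nbhs.
exists q => // u Su uv; split => //; apply: qA; rewrite /ball /= distrC.
rewrite -mulN1r -L2dotZr -L2dotDr scaleN1r; apply: le_lt_trans (L2dot_norm_le _ _) _.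
have -> : `|e k| = 1 by rewrite L2normE eo eqxx sqrtr1.
by rewrite mul1r.
Qed.

Lemma past_drift t k (E : set (measurableTypeR R)) : 0 <= t <= T -> measurable E ->
  Ft t ((fun om => drift F e (coord t ^~ om) k) @^-1` E).
Proof.
move=> t0T mE; have [/(_ t t0T) sF _ _] := hFt.
have <- : (fun om => drift F e (tnth (vec (coord t) om)) k) =
    fun om => drift F e (coord t ^~ om) k.
  apply/funext => om; congr (drift F e _ k); apply/funext => i; exact: tnth_mktuple.
exact: (past_comp sF (fun k E => @past_coord t k E t0T) (mdrift k) mE).
Qed.

Lemma past_diffusion t k j (E : set (measurableTypeR R)) : 0 <= t <= T -> measurable E ->
  Ft t ((fun om => diffusion B e (coord t ^~ om) k (f j)) @^-1` E).
Proof.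
move=> t0T mE; have [/(_ t t0T) sF _ _] := hFt.
have <- : (fun om => diffusion B e (tnth (vec (coord t) om)) k (f j)) =
    fun om => diffusion B e (coord t ^~ om) k (f j).
  apply/funext => om; congr (diffusion B e _ k (f j)); apply/funext => i; exact: tnth_mktuple.
exact: (past_comp sF (fun k E => @past_coord t k E t0T) (mnoise k (f j)) mE).
Qed.

Lemma past_growth t q : 0 <= t <= T -> Ft t [set om | r (Y t om) <= q].
Proof.
move=> t0T; pose S := projI (range e) @` H.
pose E := [set x | x <= q] : set (measurableTypeR R).
have mE : measurable E.
  have -> : E = `]-oo, q]%classic by rewrite set_itvE.
  exact: measurable_itv.
have SHs : S `<=` Hs H HH lam gamma.
  move=> v /span_projI[x ->]; apply: Hs_family => //; first by case: hHH.
  exact: basis_sub.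
(* A Lipschitz constant of the norm of [H_gamma] against that of [H] on the Galerkin space; the
   summand 1 keeps it positive when the sum vanishes. *)
pose M := Num.sqrt (\sum_k ((- lam (e k)) `^ gamma) ^+ 2) + 1.
have M0 : 0 < M by rewrite ltr_pwDr// sqrtr_ge0.
have NM u v : S u -> S v -> Hs_norm HH lam gamma (v - u) <= M * `|v - u|.
  move=> /span_projI[x ->] /span_projI[y ->].
  have -> : \sum_k y k *: e k - \sum_k x k *: e k = \sum_k (y k - x k) *: e k.
    by rewrite -sumrN -big_split; apply: eq_bigr => k _; rewrite scalerBl.
  apply: le_trans (_ : Num.sqrt (\sum_k ((- lam (e k)) `^ gamma) ^+ 2) *
    `|\sum_k (y k - x k) *: e k| <= _); last first.
    by rewrite ler_wpM2r// lerDl.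
  have N0 : 0 <= Hs_norm HH lam gamma (\sum_k (y k - x k) *: e k) by exact: normr_ge0.
  rewrite -(@ler_pXn2r _ 2) ?nnegrE ?N0 ?mulr_ge0 ?sqrtr_ge0 ?normr_ge0//.
  have l0 : 0 <= \sum_k ((- lam (e k)) `^ gamma) ^+ 2 by apply: sumr_ge0 => k _; exact: sqr_ge0.
  rewrite (Hs_norm_family _ ei eHH); last by case: hHH.
  rewrite exprMn (sqr_sqrtr l0) (orthonormal_norm eo) mulr_suml; apply: ler_sum => k _.
  rewrite ler_wpM2l ?sqr_ge0// (bigD1 k)//= lerDl; apply: sumr_ge0 => j _; exact: sqr_ge0.
have -> : [set om | r (Y t om) <= q] = Y t @^-1` ((Hs H HH lam gamma `&` r @^-1` E) `&` S).
  apply/seteqP; split=> om /= => [h|[[_]//]]; split; last exact: hYval.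
  by split => //; apply: SHs; exact: hYval.
by apply: hYadapted => //; exact: borel_on_trace SHs M0 NM _ (hrm mE).
Qed.

(** Basis vectors outside [range f] are killed by the projection, so only the finitely many
    increments along [f] enter. *)
Lemma stoch_int_family (G : Omega -> U -> U) s t om : G om 0 = 0 ->
  stoch_int UU W (fun om u => G om (projI (range f) u)) s t om =
  \sum_j (increment W f s t j om : R) *: G om (f j).
Proof.
move=> G0; rewrite /stoch_int (@fsbig_family _ _ _ _ _ f)//.
  by apply: eq_bigr => j _; rewrite (projI_inside oUU fi fU).
by move=> u Uu nu; rewrite (projI_outside oUU fi fU Uu nu) G0 scaler0.
Qed.

Let B0 x : B (\sum_i x i *: e i) 0 = 0.
Proof.
have /hBHS[[lB _] _ _] : Hs H HH lam gamma (\sum_i x i *: e i).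
  by apply: Hs_family => //; [case: hHH|exact: basis_sub].
have := lB 1 0 0; rewrite !scale1r addr0 => h; apply: (@addrI _ (B (\sum_i x i *: e i) 0)).
by rewrite addr0 -[LHS]h.
Qed.

Let projI0 : projI (range e) 0 = 0.
Proof. by rewrite (projI_family ei) big1// => k _; rewrite L2dotC L2dot0l scale0r. Qed.

Lemma semigroup_family s x :
  semigroup HH lam s (\sum_i x i *: e i) = \sum_i (expR (s * lam (e i)) * x i) *: e i.
Proof. by apply: diag_op_family => //; case: hHH. Qed.

Lemma semigroup0 s : semigroup HH lam s 0 = 0.
Proof.
have := semigroup_family s (fun=> 0).
by rewrite !big1// => i _; rewrite ?mulr0 scale0r.
Qed.

Section step.
Variable t : R.
Hypothesis t0T : 0 < t <= T.
Let tau := gfloor theta t.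
Let h := t - tau.
Let y om k : R := coord tau k om.
Let beta om k j : R := diffusion B e (y om) k (f j).
Let inc om := vec (increment W f tau t) om.

Let tauT : 0 <= tau <= T.
Proof.
have [_ g0 gt _] := gfloor_grid gth t0T; rewrite g0 /=.
by case/andP: t0T => _; apply: le_trans; exact: ltW.
Qed.

Let h0 : 0 < h.
Proof. by have [_ _ gt _] := gfloor_grid gth t0T; rewrite subr_gt0. Qed.

Let t0T' : 0 <= t <= T. Proof. by case/andP: t0T => /ltW-> ->. Qed.

(** The semigroup is diagonal in the basis, so each coordinate carries one factor
    [expR (h * lam (e k))] common to drift and noise, ready to be discarded as a contraction. *)
Lemma scheme_step_coord : {ae P, forall om k,
  (coord t k om : R) = expR (h * lam (e k)) *
   (y om k + (if r (Y tau om) <= c * mesh theta `^ (- delta) then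
      h * drift F e (y om) k +
      (1 + \sum_l noise (beta om) (inc om) l ^+ 2)^-1 * noise (beta om) (inc om) k else 0))}.
Proof.
have := hY t0T; rewrite -/tau -/h; apply: filterS => om E k; rewrite {1}/coord E.
set chi := if _ <= _ then 1 else 0.
have YE : Y tau om = \sum_i y om i *: e i by exact: scheme_coord.
have PF : projI (range e) (F (Y tau om)) = \sum_i drift F e (y om) i *: e i.
  by rewrite (projI_family ei) YE.
have PB j : projI (range e) (B (Y tau om) (f j)) = \sum_i beta om i j *: e i.
  by rewrite (projI_family ei) YE.
have s1 : stoch_int UU W (fun om u => projI (range e) (B (Y tau om) (projI (range f) u)))
    tau t om = \sum_i noise (beta om) (inc om) i *: e i.
  rewrite (stoch_int_family (G := fun om u => projI (range e) (B (Y tau om) u))); last first.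
    by rewrite YE B0 projI0.
  under eq_bigr do rewrite PB scaler_sumr.
  rewrite exchange_big /=; apply: eq_bigr => i _; rewrite /noise scaler_suml.
  by apply: eq_bigr => j _; rewrite scalerA tnth_mktuple mulrC.
pose chi' om := if r (Y tau om) <= c * mesh theta `^ (- delta) then 1 else 0 : R.
have s2 : stoch_int UU W (fun om u => semigroup HH lam h
      (chi' om *: projI (range e) (B (Y tau om) (projI (range f) u)))) tau t om =
    \sum_i (expR (h * lam (e i)) * (chi * noise (beta om) (inc om) i)) *: e i.
  rewrite (stoch_int_family (G := fun om u => semigroup HH lam h
    (chi' om *: projI (range e) (B (Y tau om) u)))); last first.
    by rewrite YE B0 projI0 scaler0 semigroup0.
  have PBS j : semigroup HH lam h (chi' om *: projI (range e) (B (Y tau om) (f j))) =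
      \sum_i (expR (h * lam (e i)) * (chi * beta om i j)) *: e i.
    rewrite PB scaler_sumr -semigroup_family; congr semigroup.
    by apply: eq_bigr => i _; rewrite scalerA.
  under eq_bigr do rewrite PBS scaler_sumr.
  rewrite exchange_big /=; apply: eq_bigr => i _; rewrite /noise !mulr_sumr scaler_suml.
  apply: eq_bigr => j _; rewrite scalerA tnth_mktuple; congr (_ *: _); ring.
rewrite s1 s2 (orthonormal_norm eo) PF {1}YE.
have -> : \sum_i y om i *: e i + (chi * h) *: (\sum_i drift F e (y om) i *: e i) =
    \sum_i (y om i + chi * h * drift F e (y om) i) *: e i.
  by rewrite scaler_sumr -big_split; apply: eq_bigr => i _; rewrite scalerDl scalerA.
rewrite semigroup_family scaler_sumr -big_split /=.
under eq_bigr do rewrite scalerA -scalerDl.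
rewrite /coord (orthonormal_coord eo) /chi; case: ifP => _; ring.
Qed.

Let contract k (a : R) : (expR (h * lam (e k)) * a) ^+ 2 <= a ^+ 2.
Proof.
rewrite exprMn ler_piMl ?sqr_ge0// expr_le1 ?expR_ge0// -expR0 ler_expR.
by rewrite mulr_ge0_le0 ?(ltW h0)// lam_le0.
Qed.

Let K2 := 4 * T + 4 * c ^+ 3 * (1 + T).

Lemma scheme_step_moment :
  (\int[P]_om (expR (eps * `|Y t om| ^+ 2 / expR (2 * (eta + eps * vt) * t)))%:E <=
   (expR (step_const eta eps vt T K2 * h))%:E *
   \int[P]_om (expR (eps * `|Y tau om| ^+ 2 / expR (2 * (eta + eps * vt) * tau)))%:E)%E.
Proof.
have [_ g0 gt _] := gfloor_grid gth t0T; have /andP[tp tT] := t0T.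
have [/(_ tau tauT) sF /(_ tau tauT) subF _] := hFt.
(* With this [a], multiplying by [expR (kap * h)] gives the weight at [tau], since [t = tau + h]. *)
set kap := 2 * (eta + eps * vt); pose a := eps / expR (kap * t).
(* The radius uses the actual step [h], which is at most the mesh; the exponent being negative, the
   threshold in [D] is at most [rho], and [h] and [rho] are tied together as [step_size_bound]
   requires. *)
pose rho := c * h `^ (- delta).
pose D := [set om | r (Y tau om) <= c * mesh theta `^ (- delta)].
have /andP[d0 d18] := hdelta.
have rho0 : 0 <= rho by rewrite mulr_ge0// powR_ge0.
have K20 : 0 <= K2.
  have c3 : 0 <= c ^+ 3 by exact: exprn_ge0.
  by rewrite /K2 !(addr_ge0, mulr_ge0)// ltW.
have a0 : 0 <= a by rewrite divr_ge0 ?expR_ge0// ltW.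
have kap0 : 0 <= kap by rewrite /kap !(mulr_ge0, addr_ge0)// ltW.
have aeps : a <= eps.
  rewrite ler_pdivrMr ?expR_gt0// ler_peMr ?(ltW heps)// -expR0 ler_expR.
  by rewrite mulr_ge0// ltW.
have hTle : h <= T by rewrite /h lerBlDr (le_trans tT)// lerDl.
have r_rho om : D om -> 0 <= r (Y tau om) /\ r (Y tau om) <= rho.
  move=> Dom; split.
    rewrite (scheme_coord om tauT); apply: le_trans (growth _).
    by rewrite mulr_ge0 ?(ltW heps)//; apply: sumr_ge0 => k _; exact: sqr_ge0.
  apply: le_trans Dom _; rewrite ler_wpM2l// !powRN lef_pV2 ?posrE ?powR_gt0//; last first.
    exact: lt_le_trans h0 (gfloor_mesh gth t0T).
  by apply: ge0_ler_powR; rewrite ?nnegrE ?(ltW d0) ?(ltW h0)//; 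
    [apply: le_trans (ltW h0) _|]; exact: (gfloor_mesh gth t0T).
have step := @one_step_moment _ Omega R P (Ft tau) (Num.sqrt h) n (increment W f tau t) sF subF _
  (increment_gaussian hFt hW oUU fi fU g0 gt tT)
  (fun A E FA mE => increment_indep hFt hW oUU fi fU g0 gt tT FA mE)
  K (coord tau) (fun k om => drift F e (y om) k) (fun k j om => beta om k j) D
  (fun k E mE => past_coord k tauT mE) _ _ (past_growth _ tauT)
  eta eps vt T K2 h rho a (ltW heta) (ltW heps) hvt (ltW hT) K20 (ltW h0) hTle rho0 _ a0 aeps
  (sqr_sqrtr (ltW h0)) _ _ _ _ (fun om => `|Y t om| ^+ 2).
have goal1 : (\int[P]_om (expR (a * `|Y t om| ^+ 2))%:E <=
   (expR (step_const eta eps vt T K2 * h))%:E *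
   \int[P]_om (expR (a * expR (kap * h) * \sum_k (coord tau k om : R) ^+ 2))%:E)%E.
  apply: step.
  - by rewrite sqrtr_eq0 -ltNge.
  - by move=> k E; exact: past_drift.
  - by move=> k j E; exact: past_diffusion.
  - apply: step_size_bound => //; [exact: ltW|exact: ltW|lra].
  - move=> om Dom; have [_] := r_rho om Dom; apply: le_trans.
    by rewrite (scheme_coord om tauT); exact: growth.
  - by move=> om _; rewrite drift_eq.
  - move=> om Dom; have [r0 rr] := r_rho om Dom.
    apply: le_trans (drift_le (y om)) _; rewrite -(scheme_coord om tauT).
    by rewrite ler_pXn2r ?nnegrE.
  - by move=> om _; exact: noise_le.
  - under eq_fun do rewrite scheme_norm//.
    apply: measurable_sum => k; apply: measurable_funX => _ E mE; rewrite setTI.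
    have [_ /(_ t t0T') subt _] := hFt; apply: subt; exact: past_coord.
  - apply: filterS scheme_step_coord => om E Dom.
    rewrite (scheme_norm om t0T') /tamed_sqr_norm; apply: ler_sum => k _.
    rewrite E; move: Dom; rewrite /D /= => ->; rewrite addrA.
    exact: contract.
  - apply: filterS scheme_step_coord => om E /negP/negbTE Dom.
    rewrite (scheme_norm om t0T'); apply: ler_sum => k _.
    by rewrite E Dom addr0; exact: contract.
apply: le_trans (le_trans goal1 _).
  by apply: le_integral_nonneg => om; rewrite lee_fin ?expR_ge0// /a mulrAC.
rewrite lee_wpmul2l ?lee_fin ?expR_ge0//; apply: le_integral_nonneg => om; rewrite lee_fin ?expR_ge0//.
rewrite (scheme_norm om tauT) ler_expR /a.
rewrite (_ : expR (kap * t) = expR (kap * tau) * expR (kap * h)); last first.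
  by rewrite -expRD -mulrDr /h addrCA subrr addr0.
rewrite invfM le_eqVlt; apply/orP; left; apply/eqP.
have ne q : expR q != 0 :> R by rewrite gt_eqF// expR_gt0.
by field; rewrite !ne.
Qed.
End step.

(** Strong induction on the number of enumerated grid points before [t], which drops on passing to
    [gfloor theta t]. The factors [exp (C h)] telescope to [exp (C t)], so the number of steps
    leaves no trace. *)
Lemma scheme_moment t : 0 <= t <= T ->
  (\int[P]_om (expR (eps * `|Y t om| ^+ 2 / expR (2 * (eta + eps * vt) * t)))%:E <=
   (expR (step_const eta eps vt T (4 * T + 4 * c ^+ 3 * (1 + T)) * t))%:E *
   \int[P]_om (expR (eps * `|Y 0 om| ^+ 2))%:E)%E.
Proof.
set C := step_const _ _ _ _ _.
have [fth _ _ _] := gth; have [N [g [_ gE]]] := finite_family fth.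
have [m] := ubnP #|[set i | (g i < t)%R]%SET|; elim: m t => // m IHm t hm t0T.
have [->|tn0] := eqVneq t 0.
  rewrite !mulr0 expR0 mul1e; apply: le_integral_nonneg => om; rewrite lee_fin ?expR_ge0//.
  by rewrite divr1.
have t0T' : 0 < t <= T by case/andP: t0T => t0 ->; rewrite lt_def tn0 t0.
have [thg g0 gt _] := gfloor_grid gth t0T'; have /andP[_ tT] := t0T.
set tau := gfloor theta t in thg g0 gt *.
have tauT : 0 <= tau <= T by rewrite g0 (le_trans (ltW gt)).
have [i0 gi0] : exists i, g i = tau by move: thg; rewrite -gE => -[i _ <-]; exists i.
have lt_card : (#|[set i | (g i < tau)%R]%SET| < m)%N.
  rewrite ltnS in hm; apply: leq_trans hm; apply: proper_card; apply/properP; split.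
    by apply/fintype.subsetP => i; rewrite !inE => h; exact: lt_trans gt.
  by exists i0; rewrite !inE gi0 ?ltxx.
apply: le_trans (scheme_step_moment t0T') _; rewrite -/tau -/C.
apply: le_trans (lee_wpmul2l _ (IHm tau lt_card tauT)) _; first by rewrite lee_fin expR_ge0.
by rewrite muleA -EFinM -expRD -mulrDr subrK.
Qed.
End tamed_scheme.

Theorem corollary4p15
  (R : realType) (eta gamma T eps delta c : R)
  (heta : 0 < eta) (hgamma : 1 / 2 < gamma) (hT : 0 < T) (heps : 0 < eps)
  (hdelta : 0 < delta < 1 / 18)
  (UU H HH : set (Uspace R))
  (hUU : orthonormal_basis [set: Uspace R] UU)
  (hH : closed_subspace H)
  (hHH : orthonormal_basis H HH) (hHH0 : HH !=set0)
  (lam : Uspace R -> R)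
  (hlam : (ereal_sup [set (lam h)%:E | h in HH] < 0)%E)
  (d : measure_display) (Omega : measurableType d) (P : probability Omega R)
  (Ft : R -> set (set Omega)) (hFt : filtration T Ft)
  (W : R -> Uspace R -> Omega -> R) (hW : cyl_wiener P T Ft W)
  (Q sqrtQ projH : Uspace R -> Uspace R)
  (hQ : bounded_linear Q) (hQsym : symmetric_op Q) (hQnneg : nonneg_op Q)
  (hQtr : trace_class Q) (hsqrtQ : is_sqrt_op Q sqrtQ)
  (hprojH : orth_projection H projH)
  (r : Uspace R -> R)
  (hr0 : forall v, Hs H HH lam gamma v -> 0 <= r v)
  (hrm : forall E : set (measurableTypeR R), measurable E ->
     borel_on (Hs H HH lam gamma) (Hs_norm HH lam gamma)
       (Hs H HH lam gamma `&` r @^-1` E))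
  (b : plane R -> plane R -> 'M[R]_2)
  (hbm : forall i j : 'I_2,
     measurable_fun (@sqD R `*` [set: plane R])
       (fun p => b p.1 p.2 i j : measurableTypeR R))
  (hb : (ereal_sup
     [set q | exists x y z : plane R, [/\ sqD x, z <> y &
        q = (opnorm (b x y) +
             opnorm (b x y - b x z) / pnorm (psub y z))%:E]] < +oo)%E)
  (vartheta : R)
  (hvartheta : vartheta = optrace UU Q *
     sup [set q | exists x y : plane R, sqD x /\ q = opnorm (b x y)] ^+ 2)
  (hc : 2 * Num.max 1 (Num.max (eps * Num.sqrt vartheta) eps) <= c)
  (F : Uspace R -> Uspace R) (B : Uspace R -> Uspace R -> Uspace R)
  (xi : Omega -> Uspace R)
  (hFH : forall w, Hs H HH lam gamma w -> H (F w))
  (hBHS : forall w, Hs H HH lam gamma w -> hilbert_schmidt UU H (B w))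
  (hxi : forall om, Hs H HH lam gamma (xi om))
  (hxim : forall A, borel_on (Hs H HH lam gamma) (Hs_norm HH lam gamma) A ->
     Ft 0 (xi @^-1` A))
  (hxiexp : ('E_P[fun om => expR (eps * `|xi om| ^+ 2)] < +oo)%E)
  (hB : forall (v : plane R -> plane R) (w : Uspace R),
     is_class v w -> Hs H HH lam gamma w ->
     forall u, B w u =
       projH (cls (fun x => mxact (b x (v x)) (Uval (sqrtQ u) x))))
  (hF : forall (w : Uspace R) (dw : 'I_2 -> Uspace R),
     Hs H HH lam gamma w -> (forall i, is_wderiv i w (dw i)) ->
     ess_bounded w ->
     F w = projH (eta *: w -
       \sum_(i < 2) cls (fun x => pscale (pcoord i (Uval w x)) (Uval (dw i) x))))
  (Y : set R -> set (Uspace R) -> set (Uspace R) -> R -> Omega -> Uspace R)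
  (hYval : forall theta I J, grid T theta -> finsub HH I -> finsub UU J ->
     forall t om, 0 <= t <= T -> (projI I @` H) (Y theta I J t om))
  (hYadapted : forall theta I J, grid T theta -> finsub HH I -> finsub UU J ->
     forall t, 0 <= t <= T ->
     forall A, borel_on (projI I @` H) (fun v => `|v|) A ->
     Ft t (Y theta I J t @^-1` A))
  (hYcont : forall theta I J, grid T theta -> finsub HH I -> finsub UU J ->
     forall om, {within `[0, T], continuous (fun t => Y theta I J t om)})
  (hY0 : forall theta I J, grid T theta -> finsub HH I -> finsub UU J ->
     forall om, Y theta I J 0 om = projI I (xi om))
  (hY : forall theta I J, grid T theta -> finsub HH I -> finsub UU J ->
     forall t, 0 < t <= T ->
     let tau := gfloor theta t in
     let Ytau := Y theta I J tau in
     let chi := fun om =>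
       if r (Ytau om) <= c * mesh theta `^ (- delta) then 1 else 0 in
     let S := semigroup HH lam (t - tau) in
     {ae P, forall om,
       Y theta I J t om =
         S (Ytau om + (chi om * (t - tau)) *: projI I (F (Ytau om))) +
         (1 + `| stoch_int UU W
                   (fun om u => projI I (B (Ytau om) (projI J u)))
                   tau t om | ^+ 2)^-1 *:
         stoch_int UU W
           (fun om u => S (chi om *: projI I (B (Ytau om) (projI J u))))
           tau t om})
  (vphi : int -> R -> R) (phi : int -> int -> R * R -> R)
  (e : int -> int -> Uspace R) (e001 : Uspace R)
  (hvphic : forall k, {within `]0, 1[, continuous (vphi k)})
  (hphic : forall k l, {within (@sqD R : set (R * R)), continuous (phi k l)})
  (hHHe : HH = [set e001] `|` [set h | exists i j, h = e i j])
  (hvphi0 : forall x, 0 < x < 1 -> vphi 0 x = 1)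
  (hvphicos : forall (n : nat) x, (0 < n)%N -> 0 < x < 1 ->
     vphi n%:Z x = Num.sqrt 2 * cos (2 * n%:R * pi * x))
  (hvphisin : forall (n : nat) x, (0 < n)%N -> 0 < x < 1 ->
     vphi (- n%:Z) x = Num.sqrt 2 * sin (2 * n%:R * pi * x))
  (hphi : forall (k l : int) (x y : R), (k, l) <> (0, 0) ->
     0 < x < 1 -> 0 < y < 1 -> phi k l (x, y) = vphi k x * vphi l y)
  (he000 : is_class (fun=> (1, 0)) (e 0 0))
  (he001 : is_class (fun=> (0, 1)) e001)
  (he : forall k l : int, (k, l) <> (0, 0) ->
     is_class (fun x => pscale (Num.sqrt (k ^+ 2 + l ^+ 2)%:~R)^-1
                 (l%:~R * phi k l x, k%:~R * phi (- k) (- l) x)) (e k l))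
  (hlame : forall k l : int, (k, l) <> (0, 0) ->
     lam (e k l) = - eta - 4 * pi ^+ 2 * (k ^+ 2 + l ^+ 2)%:~R)
  (hlam000 : lam (e 0 0) = - eta) (hlam001 : lam e001 = - eta)
  (hr : forall v, Hs H HH lam gamma v ->
     (maxe (Num.sqrt vartheta + eps * `|v| ^+ 2)%:E
        ((eta * `|v|)%:E +
         6%:E * ((eta `^ (- 2 * gamma))%:E +
           \esum_(ij in [set: int * int])
             ((eta + 4 * pi ^+ 2 * (ij.1 ^+ 2 + ij.2 ^+ 2)%:~R)
                `^ (- 2 * gamma))%:E) `^ (1 / 2) *
         (Hs_norm HH lam gamma v ^+ 2)%:E) <= (r v)%:E)%E) :
  (ereal_sup [set q | exists theta I J t,
     [/\ grid T theta, finsub HH I, finsub UU J, (0 <= t <= T)%R &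
      q = 'E_P[fun om => expR (eps * `|Y theta I J t om| ^+ 2 /
                               expR (2 * (eta + eps * vartheta) * t))]]]
   < +oo)%E.
Proof.
have oUU : Defs.orthonormal UU by case: hUU.
have oHH : Defs.orthonormal HH by case: hHH.
have vt0 : 0 <= vartheta.
  (* The empty family in [optrace_ge] shows that the trace is nonnegative. *)
  rewrite hvartheta mulr_ge0 ?sqr_ge0//; pose no (i : 'I_0) : Uspace R := 0.
  have := @optrace_ge _ Q UU 0 no hQtr hQnneg oUU.
  by rewrite big_ord0; apply; case.
have c0 : 0 <= c.
  by apply: le_trans hc; rewrite mulr_ge0// le_max ler01.
have lam0 h : HH h -> lam h <= 0.
  move=> HHh; apply: le_trans (_ : - eta <= 0); last by rewrite oppr_le0 ltW.
  exact: (stokes_lam_lt0 hHHe hvphi0 hvphicos hvphisin hphi he000 he001 he hlame hlam000 hlam001).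
pose C := step_const eta eps vartheta T (4 * T + 4 * c ^+ 3 * (1 + T)).
have C0 : 0 <= C.
  have c3 : 0 <= c ^+ 3 by exact: exprn_ge0.
  by apply: step_const_ge0; rewrite ?(ltW heta) ?(ltW heps) ?(ltW hT)// !(addr_ge0, mulr_ge0)// ltW.
(* [C] is fixed before the grid and the index sets are introduced, so this single finite bound
   serves the whole supremum. *)
apply: (@le_lt_trans _ _ ((expR (C * T))%:E * 'E_P[fun om => expR (eps * `|xi om| ^+ 2)])%E); last first.
  by apply: lte_mul_pinfty; rewrite ?lee_fin ?expR_ge0.
apply: ge_ereal_sup => _ [theta [I [J [t [gth fI fJ t0T ->]]]]].
have [K [f [fi fE]]] := finite_family fI.1; have [n [g [gi gE]]] := finite_family fJ.1.
have fHH i : HH (f i) by apply: fI.2; rewrite -fE; exists i.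
have gUU j : UU (g j) by apply: fJ.2; rewrite -gE; exists j.
have modes i : exists m : (R * R -> R * R) * ('I_2 -> R * R -> R * R) *
    ('I_2 -> R * R -> R * R) * R,
    [/\ is_class m.1.1.1 (f i), mode m.1.1.1 m.1.1.2 m.1.2 m.2 & lam (f i) = - eta - m.2].
  have [V [V1 [V2 [m [h1 h2 h3]]]]] := stokes_mode hHHe hvphi0 hvphicos hvphisin hphi
    he000 he001 he hlame hlam000 hlam001 (fHH i).
  by exists (V, V1, V2, m).
have {modes}[m mP] := choice modes.
pose V i := (m i).1.1.1.
have Vf i : is_class (V i) (f i) by case: (mP i).
have Vm i : mode (V i) (m i).1.1.2 (m i).1.2 (m i).2 by case: (mP i).
have lm i : lam (f i) = - eta - (m i).2 by case: (mP i).
have bV i : bc_field (V i) by case: (periodic_field_bc (mode_deriv (Vm i) 0)).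
have trc := stokes_trace gamma hHHe hlame hlam000 hlam001 fi fHH.
have noise_le x : \sum_k \sum_j diffusion B f x k (g j) ^+ 2 <= vartheta.
  rewrite hvartheta.
  exact: (diffusion_bound oUU hH hHH hprojH hQnneg hQtr hsqrtQ hbm hb hB fi fHH Vf bV).
have Yval := @hYval theta I J gth fI fJ.
have Yad := @hYadapted theta I J gth fI fJ.
have Ystep := @hY theta I J gth fI fJ.
have Y0 := @hY0 theta I J gth fI fJ.
rewrite -fE -gE in Yval Yad Ystep Y0 *.
have := @scheme_moment R _ Omega P eta gamma T eps delta c vartheta UU H HH lam heta hT heps
  hdelta c0 vt0 oUU hH hHH lam0 Ft W hFt hW r F B hrm hBHS K n f g theta fi fHH gi gUU gth
  (drift_energy hH hHH hprojH hF fi fHH Vf Vm)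
  (drift_norm heta hgamma hH hHH hprojH hF hr fi fHH trc Vf Vm lm)
  (growth_ge hH hHH hr fi fHH) (measurable_drift hH hHH hprojH hF fi fHH Vf Vm)
  noise_le (measurable_diffusion hH hHH hprojH hsqrtQ hbm hb hB fi fHH Vf bV)
  (Y theta (range f) (range g)) Yval Yad Ystep t t0T.
rewrite unlock => /le_trans; apply; apply: lee_pmul.
- by rewrite lee_fin expR_ge0.
- by apply: integral_ge0 => om _; rewrite lee_fin expR_ge0.
- by rewrite lee_fin ler_expR ler_wpM2l//; case/andP: t0T.
apply: le_integral_nonneg => om; first by rewrite lee_fin expR_ge0.
rewrite lee_fin ler_expR (ler_pM2l heps).
(* The scheme starts at the projection of [xi], whose norm is at most that of [xi] by Bessel's
   inequality. *)
rewrite Y0 (projI_family fi) (orthonormal_norm (orthonormal_family oHH fi fHH)).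
exact: (bessel (orthonormal_family oHH fi fHH)).
Qed.
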